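(* Let $k$ be a field of characteristic zero with algebraic closure $\bar{k}$. Let $\mathfrak{R}=k[x_0^2,x_0x_1,x_1x_2,x_2^2]$ be the ring defined in the context, and let $X=\mathrm{Spec}(\mathfrak{R})$. Let $\mathfrak{R}[V]\cong\mathfrak{R}^{[1]}$ be the polynomial ring in one variable $V$ over $\mathfrak{R}$ and define $$F=15x_0^2V-3(x_0x_1)(x_2^2)-2(x_1x_2)\quad\text{and}\quad\tilde{\mathfrak{R}}=\mathfrak{R}[V]/(F).$$ Let $\tilde{X}=\mathrm{Spec}(\tilde{\mathfrak{R}})$. Then: (a) $X\times\mathbb{A}_k^1\cong_k\tilde{X}\times\mathbb{A}_k^1$. (b) $X\not\cong_k\tilde{X}$. (c) $\tilde{X}$ admits an effective $\mathbb{G}_a\rtimes\mathbb{G}_m$-action where the $\mathbb{G}_a$-action is fixed-point free. (d) If $k=\bar{k}$ then $\tilde{\mathfrak{R}}\in\mathcal{C}(k)$ and $\mathrm{Cl}(\tilde{\mathfrak{R}})=\mathbb{Z}_2$.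
   Context: Let $\mathfrak{D}=k[x_0,x_1,x_2]$ with $2x_0x_2-x_1^2=1$, i.e. $\mathfrak{D}$ is the quotient of the polynomial ring $k[X_0,X_1,X_2]$ by the ideal $(2X_0X_2-X_1^2-1)$. Let $\mu$ be the $k$-automorphism of $\mathfrak{D}$ with $\mu(x_i)=-x_i$ for $i=0,1,2$, and let $\mathfrak{R}=\mathfrak{D}^{\langle\mu\rangle}=k[x_0^2,x_0x_1,x_0x_2,x_1^2,x_1x_2,x_2^2]$; it is generated as a $k$-algebra by $x_0^2,x_0x_1,x_1x_2,x_2^2$. $\cong_k$ denotes isomorphism of $k$-algebras or of algebraic $k$-varieties. $\mathbb{G}_a$ is the additive group $k$ and $\mathbb{G}_m$ the multiplicative group $k^*$. $\mathrm{Cl}$ denotes the divisor class group and $\mathbb{Z}_2=\mathbb{Z}/2\mathbb{Z}$. $B^{[n]}$ denotes the polynomial ring in $n$ variables over $B$. For an affine $k$-domain $B$, $\mathrm{LND}(B)$ is the set of locally nilpotent $k$-derivations of $B$ (those $D$ such that for each $b\in B$, $D^nb=0$ for $n\gg0$), and $ML(B)=\bigcap_{D\in\mathrm{LND}(B)}\ker D$. $\mathcal{C}(k)$ is the class of rings $B$ such that: $B$ is a normal affine $k$-domain, $\dim B=2$, $B^*=k^*$ and $ML(B)\neq B$; and $\ker D\cong_k k^{[1]}$ for every nonzero $D\in\mathrm{LND}(B)$. *)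

(* Defs.v *)
From HB Require Import structures.
From mathcomp Require Import all_boot all_order all_algebra.
From mathcomp Require Import generic_quotient ring_quotient.
From mathcomp Require Import boolp.
From mathcomp Require Import freeg mpoly.

Set Implicit Arguments.
Unset Strict Implicit.
Unset Printing Implicit Defensive.
Set Warnings "-redundant-canonical-projection".

Import GRing.Theory.
Local Open Scope ring_scope.
Local Open Scope quotient_scope.

Section QuotientAlgebra.
Variables (k : fieldType) (A : comAlgType k) (I : idealr A).

Definition quot_scale (c : k) (x : {ideal_quot I}) : {ideal_quot I} :=
  \pi_({ideal_quot I}) (c%:A) * x.

Fact quot_scaleA a b v : quot_scale a (quot_scale b v) = quot_scale (a * b) v.
Proof. by rewrite /quot_scale mulrA -rmorphM -scalerAl mul1r scalerA. Qed.

Fact quot_scale1 : left_id 1 quot_scale.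
Proof. by move=> v; rewrite /quot_scale scale1r rmorph1 mul1r. Qed.

Fact quot_scaleDr : right_distributive quot_scale +%R.
Proof. by move=> c u v; rewrite /quot_scale mulrDr. Qed.

Fact quot_scaleDl v : {morph quot_scale^~ v : a b / a + b}.
Proof. by move=> a b; rewrite /quot_scale scalerDl rmorphD mulrDl. Qed.

HB.instance Definition _ := GRing.Zmodule_isLmodule.Build k {ideal_quot I}
  quot_scaleA quot_scale1 quot_scaleDr quot_scaleDl.

Fact quot_scaleAl (c : k) (x y : {ideal_quot I}) : c *: (x * y) = c *: x * y.
Proof. exact: mulrA. Qed.

HB.instance Definition _ :=
  GRing.Lmodule_isLalgebra.Build k {ideal_quot I} quot_scaleAl.
HB.instance Definition _ :=
  GRing.Lalgebra_isComAlgebra.Build k {ideal_quot I}.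

Fact pi_quot_scalable : scalable (\pi_({ideal_quot I}) : A -> {ideal_quot I}).
Proof. by move=> c x; rewrite -[x in LHS]mul1r scalerAl rmorphM. Qed.

HB.instance Definition _ :=
  GRing.isScalable.Build k A {ideal_quot I} *:%R
    (\pi_({ideal_quot I}) : A -> {ideal_quot I}) pi_quot_scalable.

Definition quot_alg : comAlgType k := {ideal_quot I}.

Definition quot_pi : A -> quot_alg := \pi_({ideal_quot I}).
HB.instance Definition _ := GRing.LRMorphism.copy quot_pi
  (\pi_({ideal_quot I}) : A -> {ideal_quot I}).

Lemma quot_piP (x : quot_alg) : exists a, x = quot_pi a.
Proof. by exists (repr x); rewrite /quot_pi reprK. Qed.

Lemma quot_pi_eq (a b : A) : (quot_pi a == quot_pi b) = (a - b \in I).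
Proof. by rewrite Quotient.idealrBE. Qed.

Section Lift.
Variables (B : nzRingType) (f : {rmorphism A -> B}).

(* The morphism induced by f when f vanishes on I. *)
Definition quot_lift (x : quot_alg) : B :=
  f (repr (x : {ideal_quot I})).

Hypothesis f0 : forall a, a \in I -> f a = 0.

Lemma quot_lift_pi a : quot_lift (quot_pi a) = f a.
Proof.
apply/eqP; rewrite -subr_eq0 -rmorphB; apply/eqP/f0.
by rewrite Quotient.idealrBE reprK.
Qed.

Fact quot_lift_zmod : zmod_morphism quot_lift.
Proof.
move=> x y; have [[a ->] [b ->]] := (quot_piP x, quot_piP y).
by rewrite -rmorphB !quot_lift_pi rmorphB.
Qed.

Fact quot_lift_monoid : monoid_morphism quot_lift.
Proof.
split=> [|x y]; first by rewrite -(rmorph1 quot_pi) quot_lift_pi rmorph1.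
have [[a ->] [b ->]] := (quot_piP x, quot_piP y).
by rewrite -rmorphM !quot_lift_pi rmorphM.
Qed.

End Lift.

Fact quot_lift_scalable (B : comAlgType k) (f : {lrmorphism A -> B}) :
  (forall a, a \in I -> f a = 0) -> scalable (quot_lift f).
Proof.
move=> f0 c x; have [a ->] := quot_piP x.
have <- : quot_pi (c *: a) = c *: quot_pi a by rewrite linearZ.
by rewrite (quot_lift_pi f0) (quot_lift_pi f0); apply: (linearZ_LR f).
Qed.
End QuotientAlgebra.

Definition principal_ideal (k : fieldType) (A : comAlgType k) (f : A) : A -> bool :=
  fun a => `[< exists b, a = b * f >].

Lemma principal_idealr_closed (k : fieldType) (A : comAlgType k) (f : A)
    (C : nzRingType) (ev : {rmorphism A -> C}) :
  ev f = 0 -> idealr_closed (principal_ideal f).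
Proof.
move=> ef; split.
- by apply/asboolP; exists 0; rewrite mul0r.
- apply/negP => /asboolP[b /(congr1 ev)].
  by rewrite rmorph1 rmorphM ef mulr0 => /eqP; rewrite oner_eq0.
- move=> a u v /asboolP[b ->] /asboolP[c ->]; apply/asboolP.
  by exists (a * b + c); rewrite mulrDl mulrA.
Qed.

(* The ring A[V] as a k-algebra; the library only makes {poly A} an algebra
   over A itself. *)
Definition poly_alg (k : fieldType) (A : comAlgType k) : Type := {poly A}.

Section PolyAlgebra.
Variables (k : fieldType) (A : comAlgType k).

HB.instance Definition _ := GRing.ComNzRing.on (poly_alg A).

Definition poly_alg_scale (c : k) (p : poly_alg A) : poly_alg A :=
  (c%:A : A)%:P * (p : {poly A}).

Fact poly_alg_scaleA a b v :
  poly_alg_scale a (poly_alg_scale b v) = poly_alg_scale (a * b) v.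
Proof. by rewrite /poly_alg_scale mulrA -polyCM -scalerAl mul1r scalerA. Qed.

Fact poly_alg_scale1 : left_id 1 poly_alg_scale.
Proof. by move=> v; rewrite /poly_alg_scale scale1r mul1r. Qed.

Fact poly_alg_scaleDr : right_distributive poly_alg_scale +%R.
Proof. by move=> c u v; rewrite /poly_alg_scale mulrDr. Qed.

Fact poly_alg_scaleDl v : {morph poly_alg_scale^~ v : a b / a + b}.
Proof. by move=> a b; rewrite /poly_alg_scale scalerDl polyCD mulrDl. Qed.

HB.instance Definition _ := GRing.Zmodule_isLmodule.Build k (poly_alg A)
  poly_alg_scaleA poly_alg_scale1 poly_alg_scaleDr poly_alg_scaleDl.

Fact poly_alg_scaleAl (c : k) (x y : poly_alg A) : c *: (x * y) = c *: x * y.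
Proof. exact: mulrA. Qed.

HB.instance Definition _ :=
  GRing.Lmodule_isLalgebra.Build k (poly_alg A) poly_alg_scaleAl.
HB.instance Definition _ := GRing.Lalgebra_isComAlgebra.Build k (poly_alg A).
End PolyAlgebra.

Fact horner0_eq0 (A : comNzRingType) (C : nzRingType) (f : {rmorphism A -> C})
    (a b c d : A) : f b = 0 -> f d = 0 ->
  f (15%:R * a%:P * 'X - 3%:R * b%:P * c%:P - 2%:R * d%:P).[0] = 0.
Proof.
move=> fb fd; rewrite !(hornerD, hornerN) -!polyC_natr !hornerM hornerX !hornerC.
by rewrite mulr0 sub0r rmorphB rmorphN !rmorphM fb fd !(mulr0, mul0r) ?oppr0 ?addr0 ?oppr0.
Qed.

Section TheRings.
Variable k : fieldType.

Definition relD : {mpoly k[3]} :=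
  2%:R * 'X_(0 : 'I_3) * 'X_(2%:R : 'I_3) - 'X_(1 : 'I_3) ^+ 2 - 1.

Definition idealD : {mpoly k[3]} -> bool := principal_ideal relD.

(* A k-point of the variety of relD in any characteristic; it shows that idealD
   and idealF are proper. *)
Definition ptD (i : 'I_3) : k :=
  if (2%:R : k) == 0 then (i == 1 :> nat)%:R
  else [:: 1; 0; (2%:R)^-1]`_i.

Fact ptD_relD : meval ptD relD = 0.
Proof.
rewrite /relD !rmorphB !rmorphM rmorph1 rmorph_nat /= !mevalXU /ptD /=.
case: ifP => [/eqP e|/negbT ne].
  by rewrite !mulr0 mulr1 sub0r -opprD -[1 + 1]/(2%:R) e oppr0.
by rewrite mulr1 mulfV // mul0r subr0 subrr.
Qed.

HB.instance Definition _ := isIdealr.Build {mpoly k[3]} idealD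
  (principal_idealr_closed ptD_relD).

Definition ringD : comAlgType k := quot_alg idealD.

Definition xD (i : 'I_3) : ringD := quot_pi idealD 'X_i.

Local Notation x0 := (xD 0).
Local Notation x1 := (xD 1).
Local Notation x2 := (xD 2%:R).

Lemma xD_rel : 2%:R * x0 * x2 - x1 ^+ 2 = 1.
Proof.
apply/eqP; rewrite -subr_eq0.
have -> : 2%:R * x0 * x2 - x1 ^+ 2 - 1 = quot_pi idealD relD.
  by rewrite /relD !rmorphB !rmorphM rmorph1 rmorph_nat.
rewrite -(rmorph0 (quot_pi idealD)) quot_pi_eq subr0.
by apply/asboolP; exists 1; rewrite mul1r.
Qed.

Definition negX : {mpoly k[3]} -> ringD :=
  quot_pi idealD \o comp_mpoly [tuple - 'X_i | i < 3].
HB.instance Definition _ := GRing.LRMorphism.on negX.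

Fact negX_X i : negX 'X_i = - xD i.
Proof.
by rewrite /negX /= comp_mpolyXU -tnth_nth tnth_mktuple rmorphN.
Qed.

Fact negX_relD : negX relD = 0.
Proof.
rewrite /relD !rmorphB !rmorphM rmorph1 rmorph_nat /= !negX_X.
by rewrite !(mulrN, mulNr) !opprK -expr2 xD_rel subrr.
Qed.

Fact negX_ideal a : a \in (idealD : idealr {mpoly k[3]}) -> negX a = 0.
Proof. by case/asboolP=> b ->; rewrite rmorphM /= negX_relD mulr0. Qed.

Definition mu : ringD -> ringD := quot_lift negX.
HB.instance Definition _ := GRing.isZmodMorphism.Build ringD ringD mu
  (quot_lift_zmod negX_ideal).
HB.instance Definition _ := GRing.isMonoidMorphism.Build ringD ringD mu
  (quot_lift_monoid negX_ideal).
HB.instance Definition _ := GRing.isScalable.Build k ringD ringD *:%R mu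
  (quot_lift_scalable negX_ideal).

Lemma mu_xD i : mu (xD i) = - xD i.
Proof. by rewrite -negX_X; exact: (quot_lift_pi negX_ideal). Qed.

Definition mu_fixed : {pred ringD} := fun x => mu x == x.

Fact mu_fixed_subalg : subalg_closed mu_fixed.
Proof.
split=> [|c x y|x y]; rewrite !unfold_in ?rmorph1 ?linearP ?rmorphM //=.
- by move=> /eqP -> /eqP ->.
- by move=> /eqP -> /eqP ->.
Qed.

HB.instance Definition _ :=
  GRing.isSubalgClosed.Build k ringD mu_fixed mu_fixed_subalg.

Definition ringR_type : Type := {x : ringD | x \in mu_fixed}.
HB.instance Definition _ := SubChoice.on ringR_type.
HB.instance Definition _ := [SubChoice_isSubAlgebra of ringR_type by <:].
HB.instance Definition _ := [SubNzRing_isSubComNzRing of ringR_type by <:].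
Definition ringR : comAlgType k := ringR_type.

Fact xD_mul_fixed i j : xD i * xD j \in mu_fixed.
Proof. by rewrite unfold_in /mu_fixed rmorphM /= !mu_xD mulrNN. Qed.

Definition rx (i j : 'I_3) : ringR := exist _ (xD i * xD j) (xD_mul_fixed i j).

Definition polyF : poly_alg ringR :=
  (15%:R * (rx 0 0)%:P * 'X - 3%:R * (rx 0 1)%:P * (rx 2%:R 2%:R)%:P
   - 2%:R * (rx 1 2%:R)%:P : {poly ringR}).

Definition idealF : poly_alg ringR -> bool := principal_ideal polyF.

Fact meval_ptD_ideal a : a \in (idealD : idealr {mpoly k[3]}) -> meval ptD a = 0.
Proof. by case/asboolP=> b ->; rewrite rmorphM /= ptD_relD mulr0. Qed.

Definition evD : ringD -> k := quot_lift (meval ptD).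
HB.instance Definition _ := GRing.isZmodMorphism.Build ringD k evD
  (quot_lift_zmod meval_ptD_ideal).
HB.instance Definition _ := GRing.isMonoidMorphism.Build ringD k evD
  (quot_lift_monoid meval_ptD_ideal).

Fact evD_xD i : evD (xD i) = ptD i.
Proof. by rewrite -[RHS]mevalXU; exact: (quot_lift_pi meval_ptD_ideal). Qed.

Definition evR : ringR -> k := evD \o (val : ringR -> ringD).
HB.instance Definition _ := GRing.RMorphism.on evR.

Fact evR_rx i j : evR (rx i j) = ptD i * ptD j.
Proof. by rewrite /evR /= rmorphM /= !evD_xD. Qed.

Definition evRV : poly_alg ringR -> k :=
  evR \o (horner_eval 0 : {poly ringR} -> ringR).
HB.instance Definition _ := GRing.RMorphism.on evRV.

Fact evRV_polyF : evRV polyF = 0.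
Proof.
apply: (horner0_eq0 (f := evR)); apply: etrans (evR_rx _ _) _;
  rewrite /ptD; case: ifP => _ /=.
- by rewrite mul0r.
- by rewrite mulr0.
- by rewrite mulr0.
- by rewrite mul0r.
Qed.

HB.instance Definition _ := isIdealr.Build (poly_alg ringR) idealF
  (principal_idealr_closed evRV_polyF).

Definition ringRt : comAlgType k := quot_alg idealF.
End TheRings.

Section CommutativeAlgebra.
Variables (k : fieldType) (B : comAlgType k).
Implicit Types (P Q : {pred B}) (D : {linear B -> B}) (b : B).

Definition affine_alg : Prop :=
  exists (n : nat) (f : {lrmorphism {mpoly k[n]} -> B}), forall b, exists p, f p = b.

Definition is_domain : Prop := forall a b : B, a * b = 0 -> a = 0 \/ b = 0.

Definition normal_domain : Prop :=
  is_domain /\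
  exists (K : fieldType) (i : {rmorphism B -> K}),
    [/\ injective i,
        forall z, exists a b, b != 0 /\ z = i a / i b
      & forall z, integralOver i z -> exists a, z = i a].

Definition prime_ideal P : Prop := idealr_closed P /\ prime_idealr_closed P.

Definition prime_chain (c : nat -> {pred B}) (n : nat) : Prop :=
  (forall i, (i <= n)%N -> prime_ideal (c i)) /\
  (forall i, (i < n)%N ->
     {subset c i <= c i.+1} /\ exists2 b, b \in c i.+1 & b \notin c i).

Definition krull_dim_eq (n : nat) : Prop :=
  (exists c, prime_chain c n) /\ forall c m, prime_chain c m -> (m <= n)%N.

Definition height_eq P (n : nat) : Prop :=
  (exists2 c, prime_chain c n & c n =i P) /\
  forall c m, prime_chain c m -> c m =i P -> (m <= n)%N.

Definition units_are_scalars : Prop :=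
  forall u v : B, u * v = 1 -> exists c : k, u = c%:A.

Definition derivation D : Prop := forall a b, D (a * b) = D a * b + a * D b.

Definition LND D : Prop := derivation D /\ forall b, exists n, iter n D b = 0.

Definition ML b : Prop := forall D, LND D -> D b = 0.

(* ker D is isomorphic to a polynomial ring in one variable over k. *)
Definition kernel_is_line D : Prop :=
  exists f : {lrmorphism {poly k} -> B},
    injective f /\ forall b, D b = 0 <-> exists p, f p = b.

Definition classC : Prop :=
  [/\ affine_alg /\ normal_domain,
      krull_dim_eq 2,
      units_are_scalars,
      exists b, ~ ML b
    & forall D, LND D -> (exists b, D b != 0) -> kernel_is_line D].

(* The n-th power of P, as the ideal generated by the n-fold products. *)
Definition ideal_pow P (n : nat) b : Prop :=
  exists (m : nat) (c : 'I_m -> B) (a : 'I_m -> 'I_n -> B),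
    (forall i j, a i j \in P) /\ b = \sum_i c i * \prod_j a i j.

Definition local_ideal_pow P (n : nat) b : Prop :=
  exists2 s, s \notin P & ideal_pow P n (s * b).

(* The valuation of b at the height-one prime P: b lies in P^n B_P but not in
   P^(n+1) B_P. *)
Definition ord_at P b (n : nat) : Prop :=
  local_ideal_pow P n b /\ ~ local_ideal_pow P n.+1 b.

Definition height_one (P : B -> bool) : bool :=
  `[< prime_ideal P /\ height_eq P 1 >].

Definition prime_divisor : Type := {P : B -> bool | height_one P}.
HB.instance Definition _ := Choice.on prime_divisor.

Definition Div : Type := {freeg prime_divisor / int}.
HB.instance Definition _ := GRing.Zmodule.on Div.

Definition div_eq b (E : Div) : Prop :=
  forall P : prime_divisor, exists2 n : nat, ord_at (val P) b n & coeff P E = n%:Z.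

(* The subgroup generated by the divisors of the nonzero elements of B, that is,
   the divisors of the nonzero elements of its fraction field. *)
Definition principal_div : Div -> bool := fun E =>
  `[< forall S : {pred Div}, zmod_closed S ->
        (forall b E', b != 0 -> div_eq b E' -> E' \in S) -> E \in S >].

Fact principal_div_closed : zmod_closed principal_div.
Proof.
split=> [|E E' /asboolP h /asboolP h']; apply/asboolP => S Sz Sd; first by case: Sz.
by case: (Sz) => _; apply; [apply: h | apply: h'].
Qed.
HB.instance Definition _ :=
  GRing.isZmodClosed.Build Div principal_div principal_div_closed.

Definition Cl : zmodType := Quotient.quot (GRing.ZmodClosed.clone _ principal_div _).
End CommutativeAlgebra.

Definition group_isomorphic (U V : zmodType) : Prop :=
  exists2 f : U -> V, {morph f : x y / x + y} & bijective f.

(* k-schemes as functors of points.  An affine k-scheme is a representable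
   functor, a morphism is a natural transformation.  Test algebras range over
   nonzero commutative k-algebras. *)
Record kfunctor (k : fieldType) : Type := KFunctor {
  pts :> comAlgType k -> Type;
  res : forall A A' : comAlgType k, {lrmorphism A -> A'} -> pts A -> pts A';
  res_id : forall (A : comAlgType k) (f : {lrmorphism A -> A}),
    f =1 id -> res f =1 id;
  res_comp : forall (A A' A'' : comAlgType k) (f : {lrmorphism A -> A'})
    (g : {lrmorphism A' -> A''}) (h : {lrmorphism A -> A''}),
    h =1 g \o f -> res h =1 res g \o res f }.

Record kmorphism (k : fieldType) (X Y : kfunctor k) : Type := KMorphism {
  mor :> forall A : comAlgType k, X A -> Y A;
  mor_nat : forall (A A' : comAlgType k) (f : {lrmorphism A -> A'}) (x : X A),
    mor (res f x) = res f (mor x) }.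

Definition kisomorphic (k : fieldType) (X Y : kfunctor k) : Prop :=
  exists (f : kmorphism X Y) (g : kmorphism Y X),
    (forall A, cancel (f A) (g A)) /\ (forall A, cancel (g A) (f A)).

Section Functors.
Variable k : fieldType.
Implicit Types A : comAlgType k.

Lemma lrmorph_ext A A' (f g : {lrmorphism A -> A'}) : f =1 g -> f = g.
Proof.
case: f g => [f cf] [g cg] /= /funext fg; rewrite {}fg in cf *.
congr GRing.LRMorphism.Pack.
case: cf cg => [[a] [b] [c]] [[a'] [b'] [c']].
by congr (GRing.LRMorphism.Class _ _ _); congr (_ _); exact: Prop_irrelevance.
Qed.

Section Spec.
Variable B : comAlgType k.

Definition spec_pts A : Type := {lrmorphism B -> A}.

Definition spec_res A A' (f : {lrmorphism A -> A'}) (x : spec_pts A) : spec_pts A' :=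
  f \o x : {lrmorphism B -> A'}.

Fact spec_res_id A (f : {lrmorphism A -> A}) : f =1 id -> spec_res f =1 id.
Proof. by move=> f1 x; apply: lrmorph_ext => b /=; rewrite f1. Qed.

Fact spec_res_comp A A' A'' (f : {lrmorphism A -> A'}) (g : {lrmorphism A' -> A''})
  (h : {lrmorphism A -> A''}) : h =1 g \o f -> spec_res h =1 spec_res g \o spec_res f.
Proof. by move=> hgf x; apply: lrmorph_ext => b /=; rewrite hgf. Qed.

Definition Spec : kfunctor k := KFunctor spec_res_id spec_res_comp.
End Spec.

Definition kprod (X Y : kfunctor k) : kfunctor k.
refine (@KFunctor k (fun A => X A * Y A)%type
  (fun A A' f xy => (res f xy.1, res f xy.2)) _ _).
- by move=> A f f1 [x y] /=; rewrite !res_id.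
- by move=> A A' A'' f g h hgf [x y] /=; rewrite !(res_comp hgf).
Defined.

Definition A1 : kfunctor k.
refine (@KFunctor k (fun A => A) (fun A A' f => f) _ _).
- by [].
- by [].
Defined.
End Functors.

Record kgroup (k : fieldType) : Type := KGroup {
  gfun :> kfunctor k;
  gmul : forall A : comAlgType k, gfun A -> gfun A -> gfun A;
  gone : forall A : comAlgType k, gfun A;
  ginv : forall A : comAlgType k, gfun A -> gfun A;
  gmulA : forall A, associative (@gmul A);
  gmul1g : forall A, left_id (gone A) (@gmul A);
  gmulg1 : forall A, right_id (gone A) (@gmul A);
  gmulVg : forall A, left_inverse (gone A) (@ginv A) (@gmul A);
  gmulgV : forall A, right_inverse (gone A) (@ginv A) (@gmul A);
  gmul_nat : forall (A A' : comAlgType k) (f : {lrmorphism A -> A'}),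
    {morph (res f : gfun A -> gfun A') : x y / gmul x y} }.

Record kaction (k : fieldType) (G : kgroup k) (X : kfunctor k) : Type := KAction {
  act :> forall A : comAlgType k, G A -> X A -> X A;
  act1 : forall A x, @act A (gone G A) x = x;
  actM : forall A g h x, @act A (gmul g h) x = act g (act h x);
  act_nat : forall (A A' : comAlgType k) (f : {lrmorphism A -> A'}) g x,
    res f (@act A g x) = act (res f g) (res f x) }.

Record kaut_action (k : fieldType) (H N : kgroup k) : Type := KAutAction {
  aut_act :> kaction H N;
  aut_actM : forall A (h : H A), {morph aut_act A h : n n' / gmul n n'} }.

Section Groups.
Variable k : fieldType.
Implicit Types A : comAlgType k.

Lemma res1 (G : kgroup k) A A' (f : {lrmorphism A -> A'}) :
  res f (gone G A) = gone G A'.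
Proof.
have e : gmul (res f (gone G A)) (res f (gone G A)) = res f (gone G A).
  by rewrite -gmul_nat gmul1g.
by rewrite -[LHS]gmul1g -(gmulVg (res f (gone G A))) -gmulA e.
Qed.

Lemma aut_act1 (H N : kgroup k) (phi : kaut_action H N) A (h : H A) :
  phi A h (gone N A) = gone N A.
Proof.
set n := phi A h _; have e : gmul n n = n by rewrite /n -aut_actM gmul1g.
by rewrite -[LHS]gmul1g -(gmulVg n) -gmulA e.
Qed.

Definition Ga : kgroup k.
refine (@KGroup k (A1 k) (fun A x y => x + y) (fun A => 0) (fun A x => - x)
  _ _ _ _ _ _).
- by move=> A; exact: addrA.
- by move=> A; exact: add0r.
- by move=> A; exact: addr0.
- by move=> A; exact: addNr.
- by move=> A; exact: addrN.
- by move=> A A' f x y; exact: rmorphD.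
Defined.

(* A unit of A together with its inverse. *)
Definition unit_pts A : Type := {t : A * A | t.1 * t.2 == 1}.

Fact unit_res_proof A A' (f : {lrmorphism A -> A'}) (t : unit_pts A) :
  f (val t).1 * f (val t).2 == 1.
Proof. by rewrite -rmorphM (eqP (valP t)) rmorph1. Qed.

Definition unit_res A A' (f : {lrmorphism A -> A'}) (t : unit_pts A) : unit_pts A' :=
  exist _ (f (val t).1, f (val t).2) (unit_res_proof f t).

Definition Gm_functor : kfunctor k.
refine (@KFunctor k unit_pts unit_res _ _).
- by move=> A f f1 t; apply: val_inj; rewrite /= !f1 -surjective_pairing.
- by move=> A A' A'' f g h hgf t; apply: val_inj; rewrite /= !hgf.
Defined.

Fact unit_mul_proof A (s t : unit_pts A) :
  ((val s).1 * (val t).1) * ((val s).2 * (val t).2) == 1.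
Proof. by rewrite mulrACA (eqP (valP s)) (eqP (valP t)) mulr1. Qed.

Definition unit_mul A (s t : unit_pts A) : unit_pts A :=
  exist _ ((val s).1 * (val t).1, (val s).2 * (val t).2) (unit_mul_proof s t).

Fact unit_one_proof A : (1 : A) * 1 == 1. Proof. by rewrite mulr1. Qed.

Definition unit_one A : unit_pts A := exist _ (1, 1) (unit_one_proof A).

Fact unit_inv_proof A (t : unit_pts A) : (val t).2 * (val t).1 == 1.
Proof. by rewrite mulrC (valP t). Qed.

Definition unit_inv A (t : unit_pts A) : unit_pts A :=
  exist _ ((val t).2, (val t).1) (unit_inv_proof t).

Definition Gm : kgroup k.
refine (@KGroup k Gm_functor unit_mul unit_one unit_inv _ _ _ _ _ _).
- by move=> A s t u; apply: val_inj; rewrite /= !mulrA.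
- by move=> A [[a b] ab]; apply: val_inj; rewrite /= !mul1r.
- by move=> A [[a b] ab]; apply: val_inj; rewrite /= !mulr1.
- by move=> A [[a b] ab]; apply: val_inj; rewrite /= mulrC (eqP ab).
- by move=> A [[a b] ab]; apply: val_inj; rewrite /= (eqP ab) mulrC (eqP ab).
- by move=> A A' f s t; apply: val_inj; rewrite /= !rmorphM.
Defined.

Definition sdprod (N H : kgroup k) (phi : kaut_action H N) : kgroup k.
refine (@KGroup k (kprod N H)
  (fun A x y => (gmul x.1 (phi A x.2 y.1), gmul x.2 y.2))
  (fun A => (gone N A, gone H A))
  (fun A x => (phi A (ginv x.2) (ginv x.1), ginv x.2)) _ _ _ _ _ _).
- by move=> A [n h] [n' h'] [n'' h''] /=; rewrite aut_actM actM !gmulA.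
- by move=> A [n h] /=; rewrite act1 !gmul1g.
- by move=> A [n h] /=; rewrite aut_act1 !gmulg1.
- by move=> A [n h] /=; rewrite -aut_actM !gmulVg aut_act1.
- by move=> A [n h] /=; rewrite -actM gmulgV act1 gmulgV.
- by move=> A A' f [n h] [n' h'] /=; rewrite !gmul_nat act_nat.
Defined.

Definition act_normal (N H : kgroup k) (phi : kaut_action H N) (X : kfunctor k)
  (rho : kaction (sdprod phi) X) : kaction N X.
refine (@KAction k N X (fun A n x => rho A (n, gone H A) x) _ _ _).
- by move=> A x; exact: (act1 rho).
- move=> A n n' x; rewrite -(actM rho) /=.
  by rewrite act1 gmul1g.
- by move=> A A' f n x; rewrite (act_nat rho) /= res1.
Defined.

Definition aut_trivial (H N : kgroup k) (phi : kaut_action H N) : Prop :=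
  forall A h n, phi A h n = n.

(* The kernel of the action, as a subgroup functor, is trivial. *)
Definition effective (G : kgroup k) (X : kfunctor k) (rho : kaction G X) : Prop :=
  forall A (g : G A),
    (forall A' (f : {lrmorphism A -> A'}) (x : X A'), rho A' (res f g) x = x) ->
    g = gone G A.

(* The fixed-point subfunctor has no point over a nonzero algebra. *)
Definition fixed_point_free (G : kgroup k) (X : kfunctor k) (rho : kaction G X) : Prop :=
  forall A (x : X A),
    ~ (forall A' (f : {lrmorphism A -> A'}) (g : G A'), rho A' g (res f x) = res f x).
End Groups.

(* Main.v *)
(* Let C_m be the ring of even functions on the surface x^(2m+1) z = y^2 + 1; then
   R = C_0 and R~ = C_1.
   (a) Both surfaces are torsors under translation in y over the same base, so their
   fibre product is a trivial line bundle over each of them (Danielewski's trick).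
   (b) Comparing leading monomials, every locally nilpotent derivation of C_1 kills
   a = x^2.  On C_0 the symmetry exchanging x and z turns the translation that fixes x
   into one that fixes z, and only scalars are killed by both.
   (c) The translation y -> y + t x^3 has no fixed point because y^2 = -1 on x = 0; the
   torus acts by scaling x and z.
   (d) Away from a = 0 the ring is k[a, 1/a, b] with b = x y, which is factorial.
   Across a = 0 it is controlled by a chart psi into k[x, Y], parametrizing the surface
   modulo x^2, such that a divides r as soon as x^2 divides psi r.  The reduced fibre
   P0 over a = 0 satisfies div a = 2 P0 and ord b = 1 at P0, so P0 generates the class
   group; the homomorphism theta, which sends P0 to 1 and kills the divisors of the
   local equations of all other primes, is even on principal divisors. *)

Require Import Defs.
From HB Require Import structures.
From mathcomp Require Import all_boot all_order all_algebra.
From mathcomp Require Import generic_quotient ring_quotient.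
From mathcomp Require Import boolp.
From mathcomp Require Import freeg mpoly.
From mathcomp Require Import ring zify.

Set Implicit Arguments.
Unset Strict Implicit.
Unset Printing Implicit Defensive.

Import GRing.Theory.
Local Open Scope ring_scope.

(** * Normal forms *)

Lemma lincomb (V : zmodType) (u v a b : V) : u = v -> a - b = u - v -> a = b.
Proof. by move=> -> /eqP; rewrite subrr subr_eq0 => /eqP. Qed.

Lemma eqD (V : zmodType) (u v a b : V) : u = v -> a = b -> u + a = v + b.
Proof. by move=> -> ->. Qed.

Lemma eqM (A : nzRingType) (c u v : A) : u = v -> c * u = c * v.
Proof. by move=> ->. Qed.

Lemma mulr1_neq0l (A : nzRingType) (x y : A) : x * y = 1 -> x != 0.
Proof. by apply: contra_eq_neq => ->; rewrite mul0r eq_sym oner_eq0. Qed.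

Lemma tofrac_injective (R : idomainType) : injective (@tofrac R).
Proof. by move=> p q /eqP; rewrite -subr_eq0 -rmorphB tofrac_eq0 subr_eq0 => /eqP. Qed.

Lemma ord4_cases (th : 'I_4) : (th : nat) \in [:: 0; 1; 2; 3]%N.
Proof. by rewrite !inE; have := ltn_ord th; lia. Qed.

Lemma coef_size_bound (R : nzRingType) (I : finType) (P : I -> {poly {poly R}}) :
  exists N, forall i, (size (P i) <= N)%N /\ forall j, (size ((P i)`_j)%R <= N)%N.
Proof.
pose d i := maxn (size (P i)) (\max_(j < size (P i)) size ((P i)`_j)%R).
exists (\max_i d i)%N => i.
have le n : (n <= d i)%N -> (n <= \max_i d i)%N by move/leq_trans; apply; apply: leq_bigmax.
split=> [|j]; first by apply: le; rewrite leq_max leqnn.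
have [lt|ge] := ltnP j (size (P i)); last by rewrite nth_default // size_poly0.
by apply: le; rewrite leq_max; apply/orP; right; apply: (leq_bigmax (Ordinal lt)).
Qed.

Section Factorization.

Lemma rmorph_factor (G C A : nzRingType) (f : {rmorphism G -> C})
    (g : {rmorphism G -> A}) :
  (forall c, exists p, f p = c) -> (forall p, f p = 0 -> g p = 0) ->
  exists h : {rmorphism C -> A}, forall p, h (f p) = g p.
Proof.
move=> fs kfg; pose s c := sval (cid (fs c)).
have fsK c : f (s c) = c by rewrite /s; case: cid.
have hE p q : f p = f q -> g p = g q.
  move=> e; apply/eqP; rewrite -subr_eq0 -rmorphB kfg //.
  by rewrite rmorphB e subrr.
pose h c := g (s c).
have hf p : h (f p) = g p by apply: hE; rewrite fsK.
have hB : zmod_morphism h.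
  move=> x y; rewrite -[x]fsK -[y]fsK -rmorphB !hf; exact: rmorphB.
have hM : monoid_morphism h.
  split=> [|x y]; first by rewrite -(rmorph1 f) hf rmorph1.
  rewrite -[x]fsK -[y]fsK -rmorphM !hf; exact: rmorphM.
pose hb := GRing.isZmodMorphism.Build C A h hB.
pose hm := GRing.isMonoidMorphism.Build C A h hM.
pose H : {rmorphism C -> A} := HB.pack h hb hm.
by exists H => p; apply: hf.
Qed.

Lemma lrmorph_of_rmorph (k : fieldType) (C A : comAlgType k)
    (h : {rmorphism C -> A}) :
  (forall c : k, h c%:A = c%:A) ->
  exists h' : {lrmorphism C -> A}, h' =1 h.
Proof.
move=> hs.
have hZ : scalable h.
  by move=> c x; rewrite -[x in LHS]mul1r scalerAl rmorphM hs mulr_algl.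
pose hz := GRing.isScalable.Build k C A *:%R h hZ.
pose H : {lrmorphism C -> A} := HB.pack (h : C -> A) h hz.
by exists H.
Qed.

End Factorization.

Section NormalForm.

Variables (k : fieldType).

Section Evaluation.
Variables (A : comNzRingType) (phi : {rmorphism k -> A}).

Definition ev1 (a : A) : {poly k} -> A := horner_morph (fun x => mulrC a (phi x)).
HB.instance Definition _ a := GRing.RMorphism.on (ev1 a).

Definition ev2 (a z : A) : {poly {poly k}} -> A :=
  horner_morph (fun x => mulrC z (ev1 a x)).
HB.instance Definition _ a z := GRing.RMorphism.on (ev2 a z).

Lemma ev1C a c : ev1 a c%:P = phi c.
Proof. exact: horner_morphC. Qed.
Lemma ev1X a : ev1 a 'X = a.
Proof. exact: horner_morphX. Qed.
Lemma ev2C a z p : ev2 a z p%:P = ev1 a p.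
Proof. exact: horner_morphC. Qed.
Lemma ev2X a z : ev2 a z 'X = z.
Proof. exact: horner_morphX. Qed.

Definition gens (a z al b be : A) : 'I_5 -> A :=
  fun i => nth 0 [:: a; z; al; b; be] i.

Definition nfval (a z al b be : A) (P : 'I_4 -> {poly {poly k}}) : A :=
  ev2 a z (P 0) + al * ev2 a z (P 1) + b * ev2 a z (P 2%:R)
   + be * ev2 a z (P 3%:R).

Lemma nfval0 a z al b be P : (forall th, P th = 0) -> nfval a z al b be P = 0.
Proof. by move=> h; rewrite /nfval !h !rmorph0 !mulr0 !addr0. Qed.
End Evaluation.

(* With [a = x^2, z = Z^2, al = x Z, b = x y, be = y Z] these are the relations
   between the even products of [x, y, Z] on the surface
   [x^(2m+1) Z = y^2 + 1]. *)
Record rels (m : nat) (A : comNzRingType) (a z al b be : A) : Prop := Rels {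
  rel_alal : al ^+ 2 = a * z;
  rel_alb : al * b = a * be;
  rel_albe : al * be = b * z;
  rel_bb : b ^+ 2 = a * (a ^+ m * al - 1);
  rel_bbe : b * be = al * (a ^+ m * al - 1);
  rel_bebe : be ^+ 2 = z * (a ^+ m * al - 1) }.

Lemma rels_morph m (A B : comNzRingType) (f : {rmorphism A -> B}) a z al b be :
  rels m a z al b be -> rels m (f a) (f z) (f al) (f b) (f be).
Proof.
case=> e1 e2 e3 e4 e5 e6; split;
  by rewrite -?(rmorphXn f) -!(rmorphM f) ?(e1, e2, e3, e4, e5, e6) ?(rmorphM, rmorphB, rmorphXn, rmorph1).
Qed.

Lemma mpoly_gen_ind n (P : {mpoly k[n]} -> Prop) :
  P 1 -> (forall p q, P p -> P q -> P (p + q)) ->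
  (forall c p, P p -> P (c *: p)) -> (forall i p, P p -> P ('X_i * p)) ->
  forall p, P p.
Proof.
move=> P1 PD PZ PX p.
have P0 : P 0 by rewrite -(scale0r 1); apply: PZ.
have PM m q : P q -> P ('X_[m] * q).
  rewrite mpolyXE_id; move=> Pq; elim: (index_enum _) => [|i s IHs].
    by rewrite big_nil mul1r.
  rewrite big_cons -mulrA; elim: (m i) => [|e IHe]; first by rewrite expr0 mul1r.
  by rewrite exprS -mulrA; apply: PX.
elim/mpolyind: p => [//|c m p _ _ IH]; apply: PD => //; apply: PZ.
by rewrite -[X in P X]mulr1; apply: PM.
Qed.

Lemma nf_exists m (p : {mpoly k[5]}) : exists P : 'I_4 -> {poly {poly k}},
  forall (A : comNzRingType) (phi : {rmorphism k -> A}) (a z al b be : A),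
  rels m a z al b be -> mmap phi (gens a z al b be) p = nfval phi a z al b be P.
Proof.
pose a_ : {poly {poly k}} := 'X%:P; pose z_ : {poly {poly k}} := 'X.
elim/mpoly_gen_ind: p => [|p q [P hP] [Q hQ]|c p [P hP]|i p [P hP]].
- exists (fun i => (i == 0)%:R) => A phi a z al b be _.
  by rewrite rmorph1 /nfval /= !rmorph0 rmorph1 !mulr0 !addr0.
- exists (fun i => P i + Q i) => A phi a z al b be h.
  rewrite rmorphD /= hP // hQ // /nfval !rmorphD /=; ring.
- exists (fun i => c%:P%:P * P i) => A phi a z al b be h.
  rewrite mmapZ hP // /nfval !rmorphM /= !ev2C !ev1C; ring.
- have ai : (i : nat) \in [:: 0; 1; 2; 3; 4]%N.
    by rewrite !inE; have := ltn_ord i; lia.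
  pose q (P0 P1 P2 P3 : {poly {poly k}}) := fun j : 'I_4 => nth 0 [:: P0; P1; P2; P3] j.
  suff [Q hQ] : exists Q, forall (A : comNzRingType) (phi : {rmorphism k -> A}) (a z al b be : A),
    rels m a z al b be -> gens a z al b be i * nfval phi a z al b be P = nfval phi a z al b be Q.
    exists Q => A phi a z al b be h; rewrite rmorphM /= mmapX mmap1U hP //; exact: hQ.
  move: ai; rewrite !inE /gens => /or4P[/eqP->|/eqP->|/eqP->|/orP[/eqP->|/eqP->]].
  + exists (fun j => a_ * P j) => A phi a z al b be h /=.
    rewrite /nfval !rmorphM /= /a_ !ev2C !ev1X; ring.
  + exists (fun j => z_ * P j) => A phi a z al b be h /=.
    rewrite /nfval !rmorphM /= /z_ !ev2X; ring.
  + exists (q (a_ * z_ * P 1) (P 0) (z_ * P 3%:R) (a_ * P 2%:R)) => A phi a z al b be h /=.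
    rewrite /nfval /q /= !rmorphM /= /z_ /a_ !ev2X !ev2C !ev1X.
    case: h => e1 e2 e3 e4 e5 e6.
    apply: (lincomb (eqD (eqM (ev2 phi a z (P 1)) e1) (eqD (eqM (ev2 phi a z (P 2%:R)) e2)
      (eqM (ev2 phi a z (P 3%:R)) e3)))); ring.
  + exists (q (- (a_ * P 2%:R) + a_ ^+ m.+1 * z_ * P 3%:R) (a_ ^+ m.+1 * P 2%:R - P 3%:R)
       (P 0) (a_ * P 1)) => A phi a z al b be h /=.
    rewrite /nfval /q /= !(rmorphM, rmorphD, rmorphN, rmorphXn) /= /z_ /a_ !ev2X !ev2C !ev1X.
    case: h => e1 e2 e3 e4 e5 e6.
    apply: (lincomb (eqD (eqM (a ^+ m * ev2 phi a z (P 3%:R)) e1) (eqD (eqM (ev2 phi a z (P 1)) e2)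
      (eqD (eqM (ev2 phi a z (P 2%:R)) e4) (eqM (ev2 phi a z (P 3%:R)) e5))))).
    rewrite !exprS; ring.
  + exists (q (a_ ^+ m.+1 * z_ * P 2%:R - z_ * P 3%:R) (- P 2%:R + z_ * a_ ^+ m * P 3%:R)
       (z_ * P 1) (P 0)) => A phi a z al b be h /=.
    rewrite /nfval /q /= !(rmorphM, rmorphD, rmorphN, rmorphXn) /= /z_ /a_ !ev2X !ev2C !ev1X.
    case: h => e1 e2 e3 e4 e5 e6.
    apply: (lincomb (eqD (eqM (a ^+ m * ev2 phi a z (P 2%:R)) e1) (eqD (eqM (ev2 phi a z (P 1)) e3)
      (eqD (eqM (ev2 phi a z (P 2%:R)) e5) (eqM (ev2 phi a z (P 3%:R)) e6))))).
    rewrite !exprS; ring.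
Qed.

End NormalForm.

(** * Leading monomials *)

Section LeadingMonomials.

Variables (k : fieldType) (L : fieldType) (toL : {rmorphism {poly {poly k}} -> L}).
Hypothesis toL_inj : injective toL.

Lemma toL_eq0 p : (toL p == 0) = (p == 0).
Proof. by rewrite -(inj_eq toL_inj) rmorph0. Qed.

Definition sL : L := toL 'X.
Definition yL : L := toL 'X%:P.
Definition kL (c : k) : L := toL c%:P%:P.
HB.instance Definition _ := GRing.RMorphism.copy kL (toL \o @polyC {poly k} \o @polyC k).

Lemma sL_neq0 : sL != 0. Proof. by rewrite toL_eq0 polyX_eq0. Qed.
Lemma yL_neq0 : yL != 0. Proof. by rewrite toL_eq0 polyC_eq0 polyX_eq0. Qed.
Local Hint Resolve sL_neq0 yL_neq0 : core.

(* [residue f c]: [f] is regular for the rank two valuation of [k(s, y)] in which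
   [1/y] has positive value and [s] is infinitely larger, and its residue
   is [c]. *)
Definition residue (f : L) (c : k) : Prop :=
  exists (M : nat) (Q : {poly {poly k}}),
    [/\ f * yL ^+ M = toL Q, (size (Q`_0)%R <= M.+1)%N & Q`_0`_M = c].

Lemma coef_mul_top (p q : {poly k}) m n :
  (size p <= m.+1)%N -> (size q <= n.+1)%N ->
  (size (p * q)%R <= (m + n).+1)%N /\ (p * q)`_(m + n) = p`_m * q`_n.
Proof.
move=> sp sq; split.
  by apply: leq_trans (size_polyMleq _ _) _; move: sp sq; lia.
rewrite coefM (bigD1 (inord m)) //= inordK ?ltnS ?leq_addr // addKn.
rewrite big1 ?addr0 // => i ne_im.
have ne : (i : nat) != m.
  by apply: contra ne_im => /eqP e; apply/eqP/val_inj; rewrite /= inordK ?ltnS ?leq_addr.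
case: (ltngtP i m) ne => // [lt|gt] _.
  by rewrite [q`_ _]nth_default ?mulr0 //; apply: leq_trans sq _; have := ltn_ord i; lia.
by rewrite [p`_ _]nth_default ?mul0r //; apply: leq_trans sp _.
Qed.

Lemma res_fun f c d : residue f c -> residue f d -> c = d.
Proof.
case=> M [Q [e s <-]] [N [P [e' s' <-]]].
have eq : Q * 'X^N%:P = P * 'X^M%:P.
  apply: toL_inj; rewrite !rmorphM /= -e -e' !polyC_exp !rmorphXn /=.
  by rewrite -/yL -!mulrA -!exprD addnC.
have : (Q * 'X^N%:P)`_0`_(M + N) = (P * 'X^M%:P)`_0`_(N + M) by rewrite eq addnC.
by rewrite !coefMC !coefMXn ![(_ < _)%N]ltnNge ?leq_addl /= !addnK.
Qed.

Lemma res0 : residue 0 0.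
Proof. by exists 0, 0; rewrite mul0r rmorph0 !coef0 size_poly0. Qed.

Lemma resC c : residue (kL c) c.
Proof.
exists 0, c%:P%:P; rewrite expr0 mulr1 !coefC /=; split=> //.
by rewrite size_polyC; case: eqP.
Qed.

Lemma resD f g c d : residue f c -> residue g d -> residue (f + g) (c + d).
Proof.
case=> M [Q [e s <-]] [N [P [e' s' <-]]].
exists (M + N)%N, (Q * 'X^N%:P + P * 'X^M%:P); split.
- rewrite rmorphD !rmorphM /= -e -e' !polyC_exp !rmorphXn /= -/yL exprD; ring.
- rewrite coefD !coefMC (leq_trans (size_polyD _ _)) // geq_max.
  have h m n (p : {poly k}) : (size p <= m.+1)%N -> (size (p * 'X^n)%R <= (m + n).+1)%N.
    move=> sp; apply: leq_trans (size_polyMleq _ _) _.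
    by rewrite size_polyXn; move: sp; lia.
  by rewrite h // addnC h.
- rewrite !coefD !coefMC !coefMXn ![(_ < _)%N]ltnNge ?leq_addl ?leq_addr /=.
  by rewrite addnK addKn.
Qed.

Lemma resM f g c d : residue f c -> residue g d -> residue (f * g) (c * d).
Proof.
case=> M [Q [e s <-]] [N [P [e' s' <-]]].
have [h1 h2] := coef_mul_top s s'.
exists (M + N)%N, (Q * P); split; rewrite ?coef0M //.
by rewrite rmorphM /= -e -e' exprD; ring.
Qed.

(* The monomial s^n y^j; leading monomials are ordered by lowest exponent of s,
   then by highest exponent of y. *)
Definition chi (m : int * int) : L := sL ^ m.1 * yL ^ m.2.

Definition below (m m' : int * int) : bool :=
  (m'.1 < m.1) || (m'.1 == m.1) && (m.2 < m'.2).

Lemma chiD m m' : chi (m + m') = chi m * chi m'.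
Proof. by rewrite /chi (expfzDr _ _ sL_neq0) (expfzDr _ _ yL_neq0) mulrACA. Qed.

Lemma chi0 : chi 0 = 1. Proof. by rewrite /chi !expr0z mulr1. Qed.

Lemma chi_neq0 m : chi m != 0.
Proof. by rewrite mulf_neq0 ?expfz_neq0. Qed.

Lemma chiN m : chi (- m) = (chi m)^-1.
Proof. by apply: (mulfI (chi_neq0 m)); rewrite -chiD subrr chi0 mulfV ?chi_neq0. Qed.

Lemma chiB m m' : chi (m - m') = chi m / chi m'.
Proof. by rewrite chiD chiN. Qed.

Lemma res_chi m : below m 0 -> residue (chi m) 0.
Proof.
case: m => p q; rewrite /below /= => /orP[p0|/andP[/eqP <- q0]].
- case: p p0 => // p p0; case: q => q.
    exists 0, ('X^p * 'X^q%:P); rewrite expr0 mulr1; split.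
    + by rewrite rmorphM /= polyC_exp !rmorphXn.
    + by rewrite coefMC coefXn; case: p p0 => //= p _; rewrite mul0r size_poly0.
    + by rewrite coefMC coefXn; case: p p0 => //= p _; rewrite mul0r coef0.
  exists q.+1, ('X^p); split.
  + by rewrite /chi /= NegzE -mulrA -exprnN mulVf ?expf_neq0 // mulr1 rmorphXn.
  + by rewrite coefXn; case: p p0 => //= p _; rewrite size_poly0.
  + by rewrite coefXn; case: p p0 => //= p _; rewrite coef0.
- case: q q0 => // q _; exists q.+1, 1; split.
  + by rewrite /chi /= NegzE expr0z mul1r -exprnN mulVf ?expf_neq0 // rmorph1.
  + by rewrite coef1 size_poly1.
  + by rewrite coef1 /= coef1.
Qed.

Lemma res_below f c m m' : residue (f / chi m) c -> below m m' -> residue (f / chi m') 0.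
Proof.
move=> h b; have -> : f / chi m' = f / chi m * chi (m - m').
  by rewrite chiB mulrA mulfVK ?chi_neq0.
rewrite -[0](mulr0 c); apply: resM => //; apply: res_chi.
by move: b; rewrite /below /=; lia.
Qed.

Lemma below_total m m' : m != m' -> below m m' || below m' m.
Proof.
case: m m' => [a b] [c d]; rewrite -pair_eqE /= /below /=; lia.
Qed.

Lemma below_trans m1 m2 m3 : below m1 m2 -> below m2 m3 -> below m1 m3.
Proof. by rewrite /below; lia. Qed.

Lemma sum_leading (T : eqType) (lm : T -> int * int) (f : T -> L) (c : T -> k)
    (l : seq T) :
  {in l &, injective lm} -> uniq l -> l != [::] ->
  (forall t, t \in l -> residue (f t / chi (lm t)) (c t)) ->
  exists2 t0, t0 \in l & residue ((\sum_(t <- l) f t) / chi (lm t0)) (c t0) /\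
     forall t, t \in l -> t != t0 -> below (lm t) (lm t0).
Proof.
elim: l => [//|t l IHl] inj /= /andP[tl ul] _ hres.
have ht : residue (f t / chi (lm t)) (c t) by apply: hres; rewrite inE eqxx.
have [e|ne] := eqVneq l [::].
  exists t; first by rewrite inE eqxx.
  rewrite e big_seq1; split=> // t'; rewrite inE => /eqP ->; by rewrite eqxx.
have [] := IHl _ ul ne.
- by move=> x y hx hy; apply: inj; rewrite inE ?hx ?hy orbT.
- by move=> x hx; apply: hres; rewrite inE hx orbT.
move=> t0 ht0 [hr hb].
have ht0' : t0 \in t :: l by rewrite inE ht0 orbT.
have ne0 : lm t != lm t0.
  by apply/eqP => e; move: tl; rewrite (inj t t0) ?ht0 // inE eqxx.
case/orP: (below_total ne0) => b.
  exists t0 => //; split.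
    rewrite big_cons mulrDl -[c t0]add0r; apply: resD => //; exact: res_below ht b.
  by move=> t'; rewrite inE => /orP[/eqP -> //|/hb].
exists t; first by rewrite inE eqxx.
split; first by rewrite big_cons mulrDl -[c t]addr0; apply: resD => //; exact: res_below hr b.
move=> t'; rewrite inE => /orP[/eqP ->|ht']; first by rewrite eqxx.
move=> _; have [->//|n0] := eqVneq t' t0; exact: below_trans (hb _ ht' n0) b.
Qed.

End LeadingMonomials.

Section Model.

Variables (k : fieldType) (m : nat) (C : comAlgType k).

Record embedding (L : fieldType) (toL : {rmorphism {poly {poly k}} -> L})
    (io : {rmorphism C -> L}) (a z al b be : C) : Prop := Embedding {
  emb_inj : injective toL;
  emb_scalar : forall c : k, io c%:A = kL toL c;
  emb_a : io a = sL toL ^+ 2;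
  emb_b : io b = sL toL * yL toL;
  emb_al : io al * sL toL ^+ (2 * m) = yL toL ^+ 2 + 1;
  emb_be : io be * sL toL ^+ (2 * m).+1 = yL toL * (yL toL ^+ 2 + 1);
  emb_z : io z * sL toL ^+ (2 * (2 * m).+1) = (yL toL ^+ 2 + 1) ^+ 2 }.

Record model (a z al b be : C) : Prop := Model {
  model_rels : rels m a z al b be;
  model_gen : forall c, exists p : {mpoly k[5]},
    mmap (GRing.in_alg C) (gens a z al b be) p = c;
  model_emb : exists (L : fieldType) (toL : {rmorphism {poly {poly k}} -> L})
    (io : {rmorphism C -> L}), embedding toL io a z al b be }.

Section Leading.
Variables (L : fieldType) (toL : {rmorphism {poly {poly k}} -> L}).
Variables (io : {rmorphism C -> L}) (a z al b be : C).
Hypothesis E : embedding toL io a z al b be.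

Local Notation s := (sL toL).
Local Notation y := (yL toL).
Local Notation residue := (residue toL).
Local Notation chi := (chi toL).
Let s0 : s != 0 := sL_neq0 (emb_inj E).
Let y0 : y != 0 := yL_neq0 (emb_inj E).

Lemma res_exp f c n : residue f c -> residue (f ^+ n) (c ^+ n).
Proof.
move=> h; elim: n => [|n IHn]; last by rewrite !exprS; apply: resM.
by rewrite !expr0; have := resC toL 1; rewrite rmorph1.
Qed.

Let res1 : residue 1 1.
Proof. by have := resC toL 1; rewrite rmorph1. Qed.

Let res_w : residue ((y ^+ 2 + 1) / y ^+ 2) 1.
Proof.
exists 2%N, ('X ^+ 2 + 1)%:P; split.
- by rewrite mulfVK ?expf_neq0 // rmorphD rmorph1 rmorphXn rmorphD rmorph1 rmorphXn.
- by rewrite coefC /= size_XnaddC.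
- by rewrite coefC /= coefD coefXn coef1 addr0.
Qed.

Definition lmg (th : 'I_4) : int * int :=
  nth 0 [:: (0, 0); (- (2 * m)%:Z, 2%:Z); (1, 1); (- (2 * m).+1%:Z, 3%:Z)] th.
Definition bg (th : 'I_4) : C := nth 0 [:: 1; al; b; be] th.
Definition lmb (th : 'I_4) (i j : nat) : int * int :=
  ((lmg th).1 + (2 * i)%:Z - ((2 * (2 * m).+1) * j)%:Z, (lmg th).2 + (4 * j)%:Z).

Lemma chiE (p q : int) : chi (p, q) = s ^ p * y ^ q. Proof. by []. Qed.

Lemma res_bg th : residue (io (bg th) / chi (lmg th)) 1.
Proof.
have := ord4_cases th; rewrite /bg /lmg !inE => /or4P[]/eqP -> /=.
- by rewrite rmorph1 chi0 divr1.
- suff -> : io al / chi (- (2 * m)%:Z, 2%:Z) = (y ^+ 2 + 1) / y ^+ 2 by [].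
  rewrite -(emb_al E) chiE -exprnN -exprnP; set S := s ^+ _; have S0 : S != 0 by rewrite expf_neq0.
  field.
  by rewrite y0 S0.
- by rewrite (emb_b E) chiE !expr1z mulfV ?mulf_neq0.
- suff -> : io be / chi (- (2 * m).+1%:Z, 3%:Z) = (y ^+ 2 + 1) / y ^+ 2 by [].
  have -> : y ^+ 2 + 1 = io be * s ^+ (2 * m).+1 / y by rewrite (emb_be E) mulrAC mulfV ?mul1r.
  rewrite chiE -exprnN -exprnP; set S := s ^+ _; have S0 : S != 0 by rewrite expf_neq0.
  field.
  by rewrite y0 S0.
Qed.

Lemma res_basis th i j : residue (io (a ^+ i * z ^+ j * bg th) / chi (lmb th i j)) 1.
Proof.
have -> : lmb th i j = (((2 * i)%:Z, 0) + (- ((2 * (2 * m).+1) * j)%:Z, (4 * j)%:Z)) + lmg th.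
  apply/eqP; rewrite -pair_eqE /lmb /=; lia.
rewrite !(chiD (emb_inj E)) !(rmorphM io) !(rmorphXn io) /=.
have -> : io a ^+ i * io z ^+ j * io (bg th) /
    (chi ((2 * i)%:Z, 0) * chi (- (2 * (2 * m).+1 * j)%:Z, (4 * j)%:Z) * chi (lmg th)) =
    ((((y ^+ 2 + 1) / y ^+ 2) ^+ 2) ^+ j) * (io (bg th) / chi (lmg th)).
  rewrite (emb_a E) !chiE expr0z mulr1 -exprnN -!exprnP.
  have -> : (((y ^+ 2 + 1) / y ^+ 2) ^+ 2) ^+ j =
      io z ^+ j * s ^+ (2 * (2 * m).+1 * j) / y ^+ (4 * j).
    have e4 : ((y ^+ 2) ^+ 2) ^+ j = y ^+ (4 * j) by rewrite -!exprM mulnA.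
    have e5 : (s ^+ (2 * (2 * m).+1)) ^+ j = s ^+ (2 * (2 * m).+1 * j) by rewrite -exprM.
    by rewrite (expr_div_n _ _ 2) -(emb_z E) expr_div_n exprMn e4 e5.
  rewrite -exprM.
  have := expf_neq0 (4 * j) y0; set Y := y ^+ (4 * j) => Y0.
  have := expf_neq0 (2 * i) s0; set S1 := s ^+ (2 * i) => S10.
  have := expf_neq0 (2 * (2 * m).+1 * j) s0; set S2 := s ^+ (_ * j) => S20.
  have := chi_neq0 (emb_inj E) (lmg th); set X := chi _ => X0.
  field; by rewrite Y0 S10 S20 X0.
by have := resM (res_exp j (res_exp 2 res_w)) (res_bg th); rewrite !expr1n mulr1.
Qed.

Lemma lmb_inj th i j th' i' j' :
  lmb th i j = lmb th' i' j' -> [/\ th = th', i = i' & j = j'].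
Proof.
have := (ord4_cases th, ord4_cases th'); rewrite /lmb /lmg !inE => -[].
move=> /or4P[]/eqP e /or4P[]/eqP e'; rewrite e e' /= => -[e1 e2];
 (have jj : j = j' by lia); subst j'; (have ii : i = i' by lia); subst i';
 split=> //; (try by apply: val_inj; rewrite /= e e'); exfalso; lia.
Qed.

Lemma nfval_sum (A : comNzRingType) (phi : {rmorphism k -> A}) (aa zz all bb bbe : A)
    (P : 'I_4 -> {poly {poly k}}) N :
  (forall th, (size (P th) <= N)%N) -> (forall th j, (size ((P th)`_j)%R <= N)%N) ->
  nfval phi aa zz all bb bbe P =
  \sum_(t : 'I_4 * ('I_N * 'I_N)) phi (P t.1)`_(t.2.2)`_(t.2.1) *
     (aa ^+ t.2.1 * zz ^+ t.2.2 * nth 0 [:: 1; all; bb; bbe] t.1).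
Proof.
move=> sP sPj.
have e2 th : ev2 phi aa zz (P th) = \sum_(u : 'I_N * 'I_N)
    phi (P th)`_(u.2)`_(u.1) * (aa ^+ u.1 * zz ^+ u.2).
  rewrite /ev2 /horner_morph (@horner_coef_wide _ N); last first.
    exact: leq_trans (size_poly _ _) _.
  under eq_bigr => j _.
    rewrite coef_map /= /ev1 /horner_morph (@horner_coef_wide _ N); last first.
      exact: leq_trans (size_poly _ _) _.
    rewrite mulr_suml.
    under eq_bigr => i _ do rewrite coef_map /= -mulrA.
  over.
  by rewrite exchange_big pair_big.
rewrite -(pair_big xpredT xpredT (fun (th : 'I_4) (u : 'I_N * 'I_N) =>
   phi (P th)`_(u.2)`_(u.1) * (aa ^+ u.1 * zz ^+ u.2 * nth 0 [:: 1; all; bb; bbe] th))) /=.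
under eq_bigr => th _.
  under eq_bigr => u _ do rewrite mulrA.
  rewrite -mulr_suml -e2.
over.
rewrite !big_ord_recl big_ord0 /nfval /= addr0 mulr1.
rewrite ![_ * ev2 _ _ _ _]mulrC -!addrA; congr (_ + _).
by congr (_ + (_ + _)); congr (ev2 _ _ _ (P _) * _); apply: val_inj.
Qed.

Lemma nf_lead (P : 'I_4 -> {poly {poly k}}) : (exists th, P th != 0) ->
  exists th i j, [/\ (P th)`_j`_i != 0,
    residue (io (nfval (GRing.in_alg C) a z al b be P) / chi (lmb th i j)) (P th)`_j`_i &
    forall th' i' j', (P th')`_j'`_i' != 0 -> (lmb th i j).1 <= (lmb th' i' j').1].
Proof.
case=> th1 Pn0.
have [N /all_and2[sP sPj]] := coef_size_bound P.
pose T := ('I_4 * ('I_N * 'I_N))%type.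
pose c (t : T) := (P t.1)`_(t.2.2)`_(t.2.1).
pose lm (t : T) := lmb t.1 t.2.1 t.2.2.
pose f (t : T) := io (c t *: (a ^+ t.2.1 * z ^+ t.2.2 * bg t.1)).
have big0 th i j : (P th)`_j`_i != 0 -> (i < N)%N /\ (j < N)%N.
  move=> n0; split; rewrite ltnNge; apply: contra n0 => le.
    by rewrite [X in X`_i]/= nth_default //; apply: leq_trans le.
  by rewrite (nth_default _ (leq_trans (sP th) le)) coef0.
have cover th i j : (P th)`_j`_i != 0 -> exists2 t : T, c t != 0 & t.1 = th /\ (t.2.1 = i :> nat) /\ (t.2.2 = j :> nat).
  by move=> n0; have [hi hj] := big0 _ _ _ n0; exists (th, (Ordinal hi, Ordinal hj)).
pose l := [seq t <- index_enum T | c t != 0].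
have lnil : l != [::].
  have lc : lead_coef (lead_coef (P th1)) != 0 by rewrite !lead_coef_eq0.
  have [t ct _] := cover th1 _ _ lc.
  have : t \in l by rewrite mem_filter ct mem_index_enum.
  by case: l.
have [|||t0 ht0 [hr hb]] := @sum_leading k L toL (emb_inj E) _ lm f c l _ _ lnil.
- move=> [t1 [t2 t3]] [u1 [u2 u3]] _ _ /lmb_inj /= [-> e2 e3].
  by congr (_, (_, _)); apply: val_inj.
- exact/filter_uniq/index_enum_uniq.
- move=> [th [i j]] _; rewrite /f /lm /=.
  rewrite -[X in io X]mulr_algl rmorphM /= (emb_scalar E) -mulrA -[X in residue _ X]mulr1.
  by apply: resM; [apply: resC | apply: res_basis].
exists t0.1, t0.2.1, t0.2.2; split.
- by move: ht0; rewrite mem_filter => /andP[].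
- move: hr; congr (residue (_ / _) _).
  rewrite (nfval_sum _ _ _ _ _ _ sP sPj) rmorph_sum big_filter big_mkcond /=.
  apply: eq_bigr => t _; rewrite /f /bg -/(c t).
  by case: eqP => [->|_]; rewrite /= ?scale0r ?mul0r ?rmorph0 // mulr_algl.
- move=> th' i' j' n0; have [[t1 [t2 t3]] ct /= [e1 [e2 e3]]] := cover _ _ _ n0.
  have [e|ne] := eqVneq (t1, (t2, t3)) t0.
    by rewrite -e /= e1 e2 e3.
  have := hb (t1, (t2, t3)); rewrite mem_filter ct mem_index_enum => /(_ isT ne).
  by rewrite /lm /below /= e1 e2 e3; lia.
Qed.

Lemma nf_inj (P : 'I_4 -> {poly {poly k}}) :
  io (nfval (GRing.in_alg C) a z al b be P) = 0 -> forall th, P th = 0.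
Proof.
move=> e th; apply/eqP; apply: contraT => n0.
have [th0 [i [j [n1 hr _]]]] := nf_lead (ex_intro _ th n0).
move: hr; rewrite e mul0r => /(res_fun (emb_inj E) (res0 toL)) e0.
by rewrite -e0 eqxx in n1.
Qed.
End Leading.

End Model.

Section UniversalProperty.

Variables (k : fieldType) (m : nat) (C : comAlgType k) (a z al b be : C).
Hypothesis M : model m a z al b be.

Local Notation nf := (nfval (GRing.in_alg C) a z al b be).

Lemma model_nf c : exists P, c = nf P.
Proof.
have [p <-] := model_gen M c; have [P hP] := nf_exists m p.
by exists P; apply: hP; apply: model_rels M.
Qed.

Lemma model_nf_inj P : nf P = 0 -> forall th, P th = 0.
Proof.
by have [L [toL [io E]]] := model_emb M => e; apply: (nf_inj E); rewrite e rmorph0.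
Qed.

Lemma embedding_inj (L : fieldType) (toL : {rmorphism {poly {poly k}} -> L})
  (io : {rmorphism C -> L}) : embedding m toL io a z al b be -> injective io.
Proof.
by move=> E; apply: raddf_inj => c; have [P ->] := model_nf c => /(nf_inj E); exact: nfval0.
Qed.

Lemma model_integral (r t : C) : (r * t == 0) = (r == 0) || (t == 0).
Proof.
have [L [toL [io E]]] := model_emb M; have ii := embedding_inj E.
by rewrite -!(inj_eq ii) rmorphM !rmorph0 mulf_eq0.
Qed.

Lemma model_mulfI (r : C) : r != 0 -> injective ( *%R r).
Proof.
move=> r0 x y /eqP; rewrite -subr_eq0 -mulrBr model_integral (negPf r0) subr_eq0.
by move/eqP.
Qed.

Lemma model_expf_neq0 (r : C) n : r != 0 -> r ^+ n != 0.
Proof.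
move=> r0; elim: n => [|n IHn]; first by rewrite expr0 oner_eq0.
by rewrite exprS model_integral negb_or r0.
Qed.

Lemma model_ind (P : C -> Prop) :
  P 1 -> (forall u v, P u -> P v -> P (u + v)) -> (forall c u, P u -> P (c *: u)) ->
  (forall u, P u -> [/\ P (a * u), P (z * u), P (al * u), P (b * u) & P (be * u)]) ->
  forall u, P u.
Proof.
move=> P1 PD PZ PX u; have [p <-] := model_gen M u.
elim/mpoly_gen_ind: p => [|p q hp hq|c p hp|i p hp].
- by rewrite rmorph1.
- by rewrite rmorphD; apply: PD.
- by rewrite mmapZ /= mulr_algl; apply: PZ.
- rewrite rmorphM /= mmapX mmap1U.
  have : (i : nat) \in [:: 0; 1; 2; 3; 4]%N by rewrite !inE; have := ltn_ord i; lia.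
  have [h1 h2 h3 h4 h5] := PX _ hp.
  by rewrite /gens !inE => /or4P[/eqP->|/eqP->|/eqP->|/orP[/eqP->|/eqP->]].
Qed.

Lemma model_ext (A : nzRingType) (f g : {rmorphism C -> A}) :
  (forall c : k, f c%:A = g c%:A) ->
  f a = g a -> f z = g z -> f al = g al -> f b = g b -> f be = g be -> f =1 g.
Proof.
move=> fk e1 e2 e3 e4 e5; elim/model_ind => [|u v h1 h2|c u h|u h].
- by rewrite !rmorph1.
- by rewrite !rmorphD h1 h2.
- by rewrite -mulr_algl !rmorphM fk h.
- by rewrite !rmorphM h e1 e2 e3 e4 e5.
Qed.

Lemma model_rmorph (A : comNzRingType) (phi : {rmorphism k -> A}) a' z' al' b' be' :
  rels m a' z' al' b' be' ->
  exists h : {rmorphism C -> A}, (forall c : k, h c%:A = phi c) /\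
    [/\ h a = a', h z = z', h al = al', h b = b' & h be = be'].
Proof.
move=> R'; have [||h hE] := @rmorph_factor {mpoly k[5]} C A
   (mmap (GRing.in_alg C) (gens a z al b be)) (mmap phi (gens a' z' al' b' be')).
- exact: model_gen M.
- move=> p /= e; have [P hP] := nf_exists m p; move: e.
  rewrite (hP _ _ _ _ _ _ _ (model_rels M)) (hP _ _ _ _ _ _ _ R') => /model_nf_inj.
  exact: nfval0.
exists h; split=> [c|]; first by have := hE c%:MP; rewrite /= !mmapC.
have gE i : h (gens a z al b be i) = gens a' z' al' b' be' i.
  by have := hE 'X_i; rewrite /= !mmapX !mmap1U.
by split; [have := gE 0 | have := gE 1 | have := gE 2%:R | have := gE 3%:R | have := gE 4%:R].
Qed.

Lemma model_lrmorph (A : comAlgType k) (a' z' al' b' be' : A) :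
  rels m a' z' al' b' be' ->
  exists h : {lrmorphism C -> A},
    [/\ h a = a', h z = z', h al = al', h b = b' & h be = be'].
Proof.
move=> R'; have [h [hk hg]] := model_rmorph (GRing.in_alg A) R'.
have [h' hE] := lrmorph_of_rmorph hk; exists h'.
by rewrite !hE.
Qed.

Lemma model_affine : affine_alg C.
Proof.
have [|f fE] := @lrmorph_of_rmorph k {mpoly k[5]} C (mmap (GRing.in_alg C) (gens a z al b be)).
  by move=> c; rewrite /= mmapZ rmorph1 mulr1.
by exists 5, f => c; have [p <-] := model_gen M c; exists p.
Qed.

End UniversalProperty.

(** * The two rings *)

Section Generation.
Variables (k : fieldType) (C : comAlgType k) (a z al b be : C).

Definition generated (r : C) : Prop :=
  exists p : {mpoly k[5]}, mmap (GRing.in_alg C) (gens a z al b be) p = r.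

Lemma generated_scalar c : generated c%:A.
Proof. by exists c%:MP; rewrite mmapC. Qed.

Lemma generated1 : generated 1.
Proof. by rewrite -[1]scale1r; apply: generated_scalar. Qed.

Lemma generatedD r t : generated r -> generated t -> generated (r + t).
Proof. by case=> p <- [q <-]; exists (p + q); rewrite rmorphD. Qed.

Lemma generatedM r t : generated r -> generated t -> generated (r * t).
Proof. by case=> p <- [q <-]; exists (p * q); rewrite rmorphM. Qed.

Lemma generatedZ c r : generated r -> generated (c *: r).
Proof. by move=> h; rewrite -mulr_algl; apply: generatedM h; apply: generated_scalar. Qed.

Lemma generatedN r : generated r -> generated (- r).
Proof. by move=> h; rewrite -scaleN1r; apply: generatedZ. Qed.

Lemma generated_gens :
  [/\ generated a, generated z, generated al, generated b & generated be].
Proof.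
have h i : generated (gens a z al b be i) by exists 'X_i; rewrite mmapX mmap1U.
by split; [apply: (h 0) | apply: (h 1) | apply: (h 2%:R) | apply: (h 3%:R) | apply: (h 4%:R)].
Qed.
End Generation.

Section ModelR.

Variable (k : fieldType).
Hypothesis hk : [pchar k] =i pred0.

Lemma nat_neq0 n : (n.+1%:R : k) != 0.
Proof. by rewrite (proj1 (pcharf0P k) hk). Qed.

Lemma alg_natK (A : comAlgType k) n : n.+1%:R * (n.+1%:R^-1)%:A = 1 :> A.
Proof.
by rewrite -[n.+1%:R](rmorph_nat (GRing.in_alg A)) -rmorphM mulfV ?nat_neq0 ?rmorph1.
Qed.

Local Notation x0 := (xD k 0).
Local Notation x1 := (xD k 1).
Local Notation x2 := (xD k 2%:R).
Local Notation vR := (val : ringR k -> ringD k).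

Definition aR : ringR k := rx k 0 0.
Definition zR : ringR k := 4%:R * rx k 2%:R 2%:R.
Definition alR : ringR k := 2%:R * rx k 0 2%:R.
Definition bR : ringR k := rx k 0 1.
Definition beR : ringR k := 2%:R * rx k 1 2%:R.

Lemma val_rx i j : vR (rx k i j) = xD k i * xD k j. Proof. by []. Qed.

Lemma rels_quadric (A : comNzRingType) (u v w : A) : 2%:R * u * w - v ^+ 2 = 1 ->
  rels 0 (u ^+ 2) (4%:R * w ^+ 2) (2%:R * u * w) (u * v) (2%:R * v * w).
Proof.
move=> e; split; try ring.
- by apply: (lincomb (eqM (- u ^+ 2) e)); ring.
- by apply: (lincomb (eqM (- (2%:R * u * w)) e)); ring.
- by apply: (lincomb (eqM (- (4%:R * w ^+ 2)) e)); ring.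
Qed.

Lemma rels_reflect m (A B : comNzRingType) (f : {rmorphism A -> B}) a z al b be :
  injective f -> rels m (f a) (f z) (f al) (f b) (f be) -> rels m a z al b be.
Proof.
move=> fi [e1 e2 e3 e4 e5 e6]; split; apply: fi;
  by rewrite ?(rmorphM, rmorphXn, rmorphB, rmorph1).
Qed.

Lemma relsR : rels 0 aR zR alR bR beR.
Proof.
apply: (rels_reflect (f := vR)) val_inj _.
have := rels_quadric (xD_rel k).
by rewrite /aR /zR /alR /bR /beR !(rmorphM vR) !(rmorph_nat vR) ?val_rx /= -!expr2 !mulrA.
Qed.

Local Notation genR := (generated aR zR alR bR beR).

Lemma genR_rx i j : genR (rx k i j).
Proof.
have [h1 h2 h3 h4 h5] := generated_gens aR zR alR bR beR.
have half r : genR (2%:R * r) -> genR r.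
  move=> h; rewrite -[r]mul1r -(alg_natK (ringR k) 1) mulrAC mulrC.
  by rewrite mulr_algl; apply: generatedZ.
have h3' := half _ h3; have h5' := half _ h5.
have h2' : genR (rx k 2%:R 2%:R).
  by apply/half/half; rewrite mulrA -natrM.
have h11 : genR (rx k 1 1).
  have -> : rx k 1 1 = alR + - 1.
    apply: val_inj; rewrite (rmorphD vR) (rmorphN vR) (rmorph1 vR) (rmorphM vR) (rmorph_nat vR) ?val_rx /=.
    by apply: (lincomb (eqM (- 1) (xD_rel k))); ring.
  by apply: generatedD => //; apply: generatedN; apply: generated1.
have sym i' j' : rx k i' j' = rx k j' i' by apply: val_inj; rewrite !val_rx mulrC.
have e (l : 'I_3) : [\/ l = 0, l = 1 | l = 2%:R].
  by case: l => [[|[|[|l]]] hl] //; [constructor 1|constructor 2|constructor 3]; apply: val_inj.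
case: (e i) => ->; case: (e j) => -> //; by rewrite sym.
Qed.

Fact ring_add (A : comNzRingType) (s t0 t1 t2 s' t0' t1' t2' y0 y1 y2 : A) :
  s + (t0 * y0 + t1 * y1 + t2 * y2) + (s' + (t0' * y0 + t1' * y1 + t2' * y2)) =
  s + s' + ((t0 + t0') * y0 + (t1 + t1') * y1 + (t2 + t2') * y2).
Proof. ring. Qed.

Fact ring_mul (A : comNzRingType) (s t0 t1 t2 y0 y1 y2 yi : A) :
  yi * (s + (t0 * y0 + t1 * y1 + t2 * y2)) =
  s * yi + (t0 * (y0 * yi) + t1 * (y1 * yi) + t2 * (y2 * yi)).
Proof. ring. Qed.

Lemma genR_all r : genR r.
Proof.
suff h (d : ringD k) : exists s t0 t1 t2 : ringR k, [/\ genR s, genR t0, genR t1, genR t2 &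
    d = vR s + (vR t0 * x0 + vR t1 * x1 + vR t2 * x2)].
  have [s [t0 [t1 [t2 [hs h0 h1 h2 e]]]]] := h (vR r).
  suff -> : r = s by [].
  apply: val_inj; rewrite /= e.
  set o := (X in _ + X); have muR (u : ringR k) : mu (vR u) = vR u.
    by have := valP u; rewrite unfold_in => /eqP.
  have : mu (vR r) = vR r := muR r; rewrite e -/o rmorphD /= muR.
  have -> : mu o = - o by rewrite /o !(rmorphD (@mu k)) !(rmorphM (@mu k)) /= !muR !mu_xD !mulrN -!opprD.
  move=> /addrI /eqP; rewrite eq_sym -subr_eq0 opprK -mulr2n -mulr_natl => /eqP o2.
  suff -> : o = 0 by rewrite addr0.
  by rewrite -[o]mul1r -(alg_natK (ringD k) 1) mulrAC o2 mul0r.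
have [p ->] := quot_piP d.
have h0 : genR 0 by rewrite -(scale0r 1); apply: generated_scalar.
elim/mpoly_gen_ind: p => [|p q|c p|i p].
- exists 1, 0, 0, 0; split=> //; first exact: generated1.
  by rewrite !rmorph1 !rmorph0 !mul0r !addr0.
- move=> [s [t0 [t1 [t2 [hs g0 g1 g2 e]]]]] [s' [t0' [t1' [t2' [hs' g0' g1' g2' e']]]]].
  exists (s + s'), (t0 + t0'), (t1 + t1'), (t2 + t2'); split; try exact: generatedD.
  by rewrite (rmorphD (quot_pi _)) /= e e' ?(rmorphD vR) /= ring_add.
- move=> [s [t0 [t1 [t2 [hs g0 g1 g2 e]]]]].
  exists (c *: s), (c *: t0), (c *: t1), (c *: t2); split; try exact: generatedZ.
  by rewrite linearZ /= e !scalerDr !scalerAl.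
- move=> [s [t0 [t1 [t2 [hs g0 g1 g2 e]]]]].
  exists (t0 * rx k 0 i + t1 * rx k 1 i + t2 * rx k 2%:R i),
    (if i == 0 then s else 0), (if i == 1 then s else 0), (if i == 2%:R then s else 0).
  split; try by case: ifP.
    by rewrite -addrA; do ?apply: generatedD; apply: generatedM (genR_rx _ _).
  rewrite (rmorphM (quot_pi _)) /= e -/(xD k i) ?(rmorphD vR) ?(rmorphM vR) /= ring_mul.
  have ei : [\/ i = 0, i = 1 | i = 2%:R].
    by case: i => [[|[|[|l]]] hl] //; [constructor 1|constructor 2|constructor 3]; apply: val_inj.
  rewrite [LHS]addrC; congr (_ + _).
  by case: ei => -> /=; rewrite ?(rmorph0 vR) !mul0r ?addr0 ?add0r.
Qed.

Section Embedding.
Variables (L : fieldType) (toL : {rmorphism {poly {poly k}} -> L}).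
Hypothesis toL_inj : injective toL.
Local Notation s := (sL toL).
Local Notation y := (yL toL).

Lemma embR : exists io : {rmorphism ringR k -> L}, embedding 0 toL io aR zR alR bR beR.
Proof.
have s0 : s != 0 := sL_neq0 toL_inj.
have n2 : (2%:R : L) != 0.
  by rewrite -(rmorph_nat (kL toL)) fmorph_eq0; exact: (nat_neq0 1).
pose v : 'I_3 -> L := fun i => nth 0 [:: s; y; (y ^+ 2 + 1) / (2%:R * s)] i.
pose f := mmap (kL toL) v.
have frel : f (relD k) = 0.
  rewrite /f /relD !rmorphB !rmorphM rmorph1 rmorph_nat /= !mmapX !mmap1U /v /=.
  by field; rewrite n2 s0.
have [||h hE] := @rmorph_factor _ (ringD k) L (quot_pi (@idealD k)) f.
- by move=> d; have [p ->] := quot_piP d; exists p.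
- move=> p /eqP; rewrite -[0](rmorph0 (quot_pi (@idealD k))) quot_pi_eq subr0.
  by case/asboolP => q ->; rewrite rmorphM /= [X in _ * X]frel mulr0.
have hx i : h (xD k i) = v i by rewrite /xD hE /f /= mmapX mmap1U.
exists (h \o vR : {rmorphism ringR k -> L}).
split => //=; rewrite ?(rmorphM vR, rmorph_nat vR) /= ?val_rx ?rmorphM ?rmorph_nat ?rmorphM ?hx /v /=.
- move=> c; have := hE c%:MP; rewrite /f /= mmapC => <-; congr (h _).
  by rewrite -[c%:MP]mulr1 mul_mpolyC (rmorph_alg (quot_pi _)).
- by rewrite expr2.
- by [].
- by rewrite muln0 expr0 mulr1; field; rewrite n2 s0.
- by rewrite expr1; field; rewrite n2 s0.
- by rewrite expr2; field; rewrite n2 s0.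
Qed.
End Embedding.

Lemma modelR : model 0 aR zR alR bR beR.
Proof.
split; [exact: relsR | exact: genR_all |].
have [io E] := embR (@tofrac_injective _).
by exists {fraction {poly {poly k}}}, (@tofrac {poly {poly k}}), io.
Qed.

End ModelR.

(* If [(a, c, e, b, w)] are the generators for [x Z = y^2 + 1], adjoining
   [v = (3/4 b c + w) / (15 a)] adjoins [e / a] and [w / a], which are the
   generators [x Z'] and [y Z'] for [x^3 Z' = y^2 + 1]. *)
Section Modification.
Variables (A : comNzRingType) (a c e b w q v : A).
Hypothesis R0 : rels 0 a c e b w.
Hypothesis hq : 4%:R * q = 1.
Hypothesis hv : 15%:R * a * v = 3%:R * q * b * c + w.

Definition al_of := q * (c * (3%:R * e + 1) - 60%:R * b * v).
Definition be_of := 15%:R * v - 3%:R * q * b * al_of ^+ 2.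
Definition z_of := al_of ^+ 3 - be_of ^+ 2.

Let r1 : e ^+ 2 = a * c := rel_alal R0.
Let r2 : e * b = a * w := rel_alb R0.
Let r3 : e * w = b * c := rel_albe R0.
Let r4 : b ^+ 2 = a * (e - 1).
Proof. by rewrite (rel_bb R0) expr0 mul1r. Qed.
Let r5 : b * w = e * (e - 1).
Proof. by rewrite (rel_bbe R0) expr0 mul1r. Qed.
Let r6 : w ^+ 2 = c * (e - 1).
Proof. by rewrite (rel_bebe R0) expr0 mul1r. Qed.

Lemma a_al : a * al_of = e.
Proof.
apply: (lincomb (eqD (eqM (- (q * (3%:R * e + 1))) r1) (eqD (eqM (- (4%:R * q * b)) hv)
  (eqD (eqM (- (12%:R * q ^+ 2 * c)) r4) (eqD (eqM (12%:R * q ^+ 2 * (e - 1)) r1)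
  (eqD (eqM (- (4%:R * q)) r5) (eqM (e - 3%:R * q * (e ^+ 3 - e ^+ 2)) hq))))))).
by rewrite /al_of; ring.
Qed.

Lemma al_e : al_of * e = c.
Proof.
apply: (lincomb (eqD (eqM (- (60%:R * q * v)) r2) (eqD (eqM (- (4%:R * q * w)) hv)
  (eqD (eqM (- (12%:R * q ^+ 2 * c)) r5) (eqD (eqM (- (4%:R * q)) r6)
  (eqM (c - 3%:R * q * c * (e ^+ 2 - e)) hq)))))).
by rewrite /al_of; ring.
Qed.

Lemma b_al : b * al_of = w.
Proof.
apply: (lincomb (eqD (eqM (- (60%:R * q * v)) r4) (eqD (eqM (- (4%:R * q * (e - 1))) hv)
  (eqD (eqM (- (4%:R * q)) r3) (eqM (w - 3%:R * q * (e - 1) * b * c) hq))))).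
by rewrite /al_of; ring.
Qed.

Lemma a_be : a * be_of = w.
Proof.
apply: (lincomb (eqD hv (eqD (eqM (- (3%:R * q * b * al_of)) a_al)
  (eqM (- (3%:R * q * b)) al_e)))).
by rewrite /be_of; ring.
Qed.

Lemma b_be : b * be_of = al_of * (e - 1).
Proof.
have alE : al_of = q * (c * (3%:R * e + 1) - 60%:R * b * v) by [].
apply: (lincomb (eqD (eqM (- (3%:R * q * al_of ^+ 2)) r4) (eqD (eqM (- (3%:R * q * (e - 1) * al_of)) a_al)
  (eqD (eqM (- (3%:R * q * (e - 1))) al_e) (eqD (eqM (- 1) al_e)
  (eqD (eqM (c - 15%:R * b * v) hq) alE)))))).
by rewrite /be_of; ring.
Qed.

Lemma rels_modification : rels 1 a z_of al_of b be_of.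
Proof.
have [h1 h2 h3 h4 h5] := And5 a_al al_e b_al a_be b_be.
rewrite /z_of; move: al_of be_of h1 h2 h3 h4 h5 => al be h1 h2 h3 h4 h5.
split; rewrite ?expr1.
- apply: (lincomb (eqD (eqM (- al ^+ 2) h1) (eqD (eqM be h4) (eqD (eqM (- be) h3) (eqM al h5))))); ring.
- by rewrite mulrC h3 h4.
- apply: (lincomb (eqD (eqM (- al ^+ 2) h3) (eqD (eqM (al ^+ 2) h4) (eqD (eqM (- (al * be)) h1) (eqM be h5))))); ring.
- apply: (lincomb (eqD r4 (eqM (- a) h1))); ring.
- apply: (lincomb (eqD h5 (eqM (- al) h1))); ring.
- apply: (lincomb (eqD (eqM (al * be) h4) (eqD (eqM (- (al * be)) h3) (eqD (eqM (al ^+ 2) h5)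
    (eqM (- al ^+ 3) h1))))); ring.
Qed.

Lemma a2_z : a ^+ 2 * z_of = c.
Proof.
rewrite expr2 -mulrA -(rel_alal rels_modification) expr2 mulrA a_al mulrC.
exact: al_e.
Qed.

End Modification.

Section ModelModification.

Variable (k : fieldType).
Hypothesis hk : [pchar k] =i pred0.
Variables (B T : comAlgType k) (a c e b w : B).
Hypothesis M0 : model 0 a c e b w.
Variable (F : {poly B}).
Hypothesis FE : 4%:R * F =
  60%:R * a%:P * 'X - 3%:R * b%:P * c%:P - 4%:R * w%:P.
Variable pi : {rmorphism {poly B} -> T}.
Hypothesis pi_surj : forall t, exists p, pi p = t.
Hypothesis pi_ker : forall p, pi p = 0 <-> exists q, p = q * F.
Hypothesis pi_scalar : forall s : k, pi (s%:A)%:P = s%:A.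

Local Notation iB r := (pi r%:P).
Let q : T := (4%:R^-1)%:A.
Let v := pi 'X.
Let R0 : rels 0 (iB a) (iB c) (iB e) (iB b) (iB w).
Proof. exact: (rels_morph (pi \o polyC)) (model_rels M0). Qed.
Let hq : 4%:R * q = 1. Proof. exact: alg_natK. Qed.
Let hv : 15%:R * iB a * v = 3%:R * q * iB b * iB c + iB w.
Proof.
have piF : pi (4%:R * F) = 0 by apply/pi_ker; exists 4%:R.
move: piF; rewrite FE !rmorphB !rmorphM !rmorph_nat /= -/v => piF.
apply: (lincomb (eqD (eqM q piF) (eqM (- (15%:R * iB a * v - iB w)) hq))).
by ring.
Qed.

Definition aT := iB a.
Definition alT := al_of (iB c) (iB e) (iB b) q v.
Definition beT := be_of (iB c) (iB e) (iB b) q v.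
Definition zT := z_of (iB c) (iB e) (iB b) q v.

Local Notation gen := (generated aT zT alT (iB b) beT).

Lemma genT t : gen t.
Proof.
have [g1 g2 g3 g4 g5] := generated_gens aT zT alT (iB b) beT.
have gB r : gen (iB r).
  elim/(model_ind M0): r => [|u1 u2 h1 h2|s u h|u h].
  - by rewrite rmorph1; apply: generated1.
  - by rewrite !rmorphD; apply: generatedD.
  - rewrite -mulr_algl rmorphM rmorphM pi_scalar.
    exact: generatedM (generated_scalar _ _ _ _ _ _) h.
  - have gc : gen (iB c).
      by rewrite -(a2_z R0 hq hv) expr2; do ?apply: generatedM.
    have ge : gen (iB e).
      by rewrite -(a_al R0 hq hv); apply: generatedM.
    have gw : gen (iB w).
      by rewrite -(a_be R0 hq hv); apply: generatedM.
    by rewrite !rmorphM; split; apply: generatedM.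
have [p <-] := pi_surj t; elim/poly_ind: p => [|p r IH].
  by rewrite rmorph0 -(scale0r 1); apply: generated_scalar.
rewrite rmorphD rmorphM; apply: generatedD; last exact: gB.
apply: generatedM IH _.
have -> : pi 'X = (15%:R^-1)%:A * (beT + (3%:R *: q) * iB b * alT ^+ 2).
  rewrite /beT /be_of -/alT -/v; have h15 := alg_natK hk T 14.
  rewrite scaler_nat -[q *+ 3]mulr_natl.
  by apply: (lincomb (eqM (- v) h15)); ring.
apply: generatedM; first exact: generated_scalar.
apply: generatedD g5 _; apply: generatedM; last by rewrite expr2; apply: generatedM.
by apply: generatedM g4; apply: generatedZ; apply: generated_scalar.
Qed.

Lemma model_modification : model 1 aT zT alT (iB b) beT.
Proof.
split; [exact: (rels_modification R0 hq hv) | exact: genT |].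
have [L [toL [io E]]] := model_emb M0.
have s0 := sL_neq0 (emb_inj E).
have n15 : (15%:R : L) != 0.
  by rewrite -(rmorph_nat (kL toL)) fmorph_eq0 (nat_neq0 hk 14).
have n4 : (4%:R : L) != 0.
  by rewrite -(rmorph_nat (kL toL)) fmorph_eq0 (nat_neq0 hk 3).
have ioa : io a != 0 by rewrite (emb_a E) expf_neq0.
pose v0 := (3%:R / 4%:R * io b * io c + io w) / (15%:R * io a).
pose f := horner_morph (fun x => mulrC v0 (io x)).
have fF : f F = 0.
  apply: (mulfI n4); rewrite mulr0 -(rmorph_nat f) -rmorphM FE.
  rewrite !rmorphB !rmorphM !rmorph_nat /= !horner_morphC horner_morphX /v0.
  by field; rewrite ioa n15 n4.
have [||h hE] := @rmorph_factor _ T L pi f; first exact: pi_surj.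
  by move=> p /pi_ker[r ->]; rewrite rmorphM /= [X in _ * X]fF mulr0.
have hB r : h (iB r) = io r by rewrite hE [LHS]horner_morphC.
exists L, toL, h; split.
- exact: emb_inj E.
- by move=> s; rewrite -pi_scalar hB (emb_scalar E).
- by rewrite hB (emb_a E).
- by rewrite hB (emb_b E).
- by rewrite -(emb_a E) -hB -rmorphM mulrC (a_al R0 hq hv) hB -(emb_al E) muln0 expr0 mulr1.
- rewrite exprSr mulrA muln1 -(emb_a E) -hB -rmorphM [_ * iB a]mulrC (a_be R0 hq hv) hB -(emb_be E).
  by rewrite muln0.
- have -> : (2 * (2 * 1).+1 = 2 * 2 + 2)%N by [].
  rewrite exprD exprM -(emb_a E) -hB mulrA -rmorphXn -rmorphM [_ * iB a ^+ _]mulrC.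
  by rewrite (a2_z R0 hq hv) !hB -(emb_z E) (emb_a E).
Qed.

End ModelModification.

Section ModelQuotient.
Variable (k : fieldType).
Hypothesis hk : [pchar k] =i pred0.
Variables (B : comAlgType k) (a c e b w : B) (I : idealr (poly_alg B)).
Variables (r22 r12 : B) (F : {poly B}).
Hypothesis M0 : model 0 a (4%:R * r22) e b (2%:R * r12).
Hypothesis FE : F = 15%:R * a%:P * 'X - 3%:R * b%:P * r22%:P - 2%:R * r12%:P.
Hypothesis IE : forall p : poly_alg B, reflect (exists q : poly_alg B, p = q * F) (p \in I).

Lemma model_quotient : exists a z al b be : quot_alg I, model 1 a z al b be.
Proof.
pose pi : {rmorphism {poly B} -> quot_alg I} := quot_pi I.
have FE' : 4%:R * F = 60%:R * a%:P * 'X - 3%:R * b%:P * (4%:R * r22)%:P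
    - 4%:R * (2%:R * r12)%:P.
  by rewrite FE !polyCM !polyC_natr; ring.
do 5!eexists; apply: (model_modification hk M0 FE' (pi := pi)).
- by move=> t; have [p ->] := quot_piP t; exists p.
- move=> p; have -> : (pi p = 0) <-> is_true (quot_pi I p == quot_pi I 0).
    by rewrite rmorph0; split=> [->|/eqP].
  by rewrite quot_pi_eq subr0; split=> /IE.
- move=> s; rewrite /pi /=.
  by rewrite -[RHS](rmorph_alg (quot_pi I)); congr (quot_pi _ _); rewrite -[LHS]mulr1.
Qed.
End ModelQuotient.

Lemma modelRt (k : fieldType) (hk : [pchar k] =i pred0) :
  exists a z al b be : ringRt k, model 1 a z al b be.
Proof.
apply: (model_quotient hk (modelR hk) (erefl _)) => p.
exact: asboolP.
Qed.

(** * Group actions *)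

Section Tuples.

Variables (m : nat).

Definition tuple5 (A : Type) : Type := (A * A * A * A * A)%type.

Definition map5 (A B : Type) (f : A -> B) (q : tuple5 A) : tuple5 B :=
  let: (a, z, al, b, be) := q in (f a, f z, f al, f b, f be).

Definition rels5 (A : comNzRingType) (q : tuple5 A) : Prop :=
  let: (a, z, al, b, be) := q in rels m a z al b be.

(* The flow [y -> y + t x^n], [Z -> Z + 2 t y + t^2 x^n], where [n = 2m+1]. *)
Definition ga5 (A : comNzRingType) (t : A) (q : tuple5 A) : tuple5 A :=
  let: (a, z, al, b, be) := q in let p := a ^+ m in
  (a, z + 4%:R * t * be + t ^+ 2 * (6%:R * p * al - 4%:R) + 4%:R * t ^+ 3 * p * b
       + t ^+ 4 * p ^+ 2 * a,
   al + 2%:R * t * b + t ^+ 2 * p * a, b + t * p * a,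
   be + t * (3%:R * p * al - 2%:R) + 3%:R * t ^+ 2 * p * b + t ^+ 3 * p ^+ 2 * a).

Lemma ga5_rels (A : comNzRingType) (t : A) q : rels5 q -> rels5 (ga5 t q).
Proof.
case: q => [[[[a z] l] b] e] /= [r1 r2 r3 r4 r5 r6].
split; move: (a ^+ m) r1 r2 r3 r4 r5 r6 => p r1 r2 r3 r4 r5 r6.
- apply: (lincomb (eqD r1 (eqD (eqM (4%:R * t) r2) (eqM (4%:R * t ^+ 2) r4)))); ring.
- apply: (lincomb (eqD r2 (eqM (2%:R * t) r4))); ring.
- apply: (lincomb (eqD r3 (eqD (eqM (- (2%:R * t)) r5) (eqD (eqM (t * p) r1)
    (eqD (eqM (3%:R * t ^+ 2 * p) r2) (eqM (2%:R * t ^+ 3 * p) r4)))))); ring.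
- apply: (lincomb r4); ring.
- apply: (lincomb (eqD r5 (eqD (eqM (- (t * p)) r2) (eqM (- (t ^+ 2 * p)) r4)))); ring.
- apply: (lincomb (eqD r6 (eqD (eqM (2%:R * t * p) r3) (eqD (eqM (- (2%:R * t ^+ 2 * p)) r5)
   (eqD (eqM (t ^+ 2 * p ^+ 2) r1) (eqD (eqM (2%:R * t ^+ 3 * p ^+ 2) r2)
   (eqM (t ^+ 4 * p ^+ 2) r4))))))); ring.
Qed.

Lemma ga5_0 (A : comNzRingType) (q : tuple5 A) : ga5 0 q = q.
Proof. by case: q => [[[[a z] l] b] e] /=; congr (_, _, _, _, _); ring. Qed.

Lemma ga5_D (A : comNzRingType) (t t' : A) (q : tuple5 A) : ga5 (t + t') q = ga5 t (ga5 t' q).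
Proof.
case: q => [[[[a z] l] b] e] /=; move: (a ^+ m) => p; congr (_, _, _, _, _); ring.
Qed.

Lemma ga5_map (A B : comNzRingType) (f : {rmorphism A -> B}) t q :
  map5 f (ga5 t q) = ga5 (f t) (map5 f q).
Proof.
case: q => [[[[a z] l] b] e] /=.
have -> : f a ^+ m = f (a ^+ m) by rewrite rmorphXn.
by move: (a ^+ m) => p; congr (_, _, _, _, _); ring.
Qed.

End Tuples.

Section Torus.

(* The torus [x -> u x, Z -> u^-3 Z], where [v = u^-1]. *)
Definition gm5 (A : comNzRingType) (u v : A) (q : tuple5 A) : tuple5 A :=
  let: (a, z, al, b, be) := q in
  (u ^+ 2 * a, v ^+ 6 * z, v ^+ 2 * al, u * b, v ^+ 3 * be).

Lemma gm5_rels (A : comNzRingType) (u v : A) q : u * v = 1 -> rels5 1 q -> rels5 1 (gm5 u v q).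
Proof.
case: q => [[[[a z] l] b] e] /= uv [r1 r2 r3 r4 r5 r6].
have uv2 : u ^+ 2 * v ^+ 2 = 1 by rewrite -exprMn uv expr1n.
split.
- by apply: (lincomb (eqD (eqM (v ^+ 4) r1) (eqM (- (v ^+ 4 * a * z)) uv2))); ring.
- apply: (lincomb (eqD (eqM (u * v ^+ 2) r2) (eqM (- (u * v ^+ 2 * a * e)) uv))); ring.
- apply: (lincomb (eqD (eqM (v ^+ 5) r3) (eqM (- (v ^+ 5 * b * z)) uv))); ring.
- rewrite expr1; apply: (lincomb (eqD (eqM (u ^+ 2) r4) (eqM (- (u ^+ 2 * a * (a * l))) uv2))).
  rewrite expr1; ring.
- rewrite expr1; apply: (lincomb (eqD (eqM (u * v ^+ 3) r5)
    (eqD (eqM (- (v ^+ 2 * l * (a * l))) uv2) (eqM (v ^+ 2 * l * (a * l - 1)) uv)))).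
  rewrite expr1; ring.
- rewrite expr1; apply: (lincomb (eqD (eqM (v ^+ 6) r6) (eqM (- (v ^+ 6 * z * (a * l))) uv2))).
  rewrite expr1; ring.
Qed.

Lemma gm5_1 (A : comNzRingType) (q : tuple5 A) : gm5 1 1 q = q.
Proof. by case: q => [[[[a z] l] b] e] /=; congr (_, _, _, _, _); ring. Qed.

Lemma gm5_M (A : comNzRingType) (u v u' v' : A) (q : tuple5 A) :
  gm5 (u * u') (v * v') q = gm5 u v (gm5 u' v' q).
Proof. by case: q => [[[[a z] l] b] e] /=; congr (_, _, _, _, _); ring. Qed.

Lemma gm5_map (A B : comNzRingType) (f : {rmorphism A -> B}) u v q :
  map5 f (gm5 u v q) = gm5 (f u) (f v) (map5 f q).
Proof.
by case: q => [[[[a z] l] b] e] /=; congr (_, _, _, _, _); ring.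
Qed.

Lemma gm5_ga5 (A : comNzRingType) (u v t : A) (q : tuple5 A) : u * v = 1 ->
  gm5 u v (ga5 1 t q) = ga5 1 (v ^+ 3 * t) (gm5 u v q).
Proof.
case: q => [[[[a z] l] b] e] /= uv; rewrite !expr1.
have uv2 : u ^+ 2 * v ^+ 2 = 1 by rewrite -exprMn uv expr1n.
have uv3 : u ^+ 3 * v ^+ 3 = 1 by rewrite -exprMn uv expr1n.
have uv6 : u ^+ 6 * v ^+ 6 = 1 by rewrite -exprMn uv expr1n.
have uv4 : u ^+ 4 * v ^+ 4 = 1 by rewrite -exprMn uv expr1n.
congr (_, _, _, _, _).
- apply: (lincomb (eqD (eqM (- (6%:R * v ^+ 6 * t ^+ 2 * a * l)) uv2)
   (eqD (eqM (- (4%:R * v ^+ 6 * t ^+ 3 * a * b)) uv3) (eqM (- (v ^+ 6 * t ^+ 4 * a ^+ 3)) uv6)))); ring.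
- apply: (lincomb (eqD (eqM (- (2%:R * v ^+ 2 * t * b)) uv) (eqM (- (v ^+ 2 * t ^+ 2 * a ^+ 2)) uv4))); ring.
- apply: (lincomb (eqM (- (u * t * a ^+ 2)) uv3)); ring.
- apply: (lincomb (eqD (eqM (- (3%:R * v ^+ 3 * t * a * l)) uv2)
   (eqD (eqM (- (3%:R * v ^+ 3 * t ^+ 2 * a * b)) uv3) (eqM (- (v ^+ 3 * t ^+ 3 * a ^+ 3)) uv6)))); ring.
Qed.

End Torus.

Section Points.

Variables (k : fieldType) (m : nat) (C : comAlgType k) (a z al b be : C).
Hypothesis M : model m a z al b be.

Definition coords (A : comAlgType k) (x : {lrmorphism C -> A}) : tuple5 A :=
  map5 x (a, z, al, b, be).

Lemma coords_rels (A : comAlgType k) (x : {lrmorphism C -> A}) : rels5 m (coords x).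
Proof. exact: rels_morph (model_rels M). Qed.

Lemma coords_inj (A : comAlgType k) : injective (@coords A).
Proof.
move=> x y [e1 e2 e3 e4 e5]; apply: lrmorph_ext.
by apply: (model_ext M) => // c; apply: etrans (rmorph_alg x c) (esym (rmorph_alg y c)).
Qed.

Lemma point_ex (A : comAlgType k) (q : tuple5 A) : rels5 m q ->
  exists x : {lrmorphism C -> A}, coords x = q.
Proof.
case: q => [[[[a' z'] l'] b'] e'] /= h.
have [x [e1 e2 e3 e4 e5]] := model_lrmorph M h.
by exists x; rewrite /coords /= e1 e2 e3 e4 e5.
Qed.

Definition point (A : comAlgType k) (q : tuple5 A) (h : rels5 m q) : {lrmorphism C -> A} :=
  sval (cid (point_ex h)).

Lemma pointK (A : comAlgType k) (q : tuple5 A) (h : rels5 m q) : coords (point h) = q.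
Proof. by rewrite /point; case: cid. Qed.

Lemma coords_comp (A B : comAlgType k) (f : {lrmorphism A -> B}) (x : {lrmorphism C -> A}) :
  coords (f \o x) = map5 f (coords x).
Proof. by []. Qed.

End Points.

Section Action.

Variables (k : fieldType).
Hypothesis hk : [pchar k] =i pred0.
Variables (C : comAlgType k) (a z al b be : C).
Hypothesis M : model 1 a z al b be.
Local Notation coords := (@coords k C a z al b be _).

Definition weight_act (A : comAlgType k) (h : Gm k A) (t : Ga k A) : Ga k A :=
  (val h).2 ^+ 3 * t.

Definition weight_action : kaction (Gm k) (Ga k).
refine (@KAction k (Gm k) (Ga k) weight_act _ _ _).
- by move=> A t; rewrite /weight_act /= expr1n mul1r.
- by move=> A g h t; rewrite /weight_act /= exprMn mulrA.
- by move=> A A' f g t; rewrite /weight_act /= rmorphM rmorphXn.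
Defined.

Definition weight_aut : kaut_action (Gm k) (Ga k).
refine (@KAutAction k (Gm k) (Ga k) weight_action _).
by move=> A h t t'; rewrite /= /weight_act mulrDr.
Defined.

Lemma weight_nontrivial : ~ aut_trivial weight_aut.
Proof.
have n2 := nat_neq0 hk 1.
have u2 : (2%:R : k^o) * 2%:R^-1 == 1 by rewrite mulfV.
move=> /(_ k^o (exist _ (2%:R, 2%:R^-1) u2) 1); rewrite /= /weight_act /= mulr1 => e.
have : (2%:R : k) ^+ 3 * 2%:R^-1 ^+ 3 = 1 by rewrite -exprMn mulfV // expr1n.
rewrite e mulr1 -natrX => /eqP; rewrite -subr_eq0 -(natrB _ (isT : 1 <= 2 ^ 3)%N).
by apply/negP; exact: (nat_neq0 hk 6).
Qed.

Lemma surf_rels (A : comAlgType k) (g : sdprod weight_aut A) (x : spec_pts C A) :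
  rels5 1 (ga5 1 g.1 (gm5 (val g.2).1 (val g.2).2 (coords x))).
Proof.
by apply/ga5_rels/gm5_rels; [apply/eqP: (valP g.2) | apply: coords_rels M _ _].
Qed.

Definition surf_act (A : comAlgType k) (g : sdprod weight_aut A) (x : spec_pts C A) :
  spec_pts C A := point M (surf_rels g x).

Lemma surf_actE (A : comAlgType k) (g : sdprod weight_aut A) (x : spec_pts C A) :
  coords (surf_act g x) = ga5 1 g.1 (gm5 (val g.2).1 (val g.2).2 (coords x)).
Proof. exact: pointK. Qed.

Definition surf_action : kaction (sdprod weight_aut) (Spec C).
refine (@KAction k (sdprod weight_aut) (Spec C) surf_act _ _ _).
- move=> A x; apply: (coords_inj M); rewrite surf_actE.
  exact: etrans (congr1 (ga5 1 0) (gm5_1 _)) (ga5_0 1 _).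
- move=> A g h x; apply: (coords_inj M); rewrite !surf_actE.
  rewrite [gm5 (val g.2).1 _ _]gm5_ga5 -?ga5_D -?gm5_M //; exact: eqP (valP g.2).
- move=> A A' f g x; apply: (coords_inj M); rewrite surf_actE.
  by rewrite [LHS]coords_comp surf_actE ga5_map gm5_map coords_comp.
Defined.

Lemma surf_effective : effective surf_action.
Proof.
move=> A [t h] triv; have uv : (val h).1 * (val h).2 = 1 := eqP (valP h).
have P0 : rels5 1 ((1, 1, 1, 0, 0) : tuple5 A) by split; ring.
have P1 : rels5 1 ((1, 4%:R, 2%:R, 1, 2%:R) : tuple5 A) by split; ring.
have act x : ga5 1 t (gm5 (val h).1 (val h).2 (coords x)) = coords x.
  by rewrite -(surf_actE (t, h)); congr (coords _); rewrite -[RHS](triv A idfun x); congr (surf_act (_, _) _); apply: val_inj; case: (h) => -[].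
have := act (point M P0); rewrite pointK /= => -[_ _ _ eb _].
have := act (point M P1); rewrite pointK /= => -[_ _ _ eb' _].
set u := (val h).1 in uv eb eb'.
have t0 : t = 0.
  have uv4 : u ^+ 4 * (val h).2 ^+ 4 = 1 by rewrite -exprMn uv expr1n.
  by apply: (lincomb (eqD (eqM ((val h).2 ^+ 4) eb) (eqM (- t) uv4))); ring.
have u1 : u = 1 by move: eb'; rewrite t0 !mul0r addr0 mulr1.
have v1 : (val h).2 = 1 by move: uv; rewrite u1 mul1r.
rewrite t0; congr (_, _); apply: val_inj => /=.
by rewrite [LHS]surjective_pairing -/u u1 v1.
Qed.

Lemma surf_fixed_point_free : fixed_point_free (act_normal surf_action).
Proof.
move=> A x fixed.
have : ga5 1 1 (coords x) = coords x.
  rewrite -[RHS](congr1 (fun y => coords y) (fixed A idfun 1)).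
  by rewrite [RHS]surf_actE [gm5 _ _ _]gm5_1.
case: (coords x) => [[[[a' z'] l'] b'] e'] /=.
rewrite !expr1n !expr1 => -[_ _ eb ee].
have a2 : a' ^+ 2 = 0 by apply: (lincomb eb); ring.
have e2 : 2%:R = a' * (3%:R * l' + 3%:R * b') + a' ^+ 2 * a'.
  by apply: (lincomb (eqM (- 1) ee)); ring.
have h2 := alg_natK hk A 1.
have a0 : a' = 0.
  apply: (lincomb (eqD (eqM (a' * (2%:R^-1)%:A) e2) (eqD (eqM (- a') h2)
     (eqM ((2%:R^-1)%:A * (3%:R * l' + 3%:R * b' + a' ^+ 2)) a2)))); ring.
by apply/negP: (mulr1_neq0l h2); rewrite negbK e2 a0 expr0n /= !mul0r addr0.
Qed.

End Action.

(** * Stable isomorphism *)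

Section GenericPoint.

Variables (k : fieldType) (m : nat) (C : comAlgType k) (a z al b be : C).
Hypothesis M : model m a z al b be.

Definition tup (K : fieldType) (x y : K) : tuple5 K :=
  (x ^+ 2, (y ^+ 2 + 1) ^+ 2 / x ^+ (2 * (2 * m).+1), (y ^+ 2 + 1) / x ^+ (2 * m),
   x * y, y * (y ^+ 2 + 1) / x ^+ (2 * m).+1).

Lemma tup_rels (K : fieldType) (x y : K) : x != 0 -> rels5 m (tup x y).
Proof.
move=> x0; have e : x ^+ 2 ^+ m = x ^+ (2 * m) by rewrite -exprM.
have e2 : x ^+ (2 * (2 * m).+1) = (x ^+ (2 * m)) ^+ 2 * x ^+ 2.
  by rewrite -exprM -exprD; congr (_ ^+ _); lia.
rewrite /tup /rels5 e2 [x ^+ (2 * m).+1]exprS.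
have X0 := expf_neq0 (2 * m) x0.
split; rewrite ?e; move: (x ^+ (2 * m)) X0 => X X0; field; by rewrite ?x0 ?X0.
Qed.

Lemma poly_generic_point : exists (K : fieldType) (J : {rmorphism {poly C} -> K}) (x y : K),
  [/\ injective J, x != 0 &
    map5 (fun c => J c%:P) (a, z, al, b, be) = tup x y].
Proof.
have [L [toL [io E]]] := model_emb M.
pose tf : {rmorphism {poly L} -> {fraction {poly L}}} := @tofrac {poly L}.
pose J : {rmorphism {poly C} -> {fraction {poly L}}} := tf \o map_poly io.
have tfi : injective tf := @tofrac_injective _.
exists {fraction {poly L}}, J, (tf (sL toL)%:P), (tf (yL toL)%:P).
have Ji : injective J.
  by move=> p q /tfi; apply: (map_inj_poly (embedding_inj M E) (rmorph0 io)).
have x0 : tf (sL toL)%:P != 0.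
  rewrite -(rmorph0 tf) (inj_eq tfi) polyC_eq0; exact: sL_neq0 (emb_inj E).
split=> //.
have JC c : J c%:P = tf (io c)%:P by rewrite /J /= map_polyC.
rewrite /tup /map5 !JC.
have s0 n : sL toL ^+ n != 0 by rewrite expf_neq0 ?(sL_neq0 (emb_inj E)).
have e1 : io al = (yL toL ^+ 2 + 1) / sL toL ^+ (2 * m) by rewrite -(emb_al E) mulfK.
have e2 : io z = (yL toL ^+ 2 + 1) ^+ 2 / sL toL ^+ (2 * (2 * m).+1) by rewrite -(emb_z E) mulfK.
have e3 : io be = yL toL * (yL toL ^+ 2 + 1) / sL toL ^+ (2 * m).+1 by rewrite -(emb_be E) mulfK.
have g : forall c : L, forall n, tf (c / sL toL ^+ n)%:P = tf c%:P / tf (sL toL)%:P ^+ n.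
  move=> c n; apply: (canRL (mulfK _)); first by rewrite expf_neq0.
  by rewrite -rmorphXn -rmorphM -polyC_exp -polyCM mulfVK.
rewrite e1 e2 e3 !g (emb_a E) (emb_b E).
by rewrite !(rmorphXn, rmorphM, rmorphD, rmorph1) /=.
Qed.

End GenericPoint.

Section StableIsomorphism.

Section Maps.
Variable (A : comNzRingType).
Implicit Types (q : tuple5 A) (h s : A).

(* The fibre product of the surfaces [x Z = y^2 + 1] and [x^3 Z = y^2 + 1] over
   the common base of their translation actions is parametrized by
   [y' = y (3 y^4 + 10 y^2 + 15) / 8 + x^3 s] over the first and by
   [y = y' + x s'] over the second; here [h] stands for [1/8]. *)
Definition lift_point h q s : tuple5 A :=
  let: (a, c, e, b, w) := q in
  let H := (3%:R * e ^+ 2 + 4%:R * e + 8%:R) * h in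
  let G := (9%:R * e ^+ 2 + 15%:R * e + 40%:R) * h ^+ 2 in
  (a, c ^+ 3 * G ^+ 2 + 4%:R * G * H * c * w * s
        + (4%:R * H ^+ 2 * (e - 1) + 2%:R * e ^+ 3 * G) * s ^+ 2
        + 4%:R * H * a * b * s ^+ 3 + a ^+ 3 * s ^+ 4,
   e * c * G + 2%:R * b * H * s + a ^+ 2 * s ^+ 2, b * H + a ^+ 2 * s,
   H * G * w * c + 2%:R * H ^+ 2 * (e - 1) * s + 3%:R * H * a * b * s ^+ 2
     + e ^+ 3 * G * s + a ^+ 3 * s ^+ 3).

Definition lift_param h q s : A :=
  let: (a, c, e, b, w) := q in - (h * w * (3%:R * e + 4%:R)) - a * s.

Definition drop_point q s : tuple5 A :=
  let: (a, z, l, b, be) := q in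
  (a, a ^+ 2 * z + 4%:R * a * be * s + (6%:R * a * l - 4%:R) * s ^+ 2
        + 4%:R * b * s ^+ 3 + a * s ^+ 4,
   a * l + 2%:R * b * s + a * s ^+ 2, b + a * s,
   a * be + 2%:R * (a * l - 1) * s + 3%:R * b * s ^+ 2 + a * l * s + a * s ^+ 3).

Definition drop_param h q s : A :=
  let: (a, z, l, b, be) := q in
  - (h * be * (3%:R * a * l + 4%:R)) - 15%:R * h * a ^+ 2 * z * s
  - 30%:R * h * a * be * s ^+ 2 - 10%:R * h * (3%:R * a * l - 2%:R) * s ^+ 3
  - 15%:R * h * b * s ^+ 4 - 3%:R * h * a * s ^+ 5.
End Maps.

Lemma lift_map (A B : comNzRingType) (f : {rmorphism A -> B}) h q s :
  map5 f (lift_point h q s) = lift_point (f h) (map5 f q) (f s) /\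
  f (lift_param h q s) = lift_param (f h) (map5 f q) (f s).
Proof.
by case: q => [[[[a z] l] b] e] /=; split; [congr (_, _, _, _, _) | ]; ring.
Qed.

Lemma drop_map (A B : comNzRingType) (f : {rmorphism A -> B}) h q s :
  map5 f (drop_point q s) = drop_point (map5 f q) (f s) /\
  f (drop_param h q s) = drop_param (f h) (map5 f q) (f s).
Proof.
by case: q => [[[[a z] l] b] e] /=; split; [congr (_, _, _, _, _) | ]; ring.
Qed.

Section Field.
Variables (K : fieldType) (x y s h : K).
Hypotheses (x0 : x != 0) (hh : 8%:R * h = 1).

Let e8 : (8%:R : K) != 0 := mulr1_neq0l hh.
Let hE : h = 8%:R^-1.
Proof. by apply: (mulfI e8); rewrite hh mulfV. Qed.

Let q8 := y * (3%:R * y ^+ 4 + 10%:R * y ^+ 2 + 15%:R) / 8%:R.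

Lemma lift_tup : let y' := q8 + x ^+ 3 * s in
  lift_point h (tup 0 x y) s = tup 1 x y' /\ lift_param h (tup 0 x y) s = (y - y') / x.
Proof.
rewrite /tup /= /q8 hE ?muln0 ?muln1 ?expr0 ?expr1.
split; last (field; by rewrite ?x0 ?e8 ?oner_eq0).
by congr (_, _, _, _, _); field; rewrite ?x0 ?e8 ?oner_eq0.
Qed.

Lemma drop_tup : let y' := y + x * s in
  drop_point (tup 1 x y) s = tup 0 x y' /\
  drop_param h (tup 1 x y) s =
    (y - y' * (3%:R * y' ^+ 4 + 10%:R * y' ^+ 2 + 15%:R) / 8%:R) / x ^+ 3.
Proof.
rewrite /tup /= hE ?muln0 ?muln1 ?expr0 ?expr1.
split; last (field; by rewrite ?x0 ?e8 ?oner_eq0).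
by congr (_, _, _, _, _); field; rewrite ?x0 ?e8 ?oner_eq0.
Qed.
End Field.

Lemma map5_inj (A B : Type) (f : A -> B) : injective f -> injective (map5 f).
Proof.
by move=> fi [[[[a z] l] b] e] [[[[a' z'] l'] b'] e'] /= [] /fi-> /fi-> /fi-> /fi-> /fi->.
Qed.

Lemma rels5_map m (A B : comNzRingType) (f : {rmorphism A -> B}) q :
  rels5 m q -> rels5 m (map5 f q).
Proof. by case: q => [[[[a z] l] b] e]; apply: rels_morph. Qed.

Lemma rels5_reflect m (A B : comNzRingType) (f : {rmorphism A -> B}) q :
  injective f -> rels5 m (map5 f q) -> rels5 m q.
Proof. by case: q => [[[[a z] l] b] e]; apply: rels_reflect. Qed.

Section Algebras.
Variable (k : fieldType).
Hypothesis hk : [pchar k] =i pred0.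

Definition eighth (A : comAlgType k) : A := (8%:R^-1)%:A.

Lemma eval_poly_point (B A : comAlgType k) (x : {lrmorphism B -> A}) (s : A) :
  exists ev : {rmorphism {poly B} -> A},
    [/\ ev 'X = s, forall c, ev c%:P = x c & ev (eighth B)%:P = eighth A].
Proof.
exists (horner_morph (fun c => mulrC s (x c))).
split=> [|c|]; [exact: horner_morphX | exact: horner_morphC |].
apply: etrans (horner_morphC _ _) _; exact: (rmorph_alg x).
Qed.

Lemma lift_universal (B : comAlgType k) a c e b w (M : model 0 (a : B) c e b w)
    (A : comAlgType k) (x : {lrmorphism B -> A}) (s : A) (q := coords a c e b w x) :
  let q' := lift_point (eighth A) q s in let s' := lift_param (eighth A) q s in
  [/\ rels5 1 q', drop_point q' s' = q & drop_param (eighth A) q' s' = s].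
Proof.
have [K [J [x0 [y0 [Ji x0n Jg]]]]] := poly_generic_point M.
have hh : 8%:R * J (eighth B)%:P = 1.
  by rewrite -(rmorph_nat J) -rmorphM -polyC_natr -polyCM alg_natK // rmorph1.
have [f [fX fC f8]] := eval_poly_point x s.
pose qU := map5 polyC (a, c, e, b, w).
have fq : map5 f qU = q by rewrite /qU /= !fC.
have Jq : map5 J qU = tup 0 x0 y0 by rewrite -Jg.
have [l1 l2] := lift_tup y0 (J 'X) x0n hh.
set y1 := _ + _ in l1 l2.
have [d1 d2] := drop_tup y1 ((y0 - y1) / x0) x0n hh.
have yE : y1 + x0 * ((y0 - y1) / x0) = y0 by field.
have [L1 L2] := lift_map J (eighth B)%:P qU 'X; rewrite Jq l1 l2 in L1 L2.
have [F1 F2] := lift_map f (eighth B)%:P qU 'X; rewrite fq fX f8 in F1 F2.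
have [D1 D2] := drop_map J (eighth B)%:P (lift_point (eighth B)%:P qU 'X) (lift_param (eighth B)%:P qU 'X).
rewrite L1 L2 d1 d2 yE in D1 D2.
have [G1 G2] := drop_map f (eighth B)%:P (lift_point (eighth B)%:P qU 'X) (lift_param (eighth B)%:P qU 'X).
rewrite F1 F2 f8 in G1 G2.
move=> q' s'; rewrite {}/q' {}/s' -G1 -G2 -F1 -fX -fq; split.
- apply: rels5_map; apply: (rels5_reflect Ji); rewrite L1; exact: tup_rels.
- by congr (map5 f _); apply: (map5_inj Ji); rewrite D1 Jq.
- congr (f _); apply: Ji; rewrite D2 /y1; field; rewrite ?x0n //=.
  exact: mulr1_neq0l hh.
Qed.

Lemma drop_universal (T : comAlgType k) a z l b be (M : model 1 (a : T) z l b be)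
    (A : comAlgType k) (x : {lrmorphism T -> A}) (s : A) (q := coords a z l b be x) :
  let q' := drop_point q s in let s' := drop_param (eighth A) q s in
  [/\ rels5 0 q', lift_point (eighth A) q' s' = q & lift_param (eighth A) q' s' = s].
Proof.
have [K [J [x0 [y0 [Ji x0n Jg]]]]] := poly_generic_point M.
have hh : 8%:R * J (eighth T)%:P = 1.
  by rewrite -(rmorph_nat J) -rmorphM -polyC_natr -polyCM alg_natK // rmorph1.
have e8 : (8%:R : K) != 0 := mulr1_neq0l hh.
have [f [fX fC f8]] := eval_poly_point x s.
pose qU := map5 polyC (a, z, l, b, be).
have fq : map5 f qU = q by rewrite /qU /= !fC.
have Jq : map5 J qU = tup 1 x0 y0 by rewrite -Jg.
have [d1 d2] := drop_tup y0 (J 'X) x0n hh.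
set y1 := _ + _ in d1 d2; set s1 := _ / _ in d2.
have [l1 l2] := lift_tup y1 s1 x0n hh.
have yE : y1 * (3%:R * y1 ^+ 4 + 10%:R * y1 ^+ 2 + 15%:R) / 8%:R + x0 ^+ 3 * s1 = y0.
  by rewrite /s1; field; rewrite ?x0n ?e8.
have [D1 D2] := drop_map J (eighth T)%:P qU 'X; rewrite Jq d1 d2 in D1 D2.
have [G1 G2] := drop_map f (eighth T)%:P qU 'X; rewrite fq fX f8 in G1 G2.
have [L1 L2] := lift_map J (eighth T)%:P (drop_point qU 'X) (drop_param (eighth T)%:P qU 'X).
rewrite D1 D2 l1 l2 yE in L1 L2.
have [F1 F2] := lift_map f (eighth T)%:P (drop_point qU 'X) (drop_param (eighth T)%:P qU 'X).
rewrite G1 G2 f8 in F1 F2.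
move=> q' s'; rewrite {}/q' {}/s' -F1 -F2 -G1 -fX -fq; split.
- apply: rels5_map; apply: (rels5_reflect Ji); rewrite D1; exact: tup_rels.
- by congr (map5 f _); apply: (map5_inj Ji); rewrite L1 Jq.
- by congr (f _); apply: Ji; rewrite L2 /y1; field; rewrite ?x0n.
Qed.

Lemma eighth_map (A A' : comAlgType k) (f : {lrmorphism A -> A'}) : f (eighth A) = eighth A'.
Proof. exact: (rmorph_alg f). Qed.

Section Isomorphism.
Variables (B T : comAlgType k) (a c e b w : B) (a1 z1 l1 b1 be1 : T).
Hypotheses (M0 : model 0 a c e b w) (M1 : model 1 a1 z1 l1 b1 be1).

Let qB (A : comAlgType k) (x : spec_pts B A) := coords a c e b w x.
Let qT (A : comAlgType k) (x : spec_pts T A) := coords a1 z1 l1 b1 be1 x.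
Local Notation X := (kprod (Spec B) (A1 k)).
Local Notation Y := (kprod (Spec T) (A1 k)).

Let lift_rels (A : comAlgType k) (x : X A) : rels5 1 (lift_point (eighth A) (qB x.1) x.2).
Proof. by case: (lift_universal M0 x.1 x.2). Qed.
Let drop_rels (A : comAlgType k) (x : Y A) : rels5 0 (drop_point (qT x.1) x.2).
Proof. by case: (drop_universal M1 x.1 x.2). Qed.

Definition lift_mor (A : comAlgType k) (x : X A) : Y A :=
  (point M1 (lift_rels x), lift_param (eighth A) (qB x.1) x.2).
Definition drop_mor (A : comAlgType k) (x : Y A) : X A :=
  (point M0 (drop_rels x), drop_param (eighth A) (qT x.1) x.2).

Lemma lift_nat (A A' : comAlgType k) (f : {lrmorphism A -> A'}) (x : X A) :
  lift_mor (res f x) = res f (lift_mor x).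
Proof.
case: x => x s; congr (_, _); last first.
  symmetry; apply: etrans (lift_map f (eighth A) (qB x) s).2 _.
  exact: (congr1 (fun h => lift_param h (map5 f (qB x)) (f s)) (eighth_map f)).
apply: (coords_inj M1); rewrite pointK coords_comp pointK.
symmetry; apply: etrans (lift_map f (eighth A) (qB x) s).1 _.
exact: (congr1 (fun h => lift_point h (map5 f (qB x)) (f s)) (eighth_map f)).
Qed.

Lemma drop_nat (A A' : comAlgType k) (f : {lrmorphism A -> A'}) (x : Y A) :
  drop_mor (res f x) = res f (drop_mor x).
Proof.
case: x => x s; congr (_, _); last first.
  symmetry; apply: etrans (drop_map f (eighth A) (qT x) s).2 _.
  exact: (congr1 (fun h => drop_param h (map5 f (qT x)) (f s)) (eighth_map f)).
apply: (coords_inj M0); rewrite pointK coords_comp pointK.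
by symmetry; apply: etrans (drop_map f (eighth A) (qT x) s).1 _.
Qed.

Lemma stably_isomorphic : kisomorphic X Y.
Proof.
exists (KMorphism lift_nat), (KMorphism drop_nat); split=> A [x s] /=.
- have [h1 h2 h3] := lift_universal M0 x s; congr (_, _).
    by apply: (coords_inj M0); rewrite pointK /qT pointK.
  by rewrite /qT pointK.
- have [h1 h2 h3] := drop_universal M1 x s; congr (_, _).
    by apply: (coords_inj M1); rewrite pointK /qB pointK.
  by rewrite /qB pointK.
Qed.
End Isomorphism.
End Algebras.
End StableIsomorphism.

(** * Locally nilpotent derivations *)

Section LocallyNilpotent.

Variables (k : fieldType) (hk : [pchar k] =i pred0) (B : comAlgType k).
Variable D : {linear B -> B}.
Hypothesis Dd : derivation D.

Lemma der1 : D 1 = 0.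
Proof. by have /eqP := Dd 1 1; rewrite !mulr1 mul1r -subr_eq0 opprD addrA subrr sub0r oppr_eq0 => /eqP. Qed.

Lemma der_scalar c : D c%:A = 0.
Proof. by rewrite linearZ /= der1 scaler0. Qed.

Lemma derX r n : D (r ^+ n) = n%:R * r ^+ n.-1 * D r.
Proof.
elim: n => [|n IHn]; first by rewrite expr0 der1 !mul0r.
rewrite exprS Dd IHn /=; case: n {IHn} => [|n]; first by rewrite !expr0; ring.
by rewrite -[n.+2]addn1 natrD /= exprS; ring.
Qed.

Lemma iter_der0 n : iter n D 0 = 0.
Proof. by elim: n => [|n IHn] //=; rewrite IHn linear0. Qed.

Lemma iter_derD n r t : iter n D (r + t) = iter n D r + iter n D t.
Proof. by elim: n => [|n IHn] //=; rewrite IHn linearD. Qed.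

Lemma iter_der_le m n r : (m <= n)%N -> iter m D r = 0 -> iter n D r = 0.
Proof. by move=> le h; rewrite -(subnK le) iterD h iter_der0. Qed.

Lemma iter_der_const n r t : D r = 0 -> iter n D (r * t) = r * iter n D t.
Proof. by move=> h; elim: n => [|n IHn] //=; rewrite IHn Dd h mul0r add0r. Qed.

Lemma iter_derM_eq0 n r t p q : (p + q <= n.+1)%N -> iter p D r = 0 -> iter q D t = 0 ->
  iter n D (r * t) = 0.
Proof.
elim: n r t p q => [|n IHn] r t [|p] [|q] le hr ht;
  try (by rewrite (_ : r = 0) // mul0r iter_der0);
  try (by rewrite (_ : t = 0) // mulr0 iter_der0).
  by exfalso; lia.
move: hr ht; rewrite iterSr => hr; rewrite iterSr => ht.
rewrite iterSr Dd iter_derD.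
rewrite (IHn (D r) t p q.+1) ?(IHn r (D t) p.+1 q) ?addr0 ?iterSr //; lia.
Qed.

Lemma iter_der_top n m r t : iter n.+1 D r = 0 -> iter m.+1 D t = 0 ->
  iter (n + m) D (r * t) = 'C(n + m, n)%:R * iter n D r * iter m D t.
Proof.
move e : (n + m)%N => N; elim: N n m r t e => [|N IHN] n m r t e hr ht.
  have [-> ->] : n = 0%N /\ m = 0%N by lia.
  by rewrite bin0 mul1r.
case: n e hr => [|n] e hr.
  have -> : m = N.+1 by lia.
  by rewrite bin0 mul1r iter_der_const.
case: m e ht => [|m] e ht.
  have -> : N = n by lia.
  by rewrite binn mul1r mulrC iter_der_const // mulrC.
rewrite iterSr Dd iter_derD (IHN n m.+1) ?(IHN n.+1 m) -?iterSr //; try lia.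
by rewrite binS natrD !iterSr; ring.
Qed.

Lemma LND_dvd : (forall r t : B, (r * t == 0) = (r == 0) || (t == 0)) ->
  (forall b, exists n, iter n D b = 0) -> forall r t, D r = r * t -> D r = 0.
Proof.
move=> dom nil r t e; apply/eqP; apply: contraT => n0.
have [r0 t0] : r != 0 /\ t != 0.
  by move: n0; rewrite e dom negb_or => /andP.
have top u : u != 0 -> exists n, iter n D u != 0 /\ iter n.+1 D u = 0.
  move=> u0; have [n hn] := nil u; elim: n hn => [|n IHn] hn.
    by rewrite /= in hn; rewrite hn eqxx in u0.
  by have [/IHn//|h] := eqVneq (iter n D u) 0; exists n.
have [[|n] [hn hn1]] := top _ r0; first by rewrite /= in hn1; rewrite hn1 eqxx in n0.
have [m [hm hm1]] := top _ t0.
have := iter_der_top hn1 hm1; rewrite -e -iterSr.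
rewrite (@iter_der_le n.+2 _ r _ hn1); last by rewrite ltnS leq_addr.
move/esym/eqP; rewrite !dom (negPf hn) (negPf hm) !orbF.
have : ('C(n.+1 + m, n.+1) > 0)%N by rewrite bin_gt0 leq_addr.
case: ('C(_, _)) => // p _; by rewrite (negPf (mulr1_neq0l (alg_natK hk B p))).
Qed.

Lemma nil_mul r t : (exists n, iter n D r = 0) -> (exists n, iter n D t = 0) ->
  exists n, iter n D (r * t) = 0.
Proof.
by case=> p hp [q hq]; exists (p + q)%N; apply: (iter_derM_eq0 (p := p) (q := q)); rewrite ?leqnSn.
Qed.

Lemma nil_add r t : (exists n, iter n D r = 0) -> (exists n, iter n D t = 0) ->
  exists n, iter n D (r + t) = 0.
Proof.
case=> p hp [q hq]; exists (maxn p q).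
by rewrite iter_derD (iter_der_le _ hp) ?(iter_der_le _ hq) ?addr0 // leq_max leqnn ?orbT.
Qed.

End LocallyNilpotent.

Section Euler.

Variable k : fieldType.
Implicit Types P Q : {poly {poly k}}.

Definition thetaX P : {poly {poly k}} := 'X * P^`().
Definition thetaY P : {poly {poly k}} := swapXY (thetaX (swapXY P)).

Lemma thetaXD P Q : thetaX (P + Q) = thetaX P + thetaX Q.
Proof. by rewrite /thetaX derivD mulrDr. Qed.

Lemma thetaXM P Q : thetaX (P * Q) = thetaX P * Q + P * thetaX Q.
Proof. rewrite /thetaX derivM; ring. Qed.

Lemma thetaYD P Q : thetaY (P + Q) = thetaY P + thetaY Q.
Proof. by rewrite /thetaY rmorphD thetaXD rmorphD. Qed.

Let swM P Q : swapXY (P * Q) = swapXY P * swapXY Q.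
Proof. exact: rmorphM. Qed.

Lemma thetaYM P Q : thetaY (P * Q) = thetaY P * Q + P * thetaY Q.
Proof.
rewrite /thetaY [swapXY (P * Q)]swM thetaXM rmorphD.
by congr (_ + _); rewrite [LHS]swM swapXYK.
Qed.

Lemma coef_thetaX P i : (thetaX P)`_i = P`_i *+ i.
Proof.
by rewrite /thetaX mulrC coefMX coef_deriv; case: i => [|i] //=; rewrite mulr0n.
Qed.

Lemma coef_thetaY P i : (thetaY P)`_i = 'X * (P`_i)^`().
Proof.
apply/polyP => j; rewrite coef_swapXY coef_thetaX coefMn coef_swapXY mulrC coefMX coef_deriv.
by case: j => [|j] //=; rewrite mulr0n.
Qed.

Lemma thetaX_const (c : {poly k}) : thetaX c%:P = 0.
Proof. by rewrite /thetaX derivC mulr0. Qed.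

Lemma thetaY_const (c : k) : thetaY c%:P%:P = 0.
Proof. by rewrite /thetaY swapXY_polyC map_polyC thetaX_const rmorph0. Qed.

Lemma thetaX_X : thetaX 'X = 'X.
Proof. by rewrite /thetaX derivX mulr1. Qed.

Lemma thetaY_X : thetaY 'X = 0.
Proof. by rewrite /thetaY swapXY_X thetaX_const rmorph0. Qed.

Lemma thetaX_Y : thetaX 'X%:P = 0.
Proof. exact: thetaX_const. Qed.

Lemma thetaY_Y : thetaY 'X%:P = 'X%:P.
Proof. by rewrite /thetaY swapXY_Y thetaX_X swapXY_X. Qed.

Lemma thetaXn P n : thetaX (P ^+ n) = n%:R * P ^+ n.-1 * thetaX P.
Proof. by rewrite /thetaX deriv_exp -mulr_natl; ring. Qed.

Lemma thetaYn P n : thetaY (P ^+ n) = n%:R * P ^+ n.-1 * thetaY P.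
Proof.
have swX Q i : swapXY (Q ^+ i) = swapXY Q ^+ i by exact: rmorphXn.
rewrite /thetaY [swapXY (P ^+ n)]swX thetaXn [LHS]swM; congr (_ * _).
by rewrite swM swX swapXYK rmorph_nat.
Qed.

End Euler.

Section EulerResidue.
Variables (k : fieldType) (L : fieldType) (toL : {rmorphism {poly {poly k}} -> L}).
Hypothesis toL_inj : injective toL.
Local Notation s := (sL toL).
Local Notation y := (yL toL).

Lemma theta_nat (th : {poly {poly k}} -> {poly {poly k}}) (i j : nat) (U : {poly {poly k}}) cx cy :
  (forall P Q, th (P * Q) = th P * Q + P * th Q) ->
  (forall n, th ('X ^+ n) = (cx * n%:R) * 'X ^+ n) ->
  (forall n, th ('X%:P ^+ n) = (cy * n%:R) * 'X%:P ^+ n) ->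
  th ('X ^+ i * 'X%:P ^+ j * U) = 'X ^+ i * 'X%:P ^+ j * ((cx * i%:R + cy * j%:R) * U + th U).
Proof. by move=> hM hX hY; rewrite !hM hX hY; ring. Qed.

Lemma theta_residue (th : {poly {poly k}} -> {poly {poly k}}) (cx cy : bool) Q (n j : int) (c : k) :
  (forall P Q, th (P * Q) = th P * Q + P * th Q) ->
  (forall n, th ('X ^+ n) = (cx%:R * n%:R) * 'X ^+ n) ->
  (forall n, th ('X%:P ^+ n) = (cy%:R * n%:R) * 'X%:P ^+ n) ->
  (forall P, (th P)`_0 = cy%:R * ('X * (P`_0)^`())) ->
  residue toL (toL Q / chi toL (n, j)) c ->
  residue toL (toL (th Q) / chi toL (n, j)) ((cx%:R * n%:~R + cy%:R * j%:~R) * c).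
Proof.
move=> hM hX hY h0 [M [R [e sR cR]]].
have s0 := sL_neq0 toL_inj; have y0 := yL_neq0 toL_inj.
have [i1 [i2 ei]] : exists i1 i2 : nat, n = i1%:Z - i2%:Z.
  by case: n {e} => n; [exists n, 0%N | exists 0%N, n.+1]; rewrite ?subr0 // sub0r NegzE.
have [j1 [j2 ej]] : exists j1 j2 : nat, j = j1%:Z - j2%:Z.
  by case: j {e} => j; [exists j, 0%N | exists 0%N, j.+1]; rewrite ?subr0 // sub0r NegzE.
have chiE : chi toL (n, j) = s ^+ i1 * y ^+ j1 / (s ^+ i2 * y ^+ j2).
  rewrite /chi /= ei ej !expfzDr // -!exprnP -!exprnN; field.
  by rewrite !expf_neq0.
have cE q : toL q / chi toL (n, j) * y ^+ M =
    toL ('X ^+ i2 * 'X%:P ^+ (j2 + M) * q) / (s ^+ i1 * y ^+ j1).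
  rewrite chiE !rmorphM !rmorphXn /= -/s -/y exprD; field.
  by rewrite !expf_neq0.
have d0 : s ^+ i1 * y ^+ j1 != 0 by rewrite mulf_neq0 ?expf_neq0.
have eQ : 'X ^+ i2 * 'X%:P ^+ (j2 + M) * Q = 'X ^+ i1 * 'X%:P ^+ j1 * R.
  apply: toL_inj; move: e; rewrite cE => /(canRL (mulfVK d0)) ->.
  by rewrite !rmorphM !rmorphXn /= -/s -/y mulrC.
have := congr1 th eQ; rewrite !(theta_nat _ _ _ hM hX hY) => eT.
pose lam : {poly {poly k}} := (cx%:R * (i1%:R - i2%:R) + cy%:R * (j1%:R - (j2 + M)%:R)).
exists M, (lam * R + th R).
have e2 : 'X ^+ i2 * 'X%:P ^+ (j2 + M) * th Q = 'X ^+ i1 * 'X%:P ^+ j1 * (lam * R + th R).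
  apply: (lincomb (eqD eT (eqM (- (cx%:R * i2%:R + cy%:R * (j2 + M)%:R)) eQ))).
  rewrite /lam; ring.
have lamE : lam = (cx%:R * (i1%:R - i2%:R) + cy%:R * (j1%:R - (j2 + M)%:R))%:P%:P.
  by rewrite /lam !(rmorphD, rmorphN, rmorphM, rmorph_nat).
have c0 : (lam * R + th R)`_0 =
    (cx%:R * (i1%:R - i2%:R) + cy%:R * (j1%:R - (j2 + M)%:R))%:P * R`_0 + cy%:R * ('X * (R`_0)^`()).
  by rewrite coefD h0 lamE coefCM.
split.
- rewrite cE e2; apply: (canLR (mulfK d0)).
  by rewrite !rmorphM !rmorphXn /= -/s -/y mulrC.
- rewrite c0; apply: leq_trans (size_polyD _ _) _; rewrite geq_max; apply/andP; split.
    by rewrite mul_polyC; apply: leq_trans (size_scale_leq _ _) sR.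
  case: (cy); rewrite ?mul0r ?size_poly0 // mul1r mulrC.
  apply/leq_sizeP => l lM; rewrite coefMX coef_deriv.
  by case: l lM => [|l] //= lM; rewrite (leq_sizeP _ _ sR) ?mul0rn.
- rewrite c0 coefD coefCM cR.
  have -> : (cy%:R * ('X * (R`_0)^`()))`_M = cy%:R * (c *+ M).
    rewrite -polyC_natr coefCM ['X * _]mulrC coefMX coef_deriv.
    by case: (M) cR => [|M'] <- //=; rewrite mulr0n.
  rewrite ei ej !rmorphB /= !natrD -mulr_natr -!pmulrn; ring.
Qed.

Lemma thetaX_residue Q m (c : k) : residue toL (toL Q / chi toL m) c ->
  residue toL (toL (thetaX Q) / chi toL m) (m.1%:~R * c).
Proof.
case: m => n j h; have := @theta_residue (@thetaX k) true false Q n j c.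
rewrite /= mul1r mul0r addr0; apply=> //.
- exact: thetaXM.
- move=> i; rewrite thetaXn thetaX_X mul1r; case: i => [|i]; rewrite ?mul0r //.
  by rewrite -mulrA -exprSr.
- by move=> i; rewrite thetaXn thetaX_Y !mul0r mulr0.
- by move=> P; rewrite coef_thetaX mulr0n mul0r.
Qed.

Lemma thetaY_residue Q m (c : k) : residue toL (toL Q / chi toL m) c ->
  residue toL (toL (thetaY Q) / chi toL m) (m.2%:~R * c).
Proof.
case: m => n j h; have := @theta_residue (@thetaY k) false true Q n j c.
rewrite /= mul1r mul0r add0r; apply=> //.
- exact: thetaYM.
- by move=> i; rewrite thetaYn thetaY_X !mul0r mulr0.
- move=> i; rewrite thetaYn thetaY_Y mul1r; case: i => [|i]; rewrite ?mul0r //.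
  by rewrite -mulrA -exprSr.
- by move=> P; rewrite coef_thetaY mul1r.
Qed.
End EulerResidue.

Lemma pchar0_int (k : fieldType) (hk : [pchar k] =i pred0) (n : int) : (n%:~R == 0 :> k) = (n == 0).
Proof.
case: n => n; first by rewrite -pmulrn (proj1 (pcharf0P k) hk).
by rewrite NegzE mulrNz oppr_eq0 -pmulrn (proj1 (pcharf0P k) hk) oppr_eq0.
Qed.

Lemma pchar0_int_inj (k : fieldType) (hk : [pchar k] =i pred0) :
  injective (fun n : int => n%:~R : k).
Proof.
by move=> m n /eqP; rewrite -subr_eq0 -rmorphB pchar0_int // subr_eq0 => /eqP.
Qed.

Section Localization.

Variables (k : fieldType) (m : nat) (C : comAlgType k) (a z al b be : C).
Hypothesis M : model m a z al b be.

(* The powers of [a] clear the denominators of [C] inside [k[a, 1/a, b]]. *)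
Lemma localization_ind (P : C -> Prop) :
  P 1 -> (forall u v, P u -> P v -> P (u + v)) -> (forall c u, P u -> P (c *: u)) ->
  (forall u, P u -> P (a * u)) -> (forall u, P u -> P (b * u)) ->
  forall r, exists N, P (a ^+ N * r).
Proof.
move=> P1 PD PZ Pa Pb.
have PaX n u : P u -> P (a ^+ n * u).
  by elim: n => [|n IHn] h; rewrite ?expr0 ?mul1r // exprS -mulrA; apply/Pa/IHn.
elim/(model_ind M) => [|u v [N hu] [N' hv]|c u [N hu]|u [N hu]].
- by exists 0%N; rewrite mulr1.
- exists (N + N')%N; rewrite mulrDr; apply: PD.
    by rewrite addnC exprD -mulrA; apply: PaX.
  by rewrite exprD -mulrA; apply: PaX.
- by exists N; rewrite -scalerAr; apply: PZ.
have R := model_rels M.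
have eal v : a ^+ m.+1 * (al * v) = b * (b * v) + a * v.
  by apply: (lincomb (eqM (- v) (rel_bb R))); rewrite exprS; ring.
have Pal v : P v -> P (a ^+ m.+1 * (al * v)).
  by move=> h; rewrite eal; apply: PD (Pa _ h); apply/Pb/Pb.
have Pbe v : P v -> P (a ^+ m.+2 * (be * v)).
  move=> h; have -> : a ^+ m.+2 * (be * v) = b * (a ^+ m.+1 * (al * v)).
    by apply: (lincomb (eqM (- (a ^+ m.+1 * v)) (rel_alb R))); rewrite !exprS; ring.
  by apply/Pb/Pal.
have Pz v : P v -> P (a ^+ (m.+1 + m.+1).+1 * (z * v)).
  move=> h; have -> : a ^+ (m.+1 + m.+1).+1 * (z * v) = a ^+ m.+1 * (al * (a ^+ m.+1 * (al * v))).
    by apply: (lincomb (eqM (- (a ^+ m.+1 * a ^+ m.+1 * v)) (rel_alal R))); rewrite exprS exprD; ring.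
  by apply/Pal/Pal.
have com n x : P (a ^+ n * (x * (a ^+ N * u))) -> exists N', P (a ^+ N' * (x * u)).
  by move=> h; exists (n + N)%N; rewrite exprD; move: h; congr P; ring.
split; [apply: (com 0%N) | apply: (com _ _ (Pz _ hu)) | apply: (com _ _ (Pal _ hu)) |
  apply: (com 0%N) | apply: (com _ _ (Pbe _ hu))].
- by rewrite mul1r; apply: Pa.
- by rewrite mul1r; apply: Pb.
Qed.

End Localization.

Section LNDTheorem.

#[local] Opaque thetaX thetaY.

Variables (k : fieldType) (C : comAlgType k) (a z al b be : C).
Hypothesis hk : [pchar k] =i pred0.
Hypothesis M : model 1 a z al b be.

Variables (L : fieldType) (toL : {rmorphism {poly {poly k}} -> L}).
Variables (io : {rmorphism C -> L}).
Hypothesis E : embedding 1 toL io a z al b be.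
Let toLi := emb_inj E.

Local Notation s := (sL toL).
Local Notation y := (yL toL).
Local Notation residue := (residue toL).
Local Notation chi := (chi toL).
Let s0 : s != 0 := sL_neq0 (emb_inj E).
Let y0 : y != 0 := yL_neq0 (emb_inj E).

(* The weight [2 n + 3 j] takes the values 0, 2, 5, 3 on the basis
   [1, al, b, be], 4 on [a] and 0 on [z]. *)
Lemma lm_weight r (mm : int * int) c : c != 0 -> residue (io r / chi mm) c ->
  exists w : nat, 2%:Z * mm.1 + 3%:Z * mm.2 = w%:Z /\ w <> 1%N.
Proof.
move=> c0 hr; have [P rE] := model_nf M r.
have [th n0] : exists th, P th != 0.
  apply/existsP; apply: contraNT c0 => /existsPn h0; apply/eqP.
  have r0 : r = 0.
    by rewrite rE; apply: nfval0 => i; apply/eqP; have := h0 i; rewrite negbK.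
  by apply: (res_fun toLi hr); rewrite r0 rmorph0 mul0r; apply: res0.
have [th0 [i [j [n1 hr1 _]]]] := nf_lead E (ex_intro _ th n0).
rewrite -rE in hr1; set m1 := lmb 1 th0 i j in hr1.
have mE : mm = m1.
  apply/eqP; apply: contraT => /below_total /orP[] bl.
    have h := res_below toLi hr bl; have := res_fun toLi hr1 h. by move/eqP; rewrite (negPf n1).
  by have /eqP := res_fun toLi hr (res_below toLi hr1 bl); rewrite (negPf c0).
rewrite mE /m1 /lmb /lmg.
have := ord4_cases th0; rewrite !inE => /or4P[]/eqP -> /=.
- by exists (4 * i)%N; split; lia.
- by exists (4 * i + 2)%N; split; lia.
- by exists (4 * i + 5)%N; split; lia.
- by exists (4 * i + 3)%N; split; lia.
Qed.

Lemma lm_exists r : r != 0 -> exists mm c, [/\ c != 0, residue (io r / chi mm) c &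
  2%:Z <= mm.1 -> exists r', r = a * r'].
Proof.
move=> r0; have [P rE] := model_nf M r.
have [th n0] : exists th, P th != 0.
  apply/existsP; apply: contraNT r0 => /existsPn h0.
  by rewrite rE; apply/eqP/nfval0 => i; apply/eqP; have := h0 i; rewrite negbK.
have [th0 [i [j [n1 hr1 hb]]]] := nf_lead E (ex_intro _ th n0).
exists (lmb 1 th0 i j), (P th0)`_j`_i; split; rewrite ?rE // => le2.
have dv th' : exists Q, P th' = 'X%:P * Q.
  exists (map_poly (fun p : {poly k} => p %/ 'X) (P th')); apply/polyP => l.
  rewrite coefCM coef_map_id0 ?div0p // mulrC divpK //.
  rewrite -['X]subr0 -(polyC0 k) dvdp_XsubCl /root horner_coef0.
  apply/negPn/negP => /hb h; have := Order.POrderTheory.le_trans le2 h.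
  by have := ord4_cases th'; rewrite /lmb /lmg !inE => /or4P[]/eqP -> /=; lia.
have [Q0 e0] := dv 0; have [Q1 e1] := dv 1; have [Q2 e2] := dv 2%:R; have [Q3 e3] := dv 3%:R.
exists (nfval (GRing.in_alg C) a z al b be (fun t => nth 0 [:: Q0; Q1; Q2; Q3] t)).
rewrite /nfval e0 e1 e2 e3 /= !rmorphM /= !ev2C !ev1X; ring.
Qed.

Variable D : {linear C -> C}.
Hypothesis Dd : derivation D.

Let xi := io (D a) / (2%:R * s ^+ 2).
Let eta := io (D b) / (s * y) - xi.

Let n2 : (2%:R : L) != 0.
Proof. by rewrite -(rmorph_nat (kL toL)) fmorph_eq0 (nat_neq0 hk 1). Qed.

Lemma der_formula r : exists N Q, [/\ s ^+ (2 * N) * io r = toL Q &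
  io (D (a ^+ N * r)) = xi * toL (thetaX Q) + eta * toL (thetaY Q)].
Proof.
have [|||||N [Q [h1 h2]]] := localization_ind M (P := fun u => exists Q,
  io u = toL Q /\ io (D u) = xi * toL (thetaX Q) + eta * toL (thetaY Q)) _ _ _ _ _ r.
- exists 1; rewrite !rmorph1 (der1 Dd) rmorph0; split=> //.
  by rewrite -(polyC1 {poly k}) -(polyC1 k) thetaX_const thetaY_const !rmorph0 !mulr0 addr0.
- move=> u v [Q [e1 e2]] [Q' [e1' e2']]; exists (Q + Q'); split; first by rewrite !rmorphD e1 e1'.
  by rewrite linearD rmorphD e2 e2' thetaXD thetaYD !rmorphD; ring.
- move=> c u [Q [e1 e2]]; exists (c%:P%:P * Q).
  have ioc w : io (c *: w) = toL c%:P%:P * io w by rewrite -mulr_algl rmorphM (emb_scalar E).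
  rewrite linearZ !ioc e1 e2; split; first by rewrite rmorphM.
  rewrite thetaXM thetaYM thetaX_const thetaY_const !mul0r !add0r !rmorphM; ring.
- move=> u [Q [e1 e2]]; exists ('X ^+ 2 * Q); split; first by rewrite !rmorphM e1 (emb_a E) expr2.
  rewrite thetaXM thetaYM thetaXn thetaYn thetaX_X thetaY_X Dd.
  move: (thetaX Q) (thetaY Q) e2 => QX QY e2.
  rewrite !(rmorphD, rmorphM, rmorphXn, rmorph_nat, rmorph0) /= -/s e1 e2 (emb_a E) /xi.
  by field; rewrite s0 n2.
- move=> u [Q [e1 e2]]; exists ('X * 'X%:P * Q); split; first by rewrite !rmorphM e1 (emb_b E).
  rewrite 2!thetaXM 2!thetaYM thetaX_X thetaY_X thetaX_Y thetaY_Y Dd.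
  move: (thetaX Q) (thetaY Q) e2 => QX QY e2.
  rewrite !(rmorphD, rmorphM, rmorph0) /= -/s -/y e1 e2 (emb_b E) /eta.
  by field; rewrite s0 y0.
exists N, Q; split=> //.
by rewrite -h1 rmorphM rmorphXn (emb_a E) -exprM.
Qed.

Section Shift.
Variables (e : int * int) (x0 e0 : k).
Hypotheses (hxi : residue (xi / chi e) x0) (heta : residue (eta / chi e) e0).

Definition rho (mm : int * int) : k := mm.1%:~R * x0 + mm.2%:~R * e0.

Lemma rhoD u v : rho (u + v) = rho u + rho v.
Proof. by rewrite /rho /= !intrD; ring. Qed.

Lemma rhoMn u n : rho (u *+ n) = rho u *+ n.
Proof.
elim: n => [|n IHn]; first by rewrite !mulr0n /rho /= !mul0r addr0.
by rewrite !mulrS rhoD IHn.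
Qed.

Lemma der_residue r mm c : residue (io r / chi mm) c ->
  residue (io (D r) / chi (mm + e)) (rho mm * c).
Proof.
move=> hr; have [N [Q [h1 h2]]] := der_formula r.
have chiN : chi ((2 * N)%:Z, 0) = s ^+ (2 * N) by rewrite chiE expr0z mulr1.
have S0 : s ^+ (2 * N) != 0 by rewrite expf_neq0.
have cn0 u : chi u != 0 := chi_neq0 toLi u.
have hQ : residue (toL Q / chi (mm + ((2 * N)%:Z, 0))) c.
  have -> : toL Q / chi (mm + ((2 * N)%:Z, 0)) = io r / chi mm; last by [].
  by rewrite -h1 (chiD toLi) chiN; field; rewrite S0 cn0.
have hx := resM hxi (thetaX_residue toLi hQ).
have hy := resM heta (thetaY_residue toLi hQ).
have hz := resM (resM (resC toL (- (2 * N)%:R)) hxi) hr.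
have := resD (resD hx hy) hz.
have -> : x0 * (((mm + ((2 * N)%:Z, 0)).1)%:~R * c) + e0 * (((mm + ((2 * N)%:Z, 0)).2)%:~R * c) +
    - (2 * N)%:R * x0 * c = rho mm * c.
  by rewrite /rho /= addr0 intrD -pmulrn; ring.
suff -> : xi / chi e * (toL (thetaX Q) / chi (mm + ((2 * N)%:Z, 0))) +
    eta / chi e * (toL (thetaY Q) / chi (mm + ((2 * N)%:Z, 0))) +
    kL toL (- (2 * N)%:R) * (xi / chi e) * (io r / chi mm) = io (D r) / chi (mm + e) by [].
have kE : kL toL (- (2 * N)%:R) = - (2 * N)%:R by rewrite rmorphN rmorph_nat.
have ioE : io (D r) = (xi * toL (thetaX Q) + eta * toL (thetaY Q)) / s ^+ (2 * N)
    - (2 * N)%:R * xi * io r.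
  apply: (canRL (addrK _)); apply: (canRL (mulfK S0)); rewrite -h2 Dd (derX Dd).
  rewrite (rmorphD io) !(rmorphM io) (rmorph_nat io) !(rmorphXn io) (emb_a E).
  have -> : io (D a) = 2%:R * s ^+ 2 * xi by rewrite /xi; field; rewrite s0 n2.
  case: (N) => [|N']; first by rewrite muln0 expr0; ring.
  by rewrite natrM !exprM /= exprS; ring.
rewrite ioE kE !(chiD toLi) chiN; field.
by rewrite S0 !cn0.
Qed.

Lemma iter_der_residue n r mm c : residue (io r / chi mm) c ->
  residue (io (iter n D r) / chi (mm + e *+ n)) ((\prod_(i < n) rho (mm + e *+ i)) * c).
Proof.
move=> hr; elim: n => [|n IHn]; first by rewrite big_ord0 mul1r addr0.
by rewrite /= mulrS [e + _]addrC addrA big_ord_recr /= [_ * rho _]mulrC -mulrA; apply: der_residue.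
Qed.
End Shift.
End LNDTheorem.

Section Rigidity.

Variables (k : fieldType) (C : comAlgType k) (a z al b be : C).
Hypothesis hk : [pchar k] =i pred0.
Hypothesis M : model 1 a z al b be.
Variable D : {linear C -> C}.
Hypothesis hD : LND D.

(* If [D a <> 0], the leading forms of [D] define a locally nilpotent derivation
   of the graded monoid algebra of leading monomials, which is a Demazure root
   [e] together with a linear form [rho] such that [rho e = -1] after scaling.
   Membership of all leading monomials in the cone [2 n + 3 j >= 0] forces [rho]
   to be proportional to [2 n + 3 j], and then to take the missing value 1. *)
Theorem LND_kills_a : D a = 0.
Proof.
case: hD => Dd nil; apply/eqP; apply: contraT => Da0.
have [L [toL [io E]]] := model_emb M.
have toLi := emb_inj E.
have s0 : sL toL != 0 := sL_neq0 toLi; have y0 : yL toL != 0 := yL_neq0 toLi.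
have cn0 u : chi toL u != 0 := chi_neq0 toLi u.
have n2 : (2%:R : L) != 0.
  by rewrite -(rmorph_nat (kL toL)) fmorph_eq0 (nat_neq0 hk 1).
have k2 : (2%:R : k) != 0 := nat_neq0 hk 1.
have [ma [ca [ca0 ra div_a]]] := lm_exists M E Da0.
have ma2 : ma.1 < 2%:Z.
  rewrite Order.TotalTheory.ltNge; apply/negP => /div_a [r e].
  by move/eqP: Da0; apply; apply: (LND_dvd hk Dd (model_integral M) nil e).
pose xi := io (D a) / (2%:R * sL toL ^+ 2); pose eta := io (D b) / (sL toL * yL toL) - xi.
pose ea := ma - (2%:Z, 0).
have chiA : chi toL (2%:Z, 0) = sL toL ^+ 2 by rewrite chiE expr0z mulr1.
have chiB11 : chi toL (1, 1) = sL toL * yL toL by rewrite chiE.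
have rxi : residue toL (xi / chi toL ea) (2%:R^-1 * ca).
  have -> : xi / chi toL ea = kL toL 2%:R^-1 * (io (D a) / chi toL ma).
    rewrite /ea (chiB toLi) chiA /xi fmorphV rmorph_nat; field.
    by rewrite s0 n2 cn0.
  exact: resM (resC _ _) ra.
have xi0 : 2%:R^-1 * ca != 0 by rewrite mulf_neq0 ?invr_eq0.
have [e [x0 [e0 [he hxi heta hne]]]] : exists e x0 e0,
    [/\ e.1 <= ea.1, residue toL (xi / chi toL e) x0, residue toL (eta / chi toL e) e0 &
      (x0 != 0) || (x0 + e0 != 0)].
  have [Db0|Db0] := eqVneq (D b) 0.
    exists ea, (2%:R^-1 * ca), (- (2%:R^-1 * ca)); split=> //; last by rewrite xi0.
    rewrite /eta Db0 rmorph0 mul0r sub0r mulNr -mulN1r -[X in residue _ _ X]mulN1r.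
    by have := resM (resC toL (-1)) rxi; rewrite rmorphN1.
  have [mb [cb [cb0 rb _]]] := lm_exists M E Db0.
  pose eb := mb - (1, 1).
  have rb' : residue toL ((io (D b) / (sL toL * yL toL)) / chi toL eb) cb.
    have -> : io (D b) / (sL toL * yL toL) / chi toL eb = io (D b) / chi toL mb; last by [].
    by rewrite /eb (chiB toLi) chiB11; field; rewrite s0 y0 cn0.
  have sub f g c d u : residue toL (f / chi toL u) c -> residue toL (g / chi toL u) d ->
      residue toL ((f - g) / chi toL u) (c - d).
    move=> hf hg; rewrite mulrBl -mulN1r -[X in residue _ _ (_ - X)]mul1r.
    have := resD hf (resM (resC toL (-1)) hg); rewrite rmorphN1.
    by rewrite !mulN1r mul1r.
  have [eE|ne] := eqVneq ea eb.
    exists ea, (2%:R^-1 * ca), (cb - 2%:R^-1 * ca); split=> //; last by rewrite xi0.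
    by apply: sub rxi; rewrite eE.
  case/orP: (below_total ne) => bl.
    exists eb, 0, (cb - 0); split; rewrite ?eqxx ?subr0 ?add0r ?cb0 ?orbT //.
    - by case/orP: bl => [/Order.POrderTheory.ltW|/andP[/eqP <- _]].
    - by have := res_below toLi rxi bl.
    - by rewrite -[cb]subr0; apply: sub rb' _; have := res_below toLi rxi bl.
  exists ea, (2%:R^-1 * ca), (0 - 2%:R^-1 * ca); split=> //; last by rewrite xi0.
  by apply: sub rxi; have := res_below toLi rb' bl.
have el0 : e.1 < 0 by move: (e.1) he; rewrite /ea /= => n; lia.
pose rh := rho x0 e0.
have rhz : rh 0 = 0 by rewrite /rh /rho /= !mul0r addr0.
have vanish r mm c : c != 0 -> residue toL (io r / chi toL mm) c ->
    exists i : nat, rh mm + rh e *+ i = 0.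
  move=> c0 hr; have [n hn] := nil r.
  have := iter_der_residue hk M E Dd hxi heta n hr.
  rewrite hn rmorph0 mul0r => /(res_fun toLi (res0 toL)) /esym/eqP.
  rewrite mulf_eq0 (negPf c0) orbF => /prodf_eq0[i _ /eqP]; rewrite rhoD rhoMn => h.
  by exists i.
have res_gen r mm : io r = chi toL mm -> residue toL (io r / chi toL mm) 1.
  by move=> ->; rewrite mulfV //; have := resC toL 1; rewrite rmorph1.
have rbasis th i j := res_basis E th i j.
have rA : residue toL (io a / chi toL (2%:Z, 0)) 1 by apply: res_gen; rewrite (emb_a E) chiA.
have rB : residue toL (io b / chi toL (1, 1)) 1 by apply: res_gen; rewrite (emb_b E) chiB11.
have rZ : residue toL (io z / chi toL (- 6%:Z, 4%:Z)) 1.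
  by have := rbasis 0 0%N 1%N; rewrite /bg /= expr0 expr1 mul1r mulr1 /lmb /lmg /=.
have rAl : residue toL (io al / chi toL (- 2%:Z, 2%:Z)) 1.
  by have := rbasis 1 0%N 0%N; rewrite /bg /= !expr0 !mul1r /lmb /lmg /=.
have n10 : (1 : k) != 0 := oner_neq0 _.
have [Na hNa] := vanish _ _ _ n10 rA; have [Nb hNb] := vanish _ _ _ n10 rB.
have [Nz hNz] := vanish _ _ _ n10 rZ; have [Nl hNl] := vanish _ _ _ n10 rAl.
have re0 : rh e != 0.
  apply/eqP => re.
  have x00 : x0 = 0.
    apply: (mulfI k2); rewrite mulr0; move: hNa.
    by rewrite re mul0rn addr0 /rh /rho /= mul0r addr0.
  have e00 : x0 + e0 = 0.
    by move: hNb; rewrite re mul0rn addr0 /rh /rho /= !mul1r.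
  by move: hne; rewrite e00 x00 eqxx.
pose t := rh e.
have unN N : rh e *+ N = N%:R * t by rewrite mulr_natl.
have eNa : 2%:R * x0 = - (Na%:R * t) by apply: (lincomb hNa); rewrite unN /rh /rho /=; ring.
have eNb : x0 + e0 = - (Nb%:R * t) by apply: (lincomb hNb); rewrite unN /rh /rho /=; ring.
have eNz : - 6%:R * x0 + 4%:R * e0 = - (Nz%:R * t).
  by apply: (lincomb hNz); rewrite unN /rh /rho /=; ring.
have eNl : - 2%:R * x0 + 2%:R * e0 = - (Nl%:R * t).
  by apply: (lincomb hNl); rewrite unN /rh /rho /=; ring.
have tE : t = e.1%:~R * x0 + e.2%:~R * e0 by [].
have toZ (n1 n1' : int) : (n1%:~R : k) * t = n1'%:~R * t -> n1 = n1'.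
  by move=> /(mulIf re0) /(pchar0_int_inj hk).
have Z1 : 4%:Z * Nb = 5%:Z * Na + Nz.
  apply: toZ; rewrite !(rmorphD, rmorphM) /= -!pmulrn.
  by apply: (lincomb (eqD (eqM 4%:R eNb) (eqD (eqM (- 5%:R) eNa) (eqM (- 1) eNz)))); ring.
have Z2 : 2%:Z * Nb = 2%:Z * Na + Nl.
  apply: toZ; rewrite !(rmorphD, rmorphM) /= -!pmulrn.
  by apply: (lincomb (eqD (eqM 2%:R eNb) (eqD (eqM (- 2%:R) eNa) (eqM (- 1) eNl)))); ring.
have Z3 : e.1 * Na + 2%:Z * e.2 * Nb - e.2 * Na = - 2%:Z.
  apply: toZ; rewrite !(rmorphD, rmorphM, rmorphN) /= -!pmulrn.
  apply: (lincomb (eqD (eqM (2%:R * e.2%:~R) eNb) (eqD (eqM (e.1%:~R - e.2%:~R) eNa)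
     (eqM 2%:R tE)))); ring.
have dz (N : nat) (r : C) mm : residue toL (io r / chi toL mm) 1 -> rh mm + t *+ N = 0 -> N != 0%N ->
    exists w : nat, 2%:Z * (mm + e).1 + 3%:Z * (mm + e).2 = w%:Z /\ w <> 1%N.
  move=> hr hN N0; have := der_residue hk M E Dd hxi heta hr; rewrite mulr1.
  apply: (lm_weight M E); rewrite (_ : rho _ _ _ = - (t *+ N)); last by apply/eqP; rewrite -addr_eq0; apply/eqP.
  rewrite oppr_eq0 -mulr_natl mulf_neq0 //.
  by case: N N0 {hN} => // N _; apply: nat_neq0.
have ZE : (2%:Z * e.1 + 3%:Z * e.2) * Na + e.2 * Nz = - 4%:Z.
  have -> : (Nz : int) = 4%:Z * Nb - 5%:Z * Na by rewrite Z1; ring.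
  by apply: (lincomb (eqM 2%:Z Z3)); ring.
have [Nz0|Nz0] := eqVneq Nz 0%N; last first.
  have [w [hw _]] := dz _ _ _ rZ hNz Nz0; move: hw => /= hw.
  have hw' : 2%:Z * e.1 + 3%:Z * e.2 = w%:Z by rewrite -hw; ring.
  rewrite hw' in ZE; move: (e.1) (e.2) el0 hw' ZE => e1 e2 el0 hw' ZE.
  have e2p : 0 < e2 by clear -el0 hw'; lia.
  by clear -ZE e2p; nia.
rewrite Nz0 in ZE Z1.
have Nl0 : Nl != 0%N.
  apply/eqP => Nl0; rewrite Nl0 in Z2.
  have Na0 : Na = 0%N by clear -Z1 Z2; lia.
  by move: ZE; rewrite Na0 !mulr0.
have [w [hw w1]] := dz _ _ _ rAl hNl Nl0; move: hw => /= hw.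
have hw' : 2%:Z * e.1 + 3%:Z * e.2 = w%:Z - 2%:Z by rewrite -hw; ring.
rewrite hw' in ZE; clear -ZE Z1 w1.
have [q Nq] : exists q : nat, Na = (4 * q)%N by exists (Nb - Na)%N; lia.
rewrite Nq in ZE; have : ((w%:Z - 2%:Z) * q = - 1)%R by move: ZE; rewrite PoszM; lia.
by nia.
Qed.

End Rigidity.

Section Flow.

Variables (k : fieldType) (m : nat) (C : comAlgType k) (a z al b be : C).
Hypothesis hk : [pchar k] =i pred0.
Hypothesis M : model m a z al b be.

Lemma flow_LND : exists D : {linear C -> C}, [/\ LND D, D a = 0, D b = a ^+ m.+1 & D z = 4%:R * be].
Proof.
pose q : tuple5 (poly_alg C) := ga5 m ('X : {poly C}) (map5 polyC (a, z, al, b, be)).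
have qr : rels5 m q by apply: ga5_rels; apply: (rels_morph polyC) (model_rels M).
have [h [ha hz hl hb he]] := model_lrmorph M qr.
have cE (c : k) : (c%:A : poly_alg C) = (c%:A)%:P :> {poly C} by apply: mulr1.
have h0 r : (h r : {poly C})`_0 = r.
  rewrite -horner_coef0.
  have := @model_ext k m C a z al b be M C (horner_eval (0 : C) \o (h : {rmorphism C -> {poly C}}))
    (idfun : {rmorphism C -> C}); apply.
  - by move=> c; rewrite /= (rmorph_alg h) /horner_eval cE hornerC.
  - by rewrite /= ha /horner_eval !hornerE.
  - by rewrite /= hz /horner_eval !hornerE /=; ring.
  - by rewrite /= hl /horner_eval !hornerE /=; ring.
  - by rewrite /= hb /horner_eval !hornerE /=; ring.
  - by rewrite /= he /horner_eval !hornerE /=; ring.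
pose D0 (r : C) : C := (h r : {poly C})`_1.
have D0l : linear D0.
  move=> c u v; rewrite /D0 linearD linearZ /=.
  by rewrite coefD -[c *: h u]/((c%:A)%:P * (h u : {poly C})) coefCM mulr_algl.
pose D : {linear C -> C} := HB.pack D0 (GRing.isLinear.Build k C C *:%R D0 D0l).
have Dd : derivation D.
  move=> u v; rewrite /= /D0 rmorphM /= coefM !big_ord_recl big_ord0 /= addr0 !h0.
  by rewrite addrC.
have d1 (p : {poly C}) : p`_1 = p^`().[0] by rewrite horner_coef0 coef_deriv mulr1n.
have Da : D a = 0 by rewrite /= /D0 ha d1 !derivE hornerC.
have Db : D b = a ^+ m.+1.
  by rewrite /= /D0 hb d1 !(derivE, hornerE) /=; rewrite !exprS; ring.
have Dl : D al = 2%:R * b.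
  by rewrite /= /D0 hl d1 !(derivE, hornerE) /=; ring.
have De : D be = 3%:R * a ^+ m * al - 2%:R.
  by rewrite /= /D0 he d1 !(derivE, hornerE) /=; ring.
have Dz : D z = 4%:R * be.
  by rewrite /= /D0 hz d1 !(derivE, hornerE) /=; ring.
exists D; split=> //; split=> //.
have nilS r : (exists n, iter n D (D r) = 0) -> exists n, iter n D r = 0.
  by case=> n hn; exists n.+1; rewrite iterSr.
have nilc c : exists n, iter n D (c%:A) = 0 by exists 1%N; apply: (der_scalar Dd).
have nila : exists n, iter n D a = 0 by exists 1%N.
have nilX r n : (exists n, iter n D r = 0) -> exists n', iter n' D (r ^+ n) = 0.
  move=> hr; elim: n => [|n IHn]; first by rewrite expr0 -(scale1r 1); apply: nilc.
  by rewrite exprS; apply: nil_mul.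
have niln n : exists n', iter n' D n%:R = 0.
  by rewrite -[n%:R](rmorph_nat (GRing.in_alg C)); apply: nilc.
have nilb : exists n, iter n D b = 0 by apply: nilS; rewrite Db; apply: nilX.
have nill : exists n, iter n D al = 0 by apply: nilS; rewrite Dl; apply: nil_mul.
have nile : exists n, iter n D be = 0.
  apply: nilS; rewrite De; apply: nil_add.
    by apply: nil_mul => //; apply: nil_mul => //; apply: nilX.
  by rewrite -mulN1r; apply: nil_mul => //; rewrite -scaleN1r; apply: nilc.
have nilz : exists n, iter n D z = 0 by apply: nilS; rewrite Dz; apply: nil_mul.
elim/(model_ind M) => [|u v|c u|u hu]; first by rewrite -(scale1r 1); apply: nilc.
- exact: nil_add.
- by rewrite -mulr_algl; apply: nil_mul.
- by split; apply: nil_mul.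
Qed.

Local Notation evab := (ev2 (GRing.in_alg C) a b).
Local Notation eva := (ev1 (GRing.in_alg C) a).

Lemma eva_inj p : eva p = 0 -> p = 0.
Proof.
move=> e; have := model_nf_inj M (P := fun i => if i == 0 then p%:P else 0).
rewrite /nfval /= ev2C e !rmorph0 !mulr0 !addr0 => /(_ erefl 0) /=.
by move=> /eqP; rewrite polyC_eq0 => /eqP.
Qed.

Lemma a_neq0 : a != 0.
Proof.
apply/eqP => a0; have /eva_inj /eqP : eva 'X = 0 by rewrite ev1X.
by rewrite polyX_eq0.
Qed.

Lemma der_eva (D : {linear C -> C}) p : derivation D -> D (eva p) = eva p^`() * D a.
Proof.
move=> Dd; elim/poly_ind: p => [|p c IH]; first by rewrite deriv0 !rmorph0 linear0 mul0r.
rewrite derivD derivC addr0 derivM derivX mulr1 !rmorphD !rmorphM /= ev1X ev1C linearD Dd IH.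
by rewrite /= (der_scalar Dd); ring.
Qed.

Lemma der_evab (D : {linear C -> C}) P : derivation D -> D a = 0 ->
  D (evab P) = evab P^`() * D b.
Proof.
move=> Dd Da; elim/poly_ind: P => [|p c IH]; first by rewrite deriv0 !rmorph0 linear0 mul0r.
rewrite derivD derivC addr0 derivM derivX mulr1 !rmorphD !rmorphM /= ev2X ev2C linearD Dd IH.
by rewrite (der_eva _ Dd) Da; ring.
Qed.

Lemma pchar0_deriv_eq0 (A : comAlgType k) (P : {poly A}) : P^`() = 0 -> P = (P`_0)%:P.
Proof.
move=> e; apply/polyP => -[|i]; rewrite coefC //=.
have := congr1 (fun p : {poly A} => p`_i) e; rewrite /= coef_deriv coef0 -mulr_natl => h.
by rewrite -[LHS]mul1r -(alg_natK hk A i) mulrAC h mul0r.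
Qed.

Lemma ab_indep P : evab P = 0 -> P = 0.
Proof.
have [D [[Dd _] Da Db _]] := flow_LND.
move: {2}(size P) (leqnn (size P)) => n; elim: n P => [|n IHn] P sP e.
  by apply/eqP; rewrite -size_poly_eq0 -leqn0.
have P'0 : P^`() = 0.
  have [->|P0] := eqVneq P 0; first by rewrite deriv0.
  apply: IHn; first by rewrite -ltnS; apply: leq_trans sP; apply: lt_size_deriv.
  have := der_evab P Dd Da; rewrite e linear0 Db => /esym/eqP.
  rewrite (model_integral M) (negPf (model_expf_neq0 M _ a_neq0)) orbF.
  by move/eqP.
have PE := pchar0_deriv_eq0 P'0; move: e.
by rewrite PE ev2C => /eva_inj ->.
Qed.

Lemma localize r : exists N P, a ^+ N * r = evab P.
Proof.
apply: (localization_ind M (P := fun u => exists P, u = evab P)).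
- by exists 1; rewrite rmorph1.
- by move=> u v [P ->] [Q ->]; exists (P + Q); rewrite rmorphD.
- by move=> c u [P ->]; exists (c%:P%:P * P); rewrite rmorphM /= ev2C ev1C /= mulr_algl.
- by move=> u [P ->]; exists ('X%:P * P); rewrite rmorphM /= ev2C ev1X.
- by move=> u [P ->]; exists ('X * P); rewrite rmorphM /= ev2X.
Qed.

Lemma der_ker (D : {linear C -> C}) r : derivation D -> D a = 0 -> D b != 0 -> D r = 0 ->
  exists N p, a ^+ N * r = eva p.
Proof.
move=> Dd Da Db Dr; have [N [P e]] := localize r.
have DaN : D (a ^+ N) = 0 by rewrite (derX Dd) Da mulr0.
have : D (a ^+ N * r) = 0 by rewrite Dd DaN Dr mul0r mulr0 addr0.
rewrite e (der_evab _ Dd Da) => /eqP; rewrite (model_integral M) (negPf Db) orbF => /eqP.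
move=> /ab_indep /pchar0_deriv_eq0 PE.
by exists N, P`_0; rewrite e PE ev2C coefC.
Qed.

End Flow.

Section Rigid.

Variables (k : fieldType) (C : comAlgType k) (a z al b be : C).
Hypothesis hk : [pchar k] =i pred0.
Hypothesis M : model 1 a z al b be.

Lemma der_ab_eq0 (D : {linear C -> C}) : derivation D -> D a = 0 -> D b = 0 -> forall r, D r = 0.
Proof.
move=> Dd Da Db r; have [N [P e]] := localize M r.
have DaN : D (a ^+ N) = 0 by rewrite (derX Dd) Da mulr0.
have : D (a ^+ N * r) = 0 by rewrite e (der_evab b P Dd Da) Db mulr0.
rewrite Dd DaN mul0r add0r => /eqP.
by rewrite (model_integral M) (negPf (model_expf_neq0 M _ (a_neq0 M))) => /eqP.
Qed.

End Rigid.

Section NotIsomorphic.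

Variables (k : fieldType) (B T : comAlgType k) (a c e b w : B) (a1 z1 l1 b1 be1 : T).
Hypothesis hk : [pchar k] =i pred0.
Hypotheses (M0 : model 0 a c e b w) (M1 : model 1 a1 z1 l1 b1 be1).

Lemma rels0_sym (A : comNzRingType) (a' c' e' b' w' : A) :
  rels 0 a' c' e' b' w' -> rels 0 c' a' e' w' b'.
Proof.
case=> r1 r2 r3 r4 r5 r6; split=> //.
- by rewrite r1 mulrC.
- by rewrite r3 mulrC.
- by rewrite r2 mulrC.
- by rewrite mulrC.
Qed.

Lemma killed_scalar r : (forall D : {linear B -> B}, LND D -> D r = 0) -> exists s : k, r = s%:A.
Proof.
move=> kill; have [D [hD Da Db Dc]] := flow_LND M0.
have [sg [sa sc se sb sw]] := model_lrmorph M0 (rels0_sym (model_rels M0)).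
have sgK : cancel sg sg.
  have := @model_ext k 0 B a c e b w M0 B (sg \o sg : {rmorphism B -> B}) (idfun : {rmorphism B -> B}).
  by apply; rewrite /= ?sa ?sc ?se ?sb ?sw // => s; rewrite /= !rmorph_alg.
pose D'0 := sg \o D \o sg.
pose D' : {linear B -> B} := sg \o D \o sg.
have D'E u : D' u = sg (D (sg u)) by [].
have [Dd nil] := hD.
have hD' : LND D'.
  split=> [u v|u]; first by rewrite !D'E rmorphM Dd rmorphD !rmorphM /= !sgK.
  have [n hn] := nil (sg u); exists n.
  suff -> : iter n D' u = sg (iter n D (sg u)) by rewrite hn rmorph0.
  elim: (n) => [|n' IH]; first by rewrite /= sgK.
  by rewrite !iterS IH D'E sgK.
have Db0 : D b != 0 by rewrite Db expr1 (a_neq0 M0).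
have [N [p eN]] := der_ker hk M0 Dd Da Db0 (kill _ hD).
have D'a : D' a = 4%:R * b by rewrite D'E sa Dc rmorphM rmorph_nat /= sw.
have b0 : b != 0.
  by apply: contra_neq Db0 => ->; rewrite linear0.
have n4 : (4%:R : B) != 0 := mulr1_neq0l (alg_natK hk B 3).
have [D'd _] := hD'.
have e2 : N%:R * a ^+ N.-1 * r = ev1 (GRing.in_alg B) a p^`().
  have := congr1 D' eN; rewrite (der_eva a p D'd) D'd (kill _ hD') mulr0 addr0 (derX D'd) D'a.
  move=> h; apply: (model_mulfI M0 (r := 4%:R * b)); first by rewrite (model_integral M0) negb_or n4.
  by rewrite [RHS]mulrC -h; ring.
have e3 : ev1 (GRing.in_alg B) a (p *+ N - 'X * p^`()) = 0.
  rewrite rmorphB rmorphMn rmorphM /= ev1X -e2 -eN -mulr_natl.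
  by case: (N) => [|N'] /=; rewrite ?exprS; ring.
have pE : p = p`_N *: 'X^N.
  apply/polyP => i; rewrite coefZ coefXn; have [->|ne] := eqVneq i N; first by rewrite mulr1.
  have := congr1 (fun p : {poly k} => p`_i) (eva_inj M0 e3).
  rewrite coefB coefMn coef0 mulrC coefMX coef_deriv mulr0.
  have -> : (if i == 0%N then 0 else p`_i.-1.+1 *+ i.-1.+1) = p`_i *+ i by case: (i) => [|i'] //=; rewrite mulr0n.
  move=> h; have : (N%:Z - i%:Z)%:~R * p`_i = 0.
    by rewrite rmorphB /= -!pmulrn mulrBl !mulr_natl.
  move=> /eqP; rewrite mulf_eq0 pchar0_int // subr_eq0 => /orP[/eqP [] /eqP|/eqP //].
  by rewrite eq_sym (negPf ne).
exists p`_N; apply: (model_mulfI M0 (model_expf_neq0 M0 N (a_neq0 M0))).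
by rewrite eN {1}pE -mul_polyC rmorphM rmorphXn /= ev1C ev1X mulrC.
Qed.

Theorem not_isomorphic : ~ kisomorphic (Spec B) (Spec T).
Proof.
case=> f [g [fK gK]].
pose ph : {lrmorphism T -> B} := f B idfun.
pose ps : {lrmorphism B -> T} := g T idfun.
have n1 : f T ps = spec_res ps ph.
  have e0 : spec_res ps (idfun : {lrmorphism B -> B}) = ps by exact: lrmorph_ext.
  by rewrite -[in LHS]e0; exact: (mor_nat f).
have n2 : g B ph = spec_res ph ps.
  have e0 : spec_res ph (idfun : {lrmorphism T -> T}) = ph by exact: lrmorph_ext.
  by rewrite -[in LHS]e0; exact: (mor_nat g).
have e1 t : ps (ph t) = t.
  have := gK T idfun; rewrite -/ps n1.
  by move=> /(congr1 (fun h : {lrmorphism T -> T} => h t)).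
have e2 t : ph (ps t) = t.
  have := fK B idfun; rewrite -/ph n2.
  by move=> /(congr1 (fun h : {lrmorphism B -> B} => h t)).
have [D hD|s es] := killed_scalar (r := ph a1).
  have [Dd nil] := hD.
  pose D' : {linear T -> T} := ps \o D \o ph.
  have hD' : LND D'.
    split=> [u v|u]; first by rewrite /= !rmorphM Dd rmorphD !rmorphM /= !e1.
    have [n hn] := nil (ph u); exists n.
    suff -> : iter n D' u = ps (iter n D (ph u)) by rewrite hn rmorph0.
    elim: (n) => [|n' IH]; first by rewrite /= e1.
    by rewrite !iterS IH /= e2.
  have := LND_kills_a hk M1 hD'; rewrite /= => /(congr1 ph).
  by rewrite rmorph0 e2.
have : a1 = s%:A by rewrite -[a1]e1 es rmorph_alg.
move=> h; have /(eva_inj M1)/eqP : ev1 (GRing.in_alg T) a1 ('X - s%:P) = 0.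
  by rewrite rmorphB /= ev1X ev1C /= -h subrr.
by rewrite polyXsubC_eq0.
Qed.

End NotIsomorphic.

Section KernelLine.

Variables (k : fieldType) (m : nat) (C : comAlgType k) (a z al b be : C).
Hypothesis hk : [pchar k] =i pred0.
Hypothesis M : model m a z al b be.
Local Notation nf := (nfval (GRing.in_alg C) a z al b be).
Local Notation eva := (ev1 (GRing.in_alg C) a).

Lemma nfB (P Q : 'I_4 -> {poly {poly k}}) : nf (fun i => P i - Q i) = nf P - nf Q.
Proof.
have h i : ev2 (GRing.in_alg C) a z (P i - Q i) =
    ev2 (GRing.in_alg C) a z (P i) - ev2 (GRing.in_alg C) a z (Q i) by rewrite rmorphD rmorphN.
by rewrite /nfval !h; ring.
Qed.

Lemma nf_scale_a (p : {poly k}) (P : 'I_4 -> {poly {poly k}}) : eva p * nf P = nf (fun i => p%:P * P i).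
Proof. rewrite /nfval !rmorphM /= !ev2C; ring. Qed.

Lemma nf_eq (P Q : 'I_4 -> {poly {poly k}}) : nf P = nf Q -> forall th, P th = Q th.
Proof.
move=> e th; apply/eqP; rewrite -subr_eq0; apply/eqP.
apply: (model_nf_inj M (P := fun i => P i - Q i)).
by rewrite nfB e subrr.
Qed.

Lemma eva_div N p r : a ^+ N * r = eva p -> exists q, r = eva q.
Proof.
have [P ->] := model_nf M r => e.
have eN : eva ('X^N) = a ^+ N by rewrite rmorphXn /= ev1X.
have e' : nf (fun i => ('X^N)%:P * P i) = nf (fun i => if i == 0 then p%:P else 0).
  by rewrite -nf_scale_a eN e /nfval /= ev2C !rmorph0 !mulr0 !addr0.
have h := nf_eq e'; have X0 : ('X^N : {poly k}) != 0 by rewrite monic_neq0 ?monicXn.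
have hi i : i != 0 -> P i = 0.
  move=> i0; apply/eqP; have /eqP := h i; rewrite (negPf i0) mulf_eq0 polyC_eq0.
  by rewrite (negPf X0).
exists (P 0)`_0.
have -> : nf P = eva (P 0)`_0 ; last by [].
rewrite /nfval (hi 1) // (hi 2%:R) // (hi 3%:R) // !rmorph0 !mulr0 !addr0 -(ev2C _ a z); congr (ev2 _ _ _ _).
apply/polyP => -[|j]; rewrite coefC //=.
have := congr1 (fun p : {poly {poly k}} => p`_j.+1) (h 0).
by rewrite /= coefCM coefC /= => /eqP; rewrite mulf_eq0 (negPf X0) => /eqP.
Qed.

Lemma eva_lrmorph : exists f : {lrmorphism {poly k} -> C}, f =1 eva.
Proof.
have [|f fE] := @lrmorph_of_rmorph k {poly k} C eva; last by exists f.
by move=> c; rewrite alg_polyC /= ev1C.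
Qed.

Lemma kernel_line (D : {linear C -> C}) : derivation D -> D a = 0 -> D b != 0 -> kernel_is_line D.
Proof.
move=> Dd Da Db; have [f fE] := eva_lrmorph; exists f; split.
  by apply: raddf_inj => p e0; apply: (eva_inj M); rewrite -e0; symmetry; apply: fE.
move=> r; split=> [Dr|[p <-]]; last first.
  have -> : f p = eva p by exact: fE.
  by rewrite (der_eva _ _ Dd) Da mulr0.
have [N [p e]] := der_ker hk M Dd Da Db Dr.
by have [q ->] := eva_div e; exists q; apply: fE.
Qed.

End KernelLine.

Section ClassCKernel.
Variables (k : fieldType) (C : comAlgType k) (a z al b be : C).
Hypothesis hk : [pchar k] =i pred0.
Hypothesis M : model 1 a z al b be.

Lemma LND_kernel_line (D : {linear C -> C}) : LND D -> (exists r, D r != 0) -> kernel_is_line D.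
Proof.
move=> hD [r Dr]; have [Dd _] := hD; have Da := LND_kills_a hk M hD.
apply: (kernel_line hk M Dd Da); apply/eqP => Db; case/eqP: Dr.
exact: (der_ab_eq0 M Dd Da Db).
Qed.

Lemma ML_proper : exists r : C, ~ @ML k C r.
Proof.
have [D [hD _ Db _]] := flow_LND M; exists b => /(_ D hD) /eqP.
by rewrite Db (negPf (model_expf_neq0 M _ (a_neq0 M))).
Qed.

End ClassCKernel.

(** * A chart through the special fibre *)

Lemma sqrtN1_neq0 (k : fieldType) (i : k) : i ^+ 2 = -1 -> i != 0.
Proof. by apply: contra_eq_neq => ->; rewrite expr0n /= eq_sym oppr_eq0 oner_eq0. Qed.

Section Chart.

Variables (k : fieldType) (C : comAlgType k) (a z al b be : C) (i : k).
Hypothesis hk : [pchar k] =i pred0.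
Hypothesis M : model 1 a z al b be.
Hypothesis ii : i ^+ 2 = -1.

Local Notation S := {poly {poly k}}.
Local Notation nf := (nfval (GRing.in_alg C) a z al b be).

Lemma rels_xyz (A : comNzRingType) (x y w : A) : x ^+ 3 * w = y ^+ 2 + 1 ->
  rels 1 (x ^+ 2) (w ^+ 2) (x * w) (x * y) (y * w).
Proof.
move=> e; split; rewrite ?expr1; try ring.
- by apply: (lincomb (eqM (- x ^+ 2) e)); ring.
- by apply: (lincomb (eqM (- (x * w)) e)); ring.
- by apply: (lincomb (eqM (- w ^+ 2) e)); ring.
Qed.

Let half : k := 2%:R^-1.
Let hh : 2%:R * half = 1. Proof. by rewrite mulfV ?(nat_neq0 hk 1). Qed.

Definition xS : S := 'X.
Definition yS : S := i%:P%:P * (1 - half%:P%:P * 'X ^+ 3 * 'X%:P).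
Definition wS : S := 'X%:P * (1 - (half ^+ 2)%:P%:P * 'X ^+ 3 * 'X%:P).

Lemma yS_at0 : yS.[0] = i%:P.
Proof.
rewrite /yS hornerM hornerC hornerD hornerN !hornerM ?horner_exp hornerX ?expr0n /=.
by rewrite !(mulr0, mul0r) hornerC subr0 mulr1.
Qed.

Lemma wS_at0 : wS.[0] = 'X.
Proof.
rewrite /wS hornerM hornerC hornerD hornerN !hornerM ?horner_exp hornerX ?expr0n /=.
by rewrite !(mulr0, mul0r) hornerC subr0 mulr1.
Qed.

Let cS : {rmorphism k -> S} := @polyC {poly k} \o @polyC k.

Lemma chart_rels : rels 1 (xS ^+ 2) (wS ^+ 2) (xS * wS) (xS * yS) (yS * wS).
Proof.
apply: rels_xyz; rewrite /xS /yS /wS.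
have iS : (i%:P%:P : S) ^+ 2 = -1.
  by rewrite -!polyC_exp ii !rmorphN1.
have hS : (2%:R : S) * half%:P%:P = 1.
  by rewrite -[2%:R](rmorph_nat cS) /cS -[X in _ * X]/(cS half) -rmorphM hh rmorph1.
rewrite !polyC_exp; move: iS hS; set I := i%:P%:P; set H := half%:P%:P => iS hS.
apply: (lincomb (eqD (eqM (- ((1 - H * 'X ^+ 3 * 'X%:P) ^+ 2)) iS) (eqM (- ('X ^+ 3 * 'X%:P)) hS))).
ring.
Qed.

Definition is_chart (psi : {rmorphism C -> S}) : Prop :=
  (forall c : k, psi c%:A = c%:P%:P) /\
  [/\ psi a = xS ^+ 2, psi z = wS ^+ 2, psi al = xS * wS, psi b = xS * yS & psi be = yS * wS].

Lemma chart_exists : exists psi, is_chart psi.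
Proof. by have [psi h] := model_rmorph M cS chart_rels; exists psi. Qed.

Variable psi : {rmorphism C -> S}.
Hypothesis P : is_chart psi.

Lemma psi_ev2 p : psi (ev2 (GRing.in_alg C) a z p) = ev2 cS (xS ^+ 2) (wS ^+ 2) p.
Proof.
have [pc [pa pz _ _ _]] := P; elim/poly_ind: p => [|p q IH]; first by rewrite !rmorph0.
rewrite !rmorphD !rmorphM /= !ev2X !ev2C IH pz; congr (_ + _).
elim/poly_ind: q => [|q c IHq]; first by rewrite !rmorph0.
by rewrite !rmorphD !rmorphM /= !ev1X !ev1C IHq pa pc.
Qed.

Lemma parity_split (p q : {poly k}) c : c != 0 ->
  (p \Po 'X^2) + c%:P * 'X * (q \Po 'X^2) = 0 -> p = 0 /\ q = 0.
Proof.
move=> c0 e.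
have co j : ((p \Po 'X^2) + c%:P * 'X * (q \Po 'X^2))`_j = 0 by rewrite e coef0.
split; apply/polyP => j; rewrite coef0.
- have := co (j * 2)%N; rewrite coefD -mulrA coefCM coefXM !coef_comp_poly_Xn //.
  rewrite dvdn_mull // mulnK //; case: j => [|j]; first by rewrite mulr0 addr0.
  have -> : (2 %| (j.+1 * 2).-1)%N = false by apply/negbTE; rewrite mulSn /= dvdn2 /= oddM andbF.
  by rewrite mulr0 addr0.
- have := co (j * 2).+1; rewrite coefD -mulrA coefCM coefXM !coef_comp_poly_Xn //=.
  have -> : (2 %| (j * 2).+1)%N = false by rewrite dvdn2 /= oddM andbF.
  by rewrite add0r dvdn_mull // mulnK // => /eqP; rewrite mulf_eq0 (negPf c0) => /eqP.
Qed.

Lemma rmorph_comb4 (A B : comNzRingType) (f : {rmorphism A -> B}) (u0 u1 u2 u3 x y w : A) :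
  f (u0 + x * w * u1 + x * y * u2 + y * w * u3) =
  f u0 + f x * f w * f u1 + f x * f y * f u2 + f y * f w * f u3.
Proof. by rewrite !rmorphD !rmorphM. Qed.

(* Modulo [x^2] the chart maps [a, z, al, b, be] to [0, Y^2, x Y, i x, i Y]. *)
Lemma chart_div_nf (N : 'I_4 -> S) Q : psi (nf N) = 'X ^+ 2 * Q ->
  exists N', forall th, N th = 'X%:P * N' th.
Proof.
move=> e; pose p th : {poly k} := map_poly (coefp 0) (N th).
pose N' th : S := map_poly (drop_poly 1) (N th).
have NE th : N th = map_poly polyC (p th) + 'X%:P * N' th.
  apply/polyP => j; rewrite coefD coefCM !coef_map_id0 ?linear0 ?coef0 //=.
  rewrite -[LHS](poly_take_drop 1) expr1 ['X * _]mulrC; congr (_ + _).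
  by apply/polyP => l; rewrite coef_take_poly coefC; case: l.
suff p0 th : p th = 0 by exists N' => th; rewrite NE p0 map_poly0 add0r.
have [pc [pa pz pl pb pe]] := P.
have e1p q : ev2 cS (xS ^+ 2) (wS ^+ 2) (map_poly polyC q) = ev1 cS (wS ^+ 2) q.
  elim/poly_ind: q => [|q c IH]; first by rewrite !rmorph0.
  by rewrite !rmorphD !rmorphM /= map_polyX map_polyC /= !ev2X ev2C ev1C ev1X IH ev1C.
pose w0 q := ev1 cS (wS ^+ 2) q.
have e2 : w0 (p 0) + xS * wS * w0 (p 1) + xS * yS * w0 (p 2%:R) + yS * wS * w0 (p 3%:R)
    = 'X ^+ 2 * (Q - psi (nf N')).
  rewrite mulrBr -e -/xS -pa -rmorphM.
  have -> : a * nf N' = nf (fun th => 'X%:P * N' th) by rewrite -nf_scale_a ev1X.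
  have h t : N t - 'X%:P * N' t = map_poly polyC (p t) by rewrite {1}NE addrK.
  rewrite -rmorphB -nfB /nfval !h !rmorphD !rmorphM /= !psi_ev2 pl pb pe.
  by rewrite !e1p.
pose ev0 : {rmorphism S -> {poly k}} := horner_eval (0 : {poly k}).
have evX : ev0 'X = 0 by exact: hornerX.
have evC q : ev0 q%:P = q by exact: hornerC.
have x0 : ev0 xS = 0 by exact: evX.
have y0 : ev0 yS = i%:P := yS_at0.
have w00 : ev0 wS = 'X.
  rewrite /wS rmorphM rmorphB rmorph1 !rmorphM ?rmorphXn /= evX ?expr0n /=.
  by rewrite !(mulr0, mul0r) subr0 mulr1 evC.
have at0 q : ev0 (w0 q) = q \Po 'X^2.
  rewrite /w0; elim/poly_ind: q => [|q c IH]; first by rewrite !rmorph0.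
  rewrite (rmorphD (ev1 cS _)) (rmorphM (ev1 cS _)) /= ev1X ev1C comp_polyD comp_polyM comp_polyX comp_polyC.
  by rewrite (rmorphD ev0) (rmorphM ev0) (rmorphXn ev0) w00 IH; congr (_ + _); apply: evC.
have i0 := sqrtN1_neq0 ii.
have [p00 p30] : p 0 = 0 /\ p 3%:R = 0.
  apply: (parity_split i0); have := congr1 ev0 e2.
  rewrite (rmorph_comb4 ev0) !at0 x0 y0 w00 (rmorphM ev0) (rmorphXn ev0) evX expr0n /=.
  by rewrite !mul0r !addr0.
have e3 : wS * w0 (p 1) + yS * w0 (p 2%:R) = 'X * (Q - psi (nf N')).
  apply: (mulfI (x := 'X)); first by rewrite polyX_eq0.
  by apply: (lincomb e2); rewrite p00 p30 /w0 !rmorph0 /xS; ring.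
have iv0 : i^-1 != 0 by rewrite invr_eq0.
have [p20 p10] : p 2%:R = 0 /\ p 1 = 0.
  apply: (parity_split iv0); have := congr1 ev0 e3.
  rewrite (rmorphD ev0) (rmorphM ev0 wS) (rmorphM ev0 yS) (rmorphM ev0 'X) !at0 y0 w00 evX mul0r => h.
  apply: (lincomb (eqM (i^-1)%:P h)).
  have : (i^-1)%:P * i%:P = 1 :> {poly k} by rewrite -polyCM mulVf.
  move: (i^-1)%:P (i%:P) => u v uv; apply: (lincomb (eqM (- (p 2%:R \Po 'X^2)) uv)); ring.
have hv (t : 'I_4) : th = t :> nat -> th = t by move=> h; apply: val_inj.
by have := ord4_cases th; rewrite !inE => /or4P[]/eqP h; [rewrite (hv 0) | rewrite (hv 1) | rewrite (hv 2%:R) | rewrite (hv 3%:R)].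
Qed.

Lemma chart_div r Q : psi r = 'X ^+ 2 * Q -> exists r', r = a * r'.
Proof.
have [N ->] := model_nf M r => /chart_div_nf[N' e]; exists (nf N').
have -> : a * nf N' = nf (fun th => 'X%:P * N' th) by rewrite -nf_scale_a ev1X.
by rewrite /nfval; congr (_ + _ * _ + _ * _ + _ * _); congr (ev2 _ _ _ _); apply: e.
Qed.

Lemma chart_inj : injective psi.
Proof.
apply: raddf_inj => r; have [N ->] := model_nf M r => e.
pose bd (n : nat) (N : 'I_4 -> S) := forall th j, (size ((N th)`_j)%R <= n)%N.
have [n hn] : exists n, bd n N.
  by have [n h] := coef_size_bound N; exists n => th; have [] := h th.
have x2 : ('X ^+ 2 : S) != 0 by rewrite expf_neq0 ?polyX_eq0.
elim: n N hn e => [|n IHn] N hn e.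
  have N0 th : N th = 0.
    by apply/polyP => j; rewrite coef0; apply/eqP; rewrite -size_poly_eq0 -leqn0.
  exact: nfval0.
have [|N' eN] := @chart_div_nf N 0; first by rewrite mulr0.
have nE : nf N = a * nf N'.
  have -> : a * nf N' = nf (fun th => 'X%:P * N' th) by rewrite -nf_scale_a ev1X.
  by rewrite /nfval; congr (_ + _ * _ + _ * _ + _ * _); congr (ev2 _ _ _ _); apply: eN.
rewrite nE (IHn N') ?mulr0 //.
  move=> th j; have := hn th j; rewrite eN coefCM mulrC.
  have [->|n0] := eqVneq (N' th)`_j 0; first by rewrite size_poly0.
  by rewrite size_mulX.
have [_ [pa _ _ _ _]] := P.
have e' : psi (nf N) = 0 := e.
by apply: (mulfI x2); move: e'; rewrite nE (rmorphM psi) pa mulr0.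
Qed.

End Chart.

(** * Units and normality *)

Section Gauss.

Variable k : fieldType.
Hypothesis kcl : GRing.closed_field_axiom k.
Local Notation S := {poly {poly k}}.

Lemma closed_root (p : {poly k}) : (1 < size p)%N -> exists c, root p c.
Proof.
move=> sp; pose n := (size p).-1; have lc : lead_coef p != 0.
  by rewrite lead_coef_eq0 -size_poly_gt0; apply: leq_trans sp.
have n0 : (0 < n)%N by rewrite /n; lia.
have [x xE] := kcl (fun i => - (p`_i / lead_coef p)) n0; exists x.
rewrite /root horner_coef (_ : size p = n.+1); last by rewrite /n; lia.
rewrite big_ord_recr /= -/(lead_coef p) xE mulr_sumr -big_split /= big1 // => j _.
by field.
Qed.

Definition evc (c : k) : S -> {poly k} := map_poly (horner_eval c).
HB.instance Definition _ c := GRing.RMorphism.on (evc c).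

Lemma coef_evc c P j : (evc c P)`_j = (P`_j).[c].
Proof. by rewrite coef_map. Qed.

Lemma evcC c p : evc c p%:P = (p.[c])%:P.
Proof. by rewrite /evc map_polyC. Qed.

Lemma evcX c : evc c 'X = 'X.
Proof. by rewrite /evc map_polyX. Qed.

Lemma evc_factor c P : evc c P = 0 -> exists P', P = ('X - c%:P)%:P * P'.
Proof.
move=> e; exists (map_poly (fun q : {poly k} => q %/ ('X - c%:P)) P).
apply/polyP => j; rewrite coefCM coef_map_id0 ?div0p // mulrC divpK //.
by rewrite dvdp_XsubCl /root -coef_evc e coef0.
Qed.

Definition primitive (P : S) : Prop := forall c, evc c P != 0.

Lemma lead_coefMC (p : {poly k}) (P : S) : lead_coef (p%:P * P) = p * lead_coef P.
Proof. by rewrite lead_coefM lead_coefC. Qed.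

Lemma primitive_part P : P != 0 ->
  exists q P', [/\ q != 0, primitive P' & P = q%:P * P'].
Proof.
move: {2}(size _) (leqnn (size (lead_coef P))) => n; elim: n P => [|n IHn] P sP P0.
  by move: sP; rewrite leqn0 size_poly_eq0 lead_coef_eq0 (negPf P0).
have [prim|] := pselect (primitive P).
  by exists 1, P; rewrite oner_eq0 mul1r.
move=> /existsNP[c /negP]; rewrite negbK => /eqP/evc_factor[P' PE].
have P'0 : P' != 0 by apply: contraNneq P0; rewrite PE => ->; rewrite mulr0.
have X0 : ('X - c%:P) != 0 by rewrite polyXsubC_eq0.
have [|q [P'' [q0 prim e]]] := IHn P' _ P'0.
  move: sP; rewrite PE lead_coefMC mulrC size_Mmonic ?monicXsubC ?lead_coef_eq0 //.
  by rewrite size_XsubC addn2.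
exists (('X - c%:P) * q), P''; split=> //; first by rewrite mulf_neq0.
by rewrite PE e polyCM mulrA.
Qed.

Lemma gauss_cancel s (p g q : S) : s != 0 -> primitive p -> s%:P * g = q * p ->
  exists q', g = q' * p.
Proof.
move: {2}(size s) (leqnn (size s)) => n; elim: n s q => [|n IHn] s q sn s0 prim e.
  by move: sn; rewrite leqn0 size_poly_eq0 (negPf s0).
have [s1|s1] := leqP (size s) 1.
  have [c c0 sE] : exists2 c, c != 0 & s = c%:P.
    by exists s`_0; [rewrite -polyC_eq0 -size1_polyC | rewrite -size1_polyC].
  exists (c^-1%:P%:P * q); rewrite -mulrA -e sE mulrA -!polyCM mulVf //.
  by rewrite mul1r.
have [c /factor_theorem[s' sE]] := closed_root s1.
have X0 : ('X - c%:P) != 0 by rewrite polyXsubC_eq0.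
have /evc_factor[q' qE] : evc c q = 0.
  apply: (mulIf (prim c)); rewrite mul0r -(rmorphM (evc c)) -e rmorphM /= evcC sE.
  by rewrite hornerM !hornerE subrr mulr0 mul0r.
have s'0 : s' != 0 by apply: contraNneq s0; rewrite sE => ->; rewrite mul0r.
apply: (IHn s' q' _ s'0 prim).
  by move: sn; rewrite sE size_Mmonic ?monicXsubC // size_XsubC addn2.
apply: (@mulfI _ ('X - c%:P)%:P); first by rewrite polyC_eq0.
by rewrite !mulrA -qE -e sE polyCM [_ * s'%:P]mulrC.
Qed.

Lemma irreducible_divisor (R : idomainType) (P : {poly R}) : (1 < size P)%N ->
  exists2 p, irreducible_poly p & p %| P.
Proof.
move: {2}(size P) (leqnn (size P)) => n; elim: n P => [|n IHn] P sn s1.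
  by move: sn s1; case: (size P).
have [irr|] := pselect (irreducible_poly P); first by exists P.
have P0 : P != 0 by rewrite -size_poly_gt0; apply: leq_trans s1.
move=> nirr; have [q [q1 qP nq]] : exists q : {poly R}, [/\ size q != 1%N, q %| P & ~~ (q %= P)].
  apply: contrapT => h; apply: nirr; split=> // q q1 qP.
  by apply: contraT => nq; exfalso; apply: h; exists q.
have q0 : q != 0 by apply: contraTneq qP => ->; rewrite dvd0p.
have [||p irr pq] := IHn q.
- have le := dvdp_leq P0 qP; rewrite -ltnS; apply: leq_trans sn.
  by rewrite ltn_neqAle le andbT dvdp_size_eqp.
- by move: q1 q0; rewrite -size_poly_gt0; case: (size q) => [|[]].
- by exists p => //; apply: dvdp_trans pq qP.
Qed.

Lemma irreducible_euclid (R : idomainType) (p P Q : {poly R}) : irreducible_poly p ->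
  p %| P * Q -> (p %| P) || (p %| Q).
Proof.
move=> [_ irr] pPQ; have [c|nc] := boolP (coprimep p P).
  by rewrite -[p %| Q](Gauss_dvdpr _ c) pPQ orbT.
have := irr _ nc (dvdp_gcdl p P) => e.
by rewrite -(eqp_dvdl _ e) dvdp_gcdr.
Qed.

Lemma irreducible_exp (R : idomainType) (p P : {poly R}) n : irreducible_poly p ->
  p %| P ^+ n -> p %| P.
Proof.
move=> irr; elim: n => [|n IHn].
  by rewrite expr0 dvdp1 => /eqP s1; have [] := irr; rewrite s1.
by rewrite exprS => /(irreducible_euclid irr)/orP[].
Qed.

Lemma polyX_factor (q : {poly k}) : q != 0 -> exists N q', q = 'X^N * q' /\ q'.[0] != 0.
Proof.
move: {2}(size q) (leqnn (size q)) => n; elim: n q => [|n IHn] q sn q0.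
  by move: sn; rewrite leqn0 size_poly_eq0 (negPf q0).
have [r|nr] := boolP (root q 0); last by exists 0%N, q; rewrite expr0 mul1r.
have [q' qE] := factor_theorem q 0 r; rewrite subr0 in qE.
have q'0 : q' != 0 by apply: contraNneq q0; rewrite qE => ->; rewrite mul0r.
have [|N [q2 [e h]]] := IHn q' _ q'0; first by move: sn; rewrite qE size_mulX.
by exists N.+1, q2; rewrite qE e exprS; split=> //; ring.
Qed.

Lemma only_root0 (q : {poly k}) : q != 0 -> (forall c, root q c -> c = 0) ->
  exists N c, c != 0 /\ q = c *: 'X^N.
Proof.
move=> q0 hr; have [N [q' [e h]]] := polyX_factor q0.
have [s1|s1] := leqP (size q') 1.
  exists N, q'`_0; rewrite -horner_coef0 h; split=> //.
  by rewrite e [in LHS](size1_polyC s1) horner_coef0 mulrC mul_polyC.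
have [c hc] := closed_root s1.
have c0 : c = 0 by apply: hr; rewrite e rootM hc orbT.
by move: h; rewrite c0 in hc; rewrite (eqP hc) eqxx.
Qed.

End Gauss.

Section Homogenization.

Definition hform (R : comNzRingType) (p : {poly R}) (u t : R) : R :=
  \sum_(i < size p) p`_i * u ^+ i * t ^+ ((size p).-1 - i).

Lemma hform_root (R : nzRingType) (K : fieldType) (f : {rmorphism R -> K}) (p : {poly R}) (u t : K) :
  t != 0 -> p \is monic -> root (map_poly f p) (u / t) ->
  \sum_(i < size p) f p`_i * u ^+ i * t ^+ ((size p).-1 - i) = 0.
Proof.
move=> t0 pm /eqP; rewrite horner_coef size_map_poly_id0; last first.
  by rewrite (monicP pm) rmorph1 oner_eq0.
move=> e; transitivity (t ^+ (size p).-1 * \sum_(i < size p) (map_poly f p)`_i * (u / t) ^+ i).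
  rewrite mulr_sumr; apply: eq_bigr => i _.
  rewrite coef_map expr_div_n -[in t ^+ (size p).-1](@subnK i (size p).-1); last first.
    by rewrite -ltnS prednK // (leq_trans _ (ltn_ord i)).
  by rewrite exprD; field; rewrite expf_neq0.
by rewrite e mulr0.
Qed.

(* If [u] is integral over [t] times a multiple of [X], then [X] divides [u]. *)
Lemma hform_dvdX (R : idomainType) (p : {poly {poly R}}) u t : p \is monic ->
  hform p u ('X * t) = 0 -> exists v, u = 'X * v.
Proof.
move=> pm; rewrite /hform -(prednK (n := size p)) ?size_poly_gt0 ?monic_neq0 //.
rewrite big_ord_recr /= -/(lead_coef p) (monicP pm) subnn expr0 mulr1 mul1r => e.
suff : root u 0.
  by move=> /factor_theorem[v ->]; exists v; rewrite subr0 mulrC.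
have : (u ^+ (size p).-1).[0] = 0.
  move/eqP: e; rewrite addrC addr_eq0 => /eqP ->; rewrite hornerN horner_sum big1 ?oppr0 // => i _.
  rewrite hornerM horner_exp [('X * t).[0]]hornerM hornerX mul0r.
  by rewrite expr0n subn_eq0 leqNgt ltn_ord mulr0.
by rewrite horner_exp => /eqP; rewrite expf_eq0 => /andP[].
Qed.

Lemma hform_cancel (R : idomainType) (p : {poly R}) x u t : x != 0 -> 
  hform p (x * u) (x * t) = 0 -> hform p u t = 0.
Proof.
move=> x0 e; apply: (mulfI (expf_neq0 (size p).-1 x0)); rewrite mulr0 -e /hform mulr_sumr.
apply: eq_bigr => i _; rewrite !exprMn -[in x ^+ (size p).-1](@subnK i (size p).-1); last first.
  by rewrite -ltnS prednK // (leq_trans _ (ltn_ord i)).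
by rewrite exprD; ring.
Qed.

Lemma hform_map (R R' : comNzRingType) (f : {rmorphism R -> R'}) (p : {poly R}) u t :
  p \is monic -> f (hform p u t) = hform (map_poly f p) (f u) (f t).
Proof.
move=> pm; rewrite /hform size_map_poly_id0; last by rewrite (monicP pm) rmorph1 oner_eq0.
by rewrite rmorph_sum; apply: eq_bigr => i _; rewrite !rmorphM !rmorphXn coef_map.
Qed.

End Homogenization.

Lemma fraction_quotient (R : idomainType) (x : {fraction R}) :
  exists P Q, Q != 0 /\ x = tofrac P / tofrac Q.
Proof.
pose r := repr x; have d0 : r.2 != 0 := denom_ratioP r.
exists r.1, r.2; split=> //; apply: (canRL (mulfK _)); first by rewrite tofrac_eq0.
rewrite -[x in LHS]reprK -/r; unlock FracField.tofrac.
rewrite -[LHS]FracField.pi_mul /FracField.mulf !numden_Ratio ?oner_neq0 // mulr1.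
apply/eqmodP; rewrite /= FracField.equivfE !numden_Ratio ?oner_neq0 //.
by rewrite mulr1 mulrC.
Qed.

Section Normality.

Variables (k : fieldType) (C : comAlgType k) (a z al b be : C).
Hypothesis hk : [pchar k] =i pred0.
Hypothesis kcl : GRing.closed_field_axiom k.
Hypothesis M : model 1 a z al b be.
Local Notation S := {poly {poly k}}.
Local Notation evab := (ev2 (GRing.in_alg C) a b).

Lemma closed_sqrtN1 : exists i : k, i ^+ 2 = -1.
Proof.
have [|i hi] := closed_root kcl (p := 'X^2 + 1); first by rewrite size_XnaddC.
exists i; apply/eqP; rewrite -addr_eq0; apply/eqP.
by move/rootP: hi; rewrite !hornerE.
Qed.

Lemma model_chart : exists (i : k) (psi : {rmorphism C -> S}),
  i ^+ 2 = -1 /\ is_chart a z al b be i psi.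
Proof.
have [i ii] := closed_sqrtN1; have [psi P] := chart_exists hk M ii.
by exists i, psi.
Qed.

Lemma model_units : units_are_scalars C.
Proof.
move=> u v uv; have [i [psi [ii P]]] := model_chart.
have inj := chart_inj M ii P; have [pc _] := P.
have e : psi u * psi v = 1 by rewrite -rmorphM uv rmorph1.
have /eqP : size (psi u * psi v) == 1 by rewrite e size_poly1.
move/eqP; rewrite size_mul_eq1 => /andP[/eqP su /eqP sv].
have := e; rewrite (size1_polyC (eq_leq su)) (size1_polyC (eq_leq sv)) -polyCM => /polyC_inj e2.
have : size ((psi u)`_0 * (psi v)`_0) == 1 by rewrite e2 size_poly1.
rewrite size_mul_eq1 => /andP[/eqP su2 _].
exists (psi u)`_0`_0; apply: inj.
by rewrite pc [LHS](size1_polyC (eq_leq su)) [(psi u)`_0 in LHS](size1_polyC (eq_leq su2)).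
Qed.

Section FractionField.
Variables (K : fieldType) (toK : {rmorphism S -> K}).
Hypothesis toK_inj : injective toK.
Hypothesis toK_frac : forall x, exists P Q, Q != 0 /\ x = toK P / toK Q.

Let toK0 P : P != 0 -> toK P != 0.
Proof. by move=> h; rewrite -(rmorph0 toK) (inj_eq toK_inj). Qed.

Lemma fraction_embedding : exists j : {rmorphism C -> K}, injective j /\ forall P, j (evab P) = toK P.
Proof.
pose cK : {rmorphism k -> K} := toK \o (@polyC {poly k} \o @polyC k).
pose A := toK 'X%:P; pose B := toK 'X.
have A0 : A != 0 by rewrite toK0 // polyC_eq0 polyX_eq0.
pose w := (B ^+ 2 + A) / A ^+ 2.
have R : rels 1 A (w ^+ 2 / A) w B (B * w / A).
  by split; rewrite ?expr1 /w; field.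
have [j [jc [ja jz jl jb je]]] := model_rmorph M cK R; exists j.
have jP P : j (evab P) = toK P.
  elim/poly_ind: P => [|p q IH]; first by rewrite !rmorph0.
  rewrite !rmorphD !rmorphM /= ev2X ev2C IH jb; congr (_ + _).
  elim/poly_ind: q => [|q c IHq]; first by rewrite !rmorph0.
  by rewrite !rmorphD !rmorphM /= ev1X ev1C IHq ja jc.
split=> //; apply: raddf_inj => r jr; have [N [P e]] := localize M r.
have : toK P = 0 by rewrite -jP -e rmorphM [X in _ * X]jr mulr0.
move/eqP; rewrite -(rmorph0 toK) (inj_eq toK_inj) => /eqP P0.
move/eqP: e; rewrite P0 rmorph0 (model_integral M) => /orP[|/eqP //].
by rewrite (negPf (model_expf_neq0 M _ (a_neq0 M))).
Qed.

Variable j : {rmorphism C -> K}.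
Hypothesis jinj : injective j.
Hypothesis jP : forall P, j (evab P) = toK P.

Lemma localize_coefs (p : {poly C}) : exists N, forall i, exists f, a ^+ N * p`_i = evab f.
Proof.
elim/poly_ind: p => [|p c [N hN]].
  by exists 0%N => i; exists 0; rewrite coef0 mulr0 rmorph0.
have [N' [f' e']] := localize M c; exists (N + N')%N => -[|i].
  exists ('X^N%:P * f'); rewrite coefD coefMX coefC add0r exprD -mulrA e' rmorphM /= ev2C.
  by rewrite rmorphXn /= ev1X.
have [f e] := hN i; exists ('X^N'%:P * f).
rewrite coefD coefMX coefC addr0 /= addnC exprD -mulrA e rmorphM /= ev2C.
by rewrite rmorphXn /= ev1X.
Qed.

Lemma integral_relation x P Q : integralOver j x -> Q != 0 -> x = toK P / toK Q ->
  exists N d R, ('X^N)%:P * P ^+ d = Q * R.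
Proof.
case=> p pm hr Q0 xE; rewrite xE in hr.
have e := hform_root (toK0 Q0) pm hr.
have [N hN] := localize_coefs p; have [f fE] := choice hN.
have e2 : \sum_(i < size p) f i * P ^+ i * Q ^+ ((size p).-1 - i) = 0.
  apply: toK_inj; rewrite rmorph0 rmorph_sum -[RHS](mulr0 (j (a ^+ N))) -[in RHS]e mulr_sumr.
  apply: eq_bigr => i _; rewrite !rmorphM !rmorphXn /= -jP -fE rmorphM rmorphXn; ring.
move: e2; rewrite -(prednK (n := size p)) ?size_poly_gt0 ?monic_neq0 //.
rewrite big_ord_recr /= subnn expr0 mulr1 => e2.
have fd : f (size p).-1 = ('X^N)%:P.
  apply: toK_inj; rewrite -!jP; congr (j _).
  by rewrite -fE -/(lead_coef p) (monicP pm) mulr1 ev2C rmorphXn /= ev1X.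
rewrite fd in e2.
exists N, (size p).-1, (- \sum_(i < (size p).-1) f i * P ^+ i * Q ^+ ((size p).-1 - i).-1).
apply/eqP; rewrite mulrN -addr_eq0 addrC mulr_sumr; apply/eqP; rewrite -[RHS]e2; congr (_ + _).
apply: eq_bigr => i _; have : (0 < (size p).-1 - i)%N by rewrite subn_gt0.
by case: (_ - _)%N => // l _; rewrite exprS; ring.
Qed.

Lemma integral_const_den x : integralOver j x ->
  exists P q, q != 0 /\ x = toK P / toK q%:P.
Proof.
move=> hx; have [P [Q [Q0 xE]]] := toK_frac x.
move: {2}(size Q) (leqnn (size Q)) => n; elim: n P Q Q0 xE => [|n IHn] P Q Q0 xE sQ.
  by move: sQ; rewrite leqn0 size_poly_eq0 (negPf Q0).
have [s1|s1] := leqP (size Q) 1.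
  exists P, Q`_0; rewrite -(size1_polyC s1) xE; split=> //.
  by rewrite -polyC_eq0 -(size1_polyC s1).
have [p irr pQ] := irreducible_divisor s1.
have [N [d [R e]]] := integral_relation hx Q0 xE.
have XN : ('X^N : {poly k}) != 0 by rewrite monic_neq0 ?monicXn.
have : p %| P ^+ d by rewrite -(dvdpZr _ _ XN) -mul_polyC e dvdp_mulr.
move=> /(irreducible_exp irr)/Pdiv.Idomain.dvdpP[[c1 P'] /= c10 e1].
have /Pdiv.Idomain.dvdpP[[c2 Q'] /= c20 e2] := pQ.
have p0 : p != 0 by apply: contraTneq pQ => ->; rewrite dvd0p.
have Q'0 : Q' != 0.
  apply: contraNneq Q0 => Q'0; move/eqP: e2; rewrite Q'0 mul0r.
  by rewrite -mul_polyC mulf_eq0 polyC_eq0 (negPf c20).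
apply: (IHn (c2%:P * P') (c1%:P * Q')).
- by rewrite mulf_neq0 ?polyC_eq0.
- have e1' : toK c1%:P * toK P = toK P' * toK p by rewrite -!rmorphM mul_polyC e1.
  have e2' : toK c2%:P * toK Q = toK Q' * toK p by rewrite -!rmorphM mul_polyC e2.
  have n1 : toK c1%:P != 0 by rewrite toK0 ?polyC_eq0.
  have n2 : toK c2%:P != 0 by rewrite toK0 ?polyC_eq0.
  have n3 := toK0 Q0; have n4 := toK0 Q'0; have n5 := toK0 p0.
  rewrite xE !rmorphM.
  have -> : toK P = toK P' * toK p / toK c1%:P by rewrite -e1' mulrC mulKf.
  have -> : toK Q = toK Q' * toK p / toK c2%:P by rewrite -e2' mulrC mulKf.
  by field; rewrite n1 n2 n4 n5.
- rewrite mul_polyC size_scale //.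
  have := size_scale Q c20; rewrite e2 size_mul // => sE.
  have [sp _] := irr; move: sQ; rewrite -sE.
  have : (0 < size Q')%N by rewrite size_poly_gt0.
  by lia.
Qed.

Lemma integral_local x : integralOver j x -> exists N r, x = j r / j (a ^+ N).
Proof.
move=> hx; have [P [q [q0 xE]]] := integral_const_den hx.
move: {2}(size q) (leqnn (size q)) => n; elim: n P q q0 xE => [|n IHn] P q q0 xE sq.
  by move: sq; rewrite leqn0 size_poly_eq0 (negPf q0).
have qC0 : q%:P != 0 :> S by rewrite polyC_eq0.
have [[c [hc c0]]|h] := pselect (exists c, root q c /\ c != 0).
  have [q' qE] := factor_theorem q c hc.
  have [N [d [R e]]] := integral_relation hx qC0 xE.
  have : evc c P ^+ d = 0.
    apply: (mulfI (x := (c ^+ N)%:P)); first by rewrite polyC_eq0 expf_neq0.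
    have hP : evc c (P ^+ d) = evc c P ^+ d by rewrite rmorphXn.
    have := congr1 (evc c) e; rewrite [LHS]rmorphM [RHS]rmorphM /= !evcC (rootP hc) mul0r mulr0.
    by rewrite hP hornerXn.
  move=> /eqP; rewrite expf_eq0 => /andP[_ /eqP/evc_factor[P' PE]].
  have X0 : toK ('X - c%:P)%:P != 0 by rewrite toK0 // polyC_eq0 polyXsubC_eq0.
  have q'0 : q' != 0 by apply: contraNneq q0; rewrite qE => ->; rewrite mul0r.
  apply: (IHn P' q' q'0).
    have n1 : toK q'%:P != 0 by rewrite toK0 // polyC_eq0.
    rewrite xE PE qE polyCM ![toK (_ * _)]rmorphM.
    move: (toK _%:P) (toK q'%:P) X0 n1 => u1 u2 X0 n1; field.
    by rewrite X0 n1.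
  by move: sq; rewrite qE size_Mmonic ?monicXsubC // size_XsubC addn2.
have [|N [c [c0 qE]]] := only_root0 kcl q0.
  by move=> c hc; apply/eqP; apply: contraT => c0; exfalso; apply: h; exists c.
exists N, (evab (c^-1%:P%:P * P)); rewrite xE jP rmorphM.
have -> : j (a ^+ N) = toK ('X^N)%:P by rewrite -jP ev2C; congr (j _); rewrite rmorphXn /= ev1X.
have cc : toK c%:P%:P * toK c^-1%:P%:P = 1 by rewrite -rmorphM -!polyCM mulfV // rmorph1.
have n1 : toK c%:P%:P != 0 by rewrite toK0 // !polyC_eq0.
have n2 : toK ('X^N)%:P != 0 by rewrite toK0 // polyC_eq0 monic_neq0 ?monicXn.
rewrite qE -mul_polyC polyCM rmorphM.
have -> : toK c^-1%:P%:P = (toK c%:P%:P)^-1 by apply: (mulfI n1); rewrite cc mulfV.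
move: (toK P) (toK c%:P%:P) (toK ('X^N)%:P) n1 n2 => u1 u2 u3 n1 n2.
by field; rewrite n1 n2.
Qed.

Lemma integral_closed x : integralOver j x -> exists r, x = j r.
Proof.
move=> hx; have [N [r xE]] := integral_local hx.
have [i [psi [ii P]]] := model_chart; have [_ [pa _ _ _ _]] := P.
have ja n : j (a ^+ n) != 0.
  by rewrite -(rmorph0 j) (inj_eq jinj) (model_expf_neq0 M) ?(a_neq0 M).
elim: N r xE => [|N IHN] r xE; first by exists r; rewrite xE rmorph1 divr1.
have [p pm hr] := hx; rewrite xE in hr.
have e : hform p r (a ^+ N.+1) = 0.
  apply: jinj; rewrite rmorph0 -[RHS](hform_root (ja N.+1) pm hr) /hform rmorph_sum.
  by apply: eq_bigr => l _; rewrite !rmorphM !rmorphXn.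
have pm' : map_poly psi p \is monic.
  have lc : psi (lead_coef p) != 0 by rewrite (monicP pm) rmorph1 oner_eq0.
  by rewrite monicE (lead_coef_map_eq lc) (monicP pm); apply/eqP; apply: rmorph1.
have X0 : ('X : S) != 0 by rewrite polyX_eq0.
have := congr1 psi e; rewrite (hform_map _ _ _ pm) rmorph0 exprS rmorphM rmorphXn pa /xS expr2 -mulrA => e2.
have [v vE] := hform_dvdX pm' e2; rewrite vE in e2.
have [v' v'E] := hform_dvdX pm' (hform_cancel X0 e2).
have [|r' rE] := chart_div M ii P (r := r) (Q := v'); first by rewrite vE v'E mulrA -expr2.
apply: (IHN r'); rewrite xE rE exprS !rmorphM; field.
by rewrite ja -(expr1 a) ja.
Qed.

End FractionField.

Lemma model_normal : normal_domain C.
Proof.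
split; first by move=> r t /eqP; rewrite (model_integral M) => /orP[] /eqP; [left|right].
have inj := @tofrac_injective S.
have [j [ji jP]] := fraction_embedding inj.
exists {fraction S}, j; split=> //.
- move=> x; have [P [Q [Q0 ->]]] := fraction_quotient x; exists (evab P), (evab Q); rewrite !jP; split=> //.
  by apply: contraNneq Q0 => /(ab_indep hk M) ->.
- by move=> x; apply: (integral_closed inj (@fraction_quotient _) ji jP).
Qed.

End Normality.

(** * Krull dimension *)

Section AlgebraicDependence.

Variable k : fieldType.
Local Notation S := {poly {poly k}}.

Definition bidegree_le (d : nat) (p : S) : Prop :=
  (size p <= d.+1)%N /\ forall i, (size ((p`_i)%R) <= d.+1)%N.

Lemma bidegree_exists (p : S) : exists d, bidegree_le d p.
Proof.
have [d /(_ tt)[h1 h2]] := coef_size_bound (fun _ : unit => p).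
by exists d; split=> [|i]; apply: leqW.
Qed.

Lemma bidegree_le_trans d d' p : (d <= d')%N -> bidegree_le d p -> bidegree_le d' p.
Proof. by move=> le [h1 h2]; split=> [|i]; [have := h1 | have := h2 i]; lia. Qed.

Lemma bidegree_leM d d' p q : bidegree_le d p -> bidegree_le d' q -> bidegree_le (d + d') (p * q).
Proof.
move=> [h1 h2] [h1' h2']; split=> [|i].
  by apply: leq_trans (size_polyMleq _ _) _; lia.
rewrite coefM; apply: leq_trans (size_sum _ _ _) _; apply/bigmax_leqP => j _.
apply: leq_trans (size_polyMleq _ _) _.
by have := h2 j; have := h2' (i - j)%N; lia.
Qed.

Lemma bidegree_leX d p n : bidegree_le d p -> bidegree_le (n * d) (p ^+ n).
Proof.
move=> h; elim: n => [|n IHn].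
  rewrite expr0; split=> [|i]; first by rewrite size_poly1.
  by rewrite coef1; case: (i == 0%N); rewrite ?size_poly1 ?size_poly0.
by rewrite exprS mulSn; apply: bidegree_leM.
Qed.

Lemma wide_matrix_kernel m n (A : 'M[k]_(m, n)) : (n < m)%N ->
  exists2 v : 'rV[k]_m, v != 0 & v *m A = 0.
Proof.
move=> lt; have : kermx A != 0.
  rewrite kermx_eq0 /row_free neq_ltn; apply/orP; left.
  by apply: leq_ltn_trans (rank_leq_col A) lt.
by case/rowV0Pn => v /sub_kermxP e v0; exists v.
Qed.

Lemma algebraic_dependence3 (f1 f2 f3 : S) : exists n (q : nat -> nat -> nat -> k),
  (exists i j l : nat, [/\ (i < n)%N, (j < n)%N, (l < n)%N & q i j l != 0]) /\
  \sum_(i < n) \sum_(j < n) \sum_(l < n) (q i j l)%:P%:P * f1 ^+ i * f2 ^+ j * f3 ^+ l = 0.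
Proof.
have [d1 h1] := bidegree_exists f1; have [d2 h2] := bidegree_exists f2.
have [d3 h3] := bidegree_exists f3.
pose d := (maxn d1 (maxn d2 d3))%N.
have b1 : bidegree_le d f1 by apply: bidegree_le_trans h1; rewrite /d; lia.
have b2 : bidegree_le d f2 by apply: bidegree_le_trans h2; rewrite /d; lia.
have b3 : bidegree_le d f3 by apply: bidegree_le_trans h3; rewrite /d; lia.
pose n := ((3 * d + 1) ^ 2).+1; pose D := (3 * n * d).+1.
pose T := ('I_n * ('I_n * 'I_n))%type; pose U := ('I_D * 'I_D)%type.
pose mon (t : T) := f1 ^+ t.1 * f2 ^+ t.2.1 * f3 ^+ t.2.2.
have bmon t : bidegree_le D.-1 (mon t).
  apply: (@bidegree_le_trans (t.1 * d + t.2.1 * d + t.2.2 * d)).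
    by have := ltn_ord t.1; have := ltn_ord t.2.1; have := ltn_ord t.2.2; rewrite /D /=; nia.
  by do 2?apply: bidegree_leM; apply: bidegree_leX.
pose A := \matrix_(r < #|{: T}|, s < #|{: U}|)
  (mon (enum_val r))`_((enum_val s).1)`_((enum_val s).2).
have ltUT : (#|{: U}| < #|{: T}|)%N.
  rewrite !card_prod !card_ord.
  have le : (D <= n * (3 * d + 1))%N by rewrite /D; nia.
  apply: (@leq_ltn_trans (n * n * (3 * d + 1) ^ 2)%N); first by nia.
  by rewrite /n; nia.
have [v v0 vA] := wide_matrix_kernel A ltUT.
have n0 : (0 < n)%N by [].
pose q (i j l : nat) : k := if insub i is Some i' then if insub j is Some j' then
   if insub l is Some l' then v 0 (enum_rank ((i', (j', l')) : T)) else 0 else 0 else 0.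
have qE (i j l : 'I_n) : q i j l = v 0 (enum_rank ((i, (j, l)) : T)).
  by rewrite /q !valK.
exists n, q; split.
  have /rV0Pn[r vr] := v0; exists (enum_val r).1, (enum_val r).2.1, (enum_val r).2.2; split=> //.
  by rewrite qE -!surjective_pairing enum_valK.
have -> : \sum_(i < n) \sum_(j < n) \sum_(l < n) (q i j l)%:P%:P * f1 ^+ i * f2 ^+ j * f3 ^+ l =
    \sum_(t : T) (v 0 (enum_rank t))%:P%:P * mon t.
  under eq_bigr => i _ do rewrite pair_big /=.
  rewrite pair_big /=; apply: eq_bigr => -[i [j l]] _.
  by rewrite qE /mon /= !mulrA.
apply/polyP => x; apply/polyP => y; rewrite !coef0 coef_sum coef_sum.
under eq_bigr => t _ do rewrite !coefCM.
have [lx|gx] := ltnP x D; last first.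
  apply: big1 => t _; have [h _] := bmon t.
  by rewrite (nth_default _ (leq_trans h gx)) coef0 mulr0.
have [ly|gy] := ltnP y D; last first.
  apply: big1 => t _; have [_ h] := bmon t.
  by rewrite (nth_default _ (leq_trans (h x) gy)) mulr0.
have := congr1 (fun w : 'rV_ _ => w 0 (enum_rank ((Ordinal lx, Ordinal ly) : U))) vA.
rewrite !mxE => e; rewrite -[RHS]e (reindex (@enum_val T predT)) /=; last first.
  by exists enum_rank => t _; [apply: enum_valK | apply: enum_rankK].
by apply: eq_bigr => r _; rewrite mxE enum_valK enum_rankK.
Qed.

End AlgebraicDependence.

Section PrimeIdeals.

Variables (k : fieldType) (C : comAlgType k).
Implicit Types P Q : {pred C}.

Lemma ker_prime (R : idomainType) (f : {rmorphism C -> R}) :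
  prime_ideal (fun r => f r == 0).
Proof.
split.
- split; rewrite ?unfold_in ?rmorph0 ?rmorph1 ?oner_eq0 //.
  by move=> u v w; rewrite !unfold_in rmorphD rmorphM => /eqP -> /eqP ->; rewrite mulr0 addr0.
- by move=> u v; rewrite !unfold_in rmorphM mulf_eq0.
Qed.

Section Prime.
Variable P : {pred C}.
Hypothesis hP : prime_ideal P.

Lemma prime0 : 0 \in P. Proof. by case: hP => -[]. Qed.
Lemma prime1 : 1 \notin P. Proof. by case: hP => -[]. Qed.
Lemma primeM r t : t \in P -> r * t \in P.
Proof. by case: hP => -[h0 _ h] _ ht; rewrite -[r * t]addr0 h. Qed.
Lemma primeD r t : r \in P -> t \in P -> r + t \in P.
Proof. by case: hP => -[h0 _ h] _ hr ht; rewrite -[r]mul1r h. Qed.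
Lemma primeN r : r \in P -> - r \in P.
Proof. by rewrite -mulN1r; apply: primeM. Qed.
Lemma primeB r t : r \in P -> t \in P -> r - t \in P.
Proof. by move=> hr ht; apply: primeD => //; apply: primeN. Qed.
Lemma prime_or r t : r * t \in P -> (r \in P) || (t \in P).
Proof. by case: hP => _; apply. Qed.
Lemma prime_cancel r t : r \notin P -> r * t \in P -> t \in P.
Proof. by move=> /negPf rP /prime_or; rewrite rP. Qed.
Lemma prime_expr r n : r ^+ n \in P -> r \in P.
Proof.
elim: n => [|n IHn]; first by rewrite expr0 (negPf prime1).
by rewrite exprS => /prime_or/orP[].
Qed.
Lemma prime_notinM r t : r \notin P -> t \notin P -> r * t \notin P.
Proof. by move=> hr ht; apply/negP => /prime_or; rewrite (negPf hr) (negPf ht). Qed.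
Lemma prime_notinX r n : r \notin P -> r ^+ n \notin P.
Proof. by apply: contra; apply: prime_expr. Qed.
Lemma prime_scalar c : c != 0 -> c%:A \notin P.
Proof.
move=> c0; apply/negP => /(primeM (c^-1)%:A); rewrite -scalerAl mul1r scalerA mulVf // scale1r.
exact/negP/prime1.
Qed.
End Prime.

Lemma trailing_coef (P P' : {pred C}) (y : C) (A : nat -> C) n i0 :
  prime_ideal P -> prime_ideal P' -> {subset P <= P'} -> y \notin P -> y \in P' ->
  (i0 < n)%N -> (forall i, (i < i0)%N -> A i = 0) -> \sum_(i < n) A i * y ^+ i \in P -> A i0 \in P'.
Proof.
move=> hP hP' sub yP yP' lt A0 h.
have e : \sum_(i < n) A i * y ^+ i =
    y ^+ i0 * (A i0 + y * \sum_(i < n - i0.+1) A (i0.+1 + i)%N * y ^+ i).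
  rewrite -(big_mkord xpredT (fun i => A i * y ^+ i)) (big_cat_nat (n := i0)) ?(ltnW lt) //=.
  rewrite big_nat big1 ?add0r => [|i /andP[_ li]]; last by rewrite A0 ?mul0r.
  rewrite big_ltn // mulrDr mulrC; congr (_ + _).
  rewrite -{1}[i0.+1]add0n big_addn big_mkord mulrA -exprSr mulr_sumr.
  by apply: eq_bigr => i _; rewrite addnC exprD; ring.
rewrite e in h; have := sub _ (prime_cancel hP (prime_notinX hP i0 yP) h) => h2.
rewrite -[A i0](addrK (y * \sum_(i < n - i0.+1) A (i0.+1 + i)%N * y ^+ i)).
by apply: primeB => //; rewrite mulrC; apply: primeM.
Qed.

End PrimeIdeals.

Section KrullDimension.

Variables (k : fieldType) (C : comAlgType k) (a z al b be : C).
Hypothesis hk : [pchar k] =i pred0.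
Hypothesis kcl : GRing.closed_field_axiom k.
Hypothesis M : model 1 a z al b be.

Lemma model_dependence (y1 y2 y3 : C) : exists n (q : nat -> nat -> nat -> k),
  (exists i j l : nat, [/\ (i < n)%N, (j < n)%N, (l < n)%N & q i j l != 0]) /\
  \sum_(i < n) (\sum_(j < n) (\sum_(l < n) (q i j l)%:A * y3 ^+ l) * y2 ^+ j) * y1 ^+ i = 0.
Proof.
have [i [psi [ii P]]] := model_chart hk kcl M.
have [n [q [ex e]]] := algebraic_dependence3 (psi y1) (psi y2) (psi y3).
exists n, q; split=> //; apply: (chart_inj M ii P).
rewrite rmorph0 -[RHS]e rmorph_sum; apply: eq_bigr => i' _.
rewrite rmorphM rmorph_sum mulr_suml; apply: eq_bigr => j _.
rewrite rmorphM rmorph_sum !mulr_suml; apply: eq_bigr => l _.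
have [pc _] := P; rewrite rmorphM !rmorphXn pc; ring.
Qed.

Lemma krull_le2 (c : nat -> {pred C}) m : prime_chain c m -> (m <= 2)%N.
Proof.
case=> hp hs; rewrite leqNgt; apply/negP => m3.
have p0 := hp 0%N (leq0n _); have p1 := hp 1%N (ltnW (ltnW m3)).
have p2 := hp 2%N (ltnW m3); have p3 := hp 3%N m3.
have [s1 [y1 y11 y10]] := hs 0%N (ltnW (ltnW m3)).
have [s2 [y2 y22 y21]] := hs 1%N (ltnW m3).
have [s3 [y3 y33 y32]] := hs 2%N m3.
have [n [q [[i [j [l [li lj ll qn]]]] e]]] := model_dependence y1 y2 y3.
pose P3 i j l := (l < n)%N && (q i j l != 0).
pose P2 i j := (j < n)%N && [exists l : 'I_n, P3 i j l].
pose P1 i := (i < n)%N && [exists j : 'I_n, P2 i j].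
have ex1 : exists i, P1 i.
  exists i; rewrite /P1 li; apply/existsP; exists (Ordinal lj); rewrite /P2 lj /=.
  by apply/existsP; exists (Ordinal ll); rewrite /P3 ll.
case: (ex_minnP ex1) => i0 /andP[li0 /existsP[j' hj']] min1.
have ex2 : exists j, P2 i0 j by exists j'.
case: (ex_minnP ex2) => j0 /andP[lj0 /existsP[l' hl']] min2.
have ex3 : exists l, P3 i0 j0 l by exists l'.
case: (ex_minnP ex3) => l0 /andP[ll0 q0] min3.
have z3 l1 : (l1 < l0)%N -> q i0 j0 l1 = 0.
  move=> lt; apply/eqP; apply: contraT => h; have := min3 l1.
  by rewrite /P3 h (ltn_trans lt ll0) leqNgt lt => /(_ isT).
have z2 j1 l1 : (j1 < j0)%N -> (l1 < n)%N -> q i0 j1 l1 = 0.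
  move=> lt ll1; apply/eqP; apply: contraT => h; have := min2 j1.
  rewrite leqNgt lt; apply; rewrite /P2 (ltn_trans lt lj0); apply/existsP.
  by exists (Ordinal ll1); rewrite /P3 /= ll1.
have z1 i1 j1 l1 : (i1 < i0)%N -> (j1 < n)%N -> (l1 < n)%N -> q i1 j1 l1 = 0.
  move=> lt lj1 ll1; apply/eqP; apply: contraT => h; have := min1 i1.
  rewrite leqNgt lt; apply; rewrite /P1 (ltn_trans lt li0); apply/existsP.
  exists (Ordinal lj1); rewrite /P2 /= lj1; apply/existsP.
  by exists (Ordinal ll1); rewrite /P3 /= ll1.
have h1 : \sum_(j < n) (\sum_(l < n) (q i0 j l)%:A * y3 ^+ l) * y2 ^+ j \in c 1%N.
  apply: (trailing_coef (A := fun i => \sum_(j < n) (\sum_(l < n) (q i j l)%:A * y3 ^+ l) * y2 ^+ j)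
    p0 p1 s1 y10 y11 li0) => [i1 lt|].
    apply: big1 => j1 _; rewrite big1 ?mul0r // => l1 _.
    by rewrite z1 // scale0r mul0r.
  by rewrite e; apply: prime0.
have h2 : \sum_(l < n) (q i0 j0 l)%:A * y3 ^+ l \in c 2%N.
  apply: (trailing_coef (A := fun j => \sum_(l < n) (q i0 j l)%:A * y3 ^+ l) p1 p2 s2 y21 y22 lj0 _ h1).
  move=> j1 lt; apply: big1 => l1 _.
  by rewrite z2 // scale0r mul0r.
have h3 : (q i0 j0 l0)%:A \in c 3%N.
  apply: (trailing_coef (A := fun l => (q i0 j0 l)%:A) p2 p3 s3 y32 y33 ll0 _ h2).
  by move=> l1 lt; rewrite z3 // scale0r.
by move: h3; rewrite (negPf (prime_scalar p3 q0)).
Qed.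

Definition zero_ideal : {pred C} := fun r => r == 0.

Lemma zero_prime : prime_ideal zero_ideal.
Proof.
split.
- split; rewrite ?unfold_in ?eqxx ?oner_eq0 //.
  by move=> u v w; rewrite !unfold_in => /eqP -> /eqP ->; rewrite mulr0 addr0.
- by move=> u v; rewrite !unfold_in (model_integral M).
Qed.

Lemma chain_cat (P Q : {pred C}) c m : prime_chain c m -> c m =i P -> prime_ideal Q ->
  {subset P <= Q} -> (exists2 r, r \in Q & r \notin P) ->
  prime_chain (fun n => if (n <= m)%N then c n else Q) m.+1.
Proof.
case=> hp hs cP hQ sub [r rQ rP]; split=> [n le|n]; first by case: ifP => // /hp.
rewrite ltnS => le; rewrite le; case: ltngtP le => // [lt|->] _; first exact: hs.
split=> [t|]; first by rewrite cP => /sub.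
by exists r => //; rewrite cP.
Qed.

Lemma chain01 (P : {pred C}) : prime_ideal P -> (exists2 r, r \in P & r != 0) ->
  prime_chain (fun n => if (n <= 0)%N then zero_ideal else P) 1.
Proof.
move=> hP [r rP r0]; apply: (@chain_cat zero_ideal P (fun=> zero_ideal) 0%N) => //.
- by split=> // n _; apply: zero_prime.
- by move=> t; rewrite unfold_in => /eqP ->; apply: prime0.
- by exists r.
Qed.

Lemma height_one_of_dim (P Q : {pred C}) : prime_ideal P -> (exists2 r, r \in P & r != 0) ->
  prime_ideal Q -> {subset P <= Q} -> (exists2 r, r \in Q & r \notin P) -> height_eq P 1.
Proof.
move=> hP nz hQ sub ex; split.
  by exists (fun n => if (n <= 0)%N then zero_ideal else P); [apply: chain01 |].
move=> c m hc cP; rewrite -ltnS; apply: krull_le2.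
exact: (chain_cat hc cP hQ sub ex).
Qed.

Lemma height_one_minimal (P Q : {pred C}) : height_eq P 1 -> prime_ideal P -> prime_ideal Q ->
  (exists2 r, r \in Q & r != 0) -> {subset Q <= P} -> Q =i P.
Proof.
move=> [_ hP] pP pQ nz sub t; apply/idP/idP => [/sub //|tP].
apply: contraT => tQ.
have hc : prime_chain _ 2 := chain_cat (chain01 pQ nz) (fun _ => erefl) pP sub (ex_intro2 _ _ t tP tQ).
by have := hP _ 2%N hc (fun _ => erefl).
Qed.

End KrullDimension.

(** * Height-one primes *)

Section Primes.

Variables (k : fieldType) (C : comAlgType k) (a z al b be : C).
Hypothesis hk : [pchar k] =i pred0.
Hypothesis kcl : GRing.closed_field_axiom k.
Hypothesis M : model 1 a z al b be.
Local Notation S := {poly {poly k}}.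
Local Notation evab := (ev2 (GRing.in_alg C) a b).
Local Notation eva := (ev1 (GRing.in_alg C) a).
Implicit Types Q : {pred C}.

Lemma evab_XnC N : evab ('X^N)%:P = a ^+ N.
Proof. by rewrite ev2C rmorphXn /= ev1X. Qed.

Lemma evab_inj : injective evab.
Proof. by apply: raddf_inj => P e; apply: (ab_indep hk M). Qed.

Section SpecialFibre.
Variables (i : k) (psi : {rmorphism C -> S}).
Hypotheses (ii : i ^+ 2 = -1) (ch : is_chart a z al b be i psi).

Definition chart_at0 : {rmorphism C -> {poly k}} := horner_eval (0 : {poly k}) \o psi.
Definition chart_at00 : {rmorphism C -> k} := horner_eval (0 : k) \o chart_at0.

Definition fibre_ideal : {pred C} := fun r => chart_at0 r == 0.
Definition origin_ideal : {pred C} := fun r => chart_at00 r == 0.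

Lemma fibre_prime : prime_ideal fibre_ideal. Proof. exact: ker_prime. Qed.
Lemma origin_prime : prime_ideal origin_ideal. Proof. exact: ker_prime. Qed.

Lemma chart_at0E r : chart_at0 r = (psi r).[0]. Proof. by []. Qed.
Lemma chart_at00E r : chart_at00 r = (chart_at0 r).[0]. Proof. by []. Qed.

Lemma fibre_dvd r : r \in fibre_ideal -> exists v, psi r = 'X * v.
Proof.
rewrite unfold_in chart_at0E => /factor_theorem[v ->]; exists v.
by rewrite subr0 mulrC.
Qed.

Lemma a_in_fibre : a \in fibre_ideal.
Proof.
have [_ [pa _ _ _ _]] := ch.
by rewrite unfold_in chart_at0E pa /xS horner_exp hornerX expr0n.
Qed.

Lemma chart_at0_b : chart_at0 b = 0.
Proof.
have [_ [_ _ _ pb _]] := ch.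
by rewrite chart_at0E pb hornerM /xS hornerX mul0r.
Qed.

Lemma chart_at0_be : chart_at0 be = i%:P * 'X.
Proof.
by have [_ [_ _ _ _ pe]] := ch; rewrite chart_at0E pe hornerM yS_at0 wS_at0.
Qed.

Lemma fibre_origin : {subset fibre_ideal <= origin_ideal}.
Proof. by move=> r; rewrite !unfold_in chart_at00E => /eqP ->; rewrite horner0. Qed.

Lemma be_origin : be \in origin_ideal /\ be \notin fibre_ideal.
Proof.
rewrite !unfold_in chart_at00E chart_at0_be hornerM hornerX mulr0 eqxx.
by rewrite mulf_neq0 ?polyX_eq0 // polyC_eq0 (sqrtN1_neq0 ii).
Qed.

Lemma fibre_height : height_eq fibre_ideal 1.
Proof.
apply: (height_one_of_dim hk kcl M fibre_prime _ origin_prime fibre_origin).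
  by exists a; [apply: a_in_fibre | apply: a_neq0 M].
by exists be; have [] := be_origin.
Qed.

Lemma krull_dim2 : krull_dim_eq C 2.
Proof.
split; last by move=> c m; apply: (krull_le2 hk kcl M).
have nz : exists2 r, r \in fibre_ideal & r != 0 by exists a; [apply: a_in_fibre | apply: a_neq0 M].
eexists; apply: (chain_cat (chain01 M fibre_prime nz) (fun _ => erefl) origin_prime fibre_origin).
by exists be; have [] := be_origin.
Qed.

Lemma fibre_square r : r \in fibre_ideal -> exists r', r ^+ 2 = a * r'.
Proof.
move=> /fibre_dvd[v e]; apply: (chart_div M ii ch (Q := v ^+ 2)).
by rewrite rmorphXn e exprMn.
Qed.

Lemma prime_a_fibre Q : prime_ideal Q -> a \in Q -> {subset fibre_ideal <= Q}.
Proof.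
move=> hQ aQ r /fibre_square[r' e]; apply: (prime_expr hQ (n := 2)).
by rewrite e mulrC; apply: primeM.
Qed.

Lemma height_one_a Q : prime_ideal Q -> height_eq Q 1 -> a \in Q -> fibre_ideal =i Q.
Proof.
move=> hQ h1 aQ; apply: (height_one_minimal M h1 hQ fibre_prime).
  by exists a; [apply: a_in_fibre | apply: a_neq0 M].
exact: prime_a_fibre.
Qed.

End SpecialFibre.

Section VerticalFibre.
Variable c : k.
Hypothesis c0 : c != 0.

Lemma vertical_exists : exists f : {rmorphism C -> {poly k}}, f a = c%:P /\ forall R, f (evab R) = evc c R.
Proof.
pose u : {poly k} := (c^-1)%:P; have cu : c%:P * u = 1 by rewrite -polyCM mulfV.
pose l := u ^+ 2 * ('X ^+ 2 + c%:P).
have R : rels 1 c%:P (u * l ^+ 2) l 'X (u * 'X * l).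
  rewrite {}/l; clearbody u; move: c%:P cu ('X : {poly k}) => d cu x.
  split; rewrite ?expr1.
  - apply: (lincomb (eqM (- (u ^+ 2 * (x ^+ 2 + d)) ^+ 2) cu)); ring.
  - apply: (lincomb (eqM (- (u ^+ 2 * (x ^+ 2 + d) * x)) cu)); ring.
  - ring.
  - apply: (lincomb (eqM (- (x ^+ 2 + d) * (d * u + 1)) cu)); ring.
  - apply: (lincomb (eqM (- (u ^+ 2 * (x ^+ 2 + d)) * (u * x ^+ 2 + d * u + 1)) cu)); ring.
  - apply: (lincomb (eqM (- u * (u ^+ 2 * (x ^+ 2 + d)) ^+ 2 * (u * x ^+ 2 + d * u + 1)) cu)); ring.
have [f [fc [fa _ _ fb _]]] := model_rmorph M (@polyC k) R; exists f; split=> //.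
elim/poly_ind => [|p q IH]; first by rewrite !rmorph0.
rewrite !rmorphD !rmorphM /= ev2X ev2C IH fb evcX evcC; congr (_ + _).
elim/poly_ind: q => [|q e IHq]; first by rewrite !rmorph0 horner0.
by rewrite !rmorphD !rmorphM /= ev1X ev1C /= IHq fa fc hornerMXaddC polyCD polyCM.
Qed.

End VerticalFibre.
End Primes.

Section PrimesAwayFromFibre.

Variables (k : fieldType) (C : comAlgType k) (a z al b be : C).
Hypothesis hk : [pchar k] =i pred0.
Hypothesis kcl : GRing.closed_field_axiom k.
Hypothesis M : model 1 a z al b be.
Local Notation S := {poly {poly k}}.
Local Notation evab := (ev2 (GRing.in_alg C) a b).
Implicit Types Q : {pred C}.

Definition away_generator Q (p : C) : Prop :=
  [/\ p != 0, p \in Q & forall r, r \in Q -> exists N h, a ^+ N * r = p * h].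

Lemma evab_eq0 P : (evab P == 0) = (P == 0).
Proof. by apply/eqP/eqP => [/(ab_indep hk M) //|->]; apply: rmorph0. Qed.

Lemma evab_Xsub c : evab ('X - c%:P)%:P = a - c%:A.
Proof. by rewrite ev2C rmorphB /= ev1X ev1C. Qed.

Section Vertical.
Variables (c : k) (f : {rmorphism C -> {poly k}}).
Hypotheses (c0 : c != 0) (fa : f a = c%:P) (fP : forall R, f (evab R) = evc c R).

Definition vertical_ideal : {pred C} := fun r => f r == 0.

Lemma vertical_prime : prime_ideal vertical_ideal. Proof. exact: ker_prime. Qed.

Lemma vertical_mem r : (r \in vertical_ideal) = (f r == 0). Proof. by []. Qed.

Lemma vertical_in : a - c%:A \in vertical_ideal.
Proof. by rewrite vertical_mem -evab_Xsub fP evcC hornerXsubC subrr. Qed.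

Lemma Xsub_neq0 : a - c%:A != 0.
Proof. by rewrite -evab_Xsub evab_eq0 polyC_eq0 polyXsubC_eq0. Qed.

Lemma vertical_generator : away_generator vertical_ideal (a - c%:A).
Proof.
split; [exact: Xsub_neq0 | exact: vertical_in | move=> r; rewrite vertical_mem => /eqP fr].
have [N [P e]] := localize M r.
have /evc_factor[P' PE] : evc c P = 0 by rewrite -fP -e rmorphM fr mulr0.
by exists N, (evab P'); rewrite e PE rmorphM /= evab_Xsub.
Qed.

Lemma vertical_height : height_eq vertical_ideal 1.
Proof.
pose f0 : {rmorphism C -> k} := horner_eval (0 : k) \o f.
have f0E r : f0 r = (f r).[0] by [].
have fb : f b = 'X by rewrite -[b in LHS](ev2X (GRing.in_alg C) a) fP evcX.
apply: (height_one_of_dim hk kcl M vertical_prime _ (ker_prime f0)).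
- by exists (a - c%:A); [apply: vertical_in | apply: Xsub_neq0].
- by move=> r; rewrite vertical_mem unfold_in f0E => /eqP ->; rewrite horner0.
- exists b; first by rewrite unfold_in f0E fb hornerX.
  by rewrite vertical_mem fb polyX_eq0.
Qed.

End Vertical.

Lemma height_one_neq0 Q : height_eq Q 1 -> exists2 r, r \in Q & r != 0.
Proof.
case=> -[c [hp hs] cQ] _; have [_ [r r1 r0]] := hs 0%N isT.
exists r; first by rewrite -cQ.
by apply: contraNneq r0 => ->; apply: prime0; apply: hp.
Qed.

Lemma away_generator_exists Q : prime_ideal Q -> height_eq Q 1 -> a \notin Q ->
  exists p, away_generator Q p.
Proof.
move=> hQ h1 aQ; have aN r N : a ^+ N * r \in Q -> r \in Q.
  by apply: prime_cancel => //; apply: prime_notinX.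
have [[s [s0 sQ]]|nos] := pselect (exists s : {poly k}, s != 0 /\ evab s%:P \in Q).
  have [c cQ] : exists c, a - c%:A \in Q.
    move: {2}(size s) (leqnn (size s)) => n; elim: n s s0 sQ => [|n IHn] s s0 sQ sn.
      by move: sn; rewrite leqn0 size_poly_eq0 (negPf s0).
    have [s1|s1] := leqP (size s) 1.
      have := sQ; rewrite (size1_polyC s1) ev2C ev1C (negPf (prime_scalar hQ _)) //.
      by rewrite -polyC_eq0 -size1_polyC.
    have [c /factor_theorem[s' sE]] := closed_root kcl s1.
    have s'0 : s' != 0 by apply: contraNneq s0; rewrite sE => ->; rewrite mul0r.
    have := sQ; rewrite sE polyCM rmorphM /= evab_Xsub => /(prime_or hQ)/orP[s'Q|]; last by exists c.
    by apply: (IHn s') => //; move: sn; rewrite sE size_Mmonic ?monicXsubC // size_XsubC addn2.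
  have c0 : c != 0 by apply: contraTneq cQ => ->; rewrite scale0r subr0.
  have [f [fa fP]] := vertical_exists M c0.
  have [p0 pQ gen] := vertical_generator fP.
  have sub : {subset vertical_ideal f <= Q}.
    by move=> r /gen[N [h e]]; apply: (aN _ N); rewrite e mulrC; apply: primeM.
  have e : vertical_ideal f =i Q.
    by apply: (height_one_minimal M h1 hQ (vertical_prime f) _ sub); exists (a - c%:A).
  by exists (a - c%:A); split=> // r; rewrite -e; apply: gen.
have [r rQ r0] := height_one_neq0 h1.
pose has_size n := `[< exists R : S, [/\ R != 0, evab R \in Q & size R = n] >].
have ex : exists n, has_size n.
  have [N [P e]] := localize M r; exists (size P); apply/asboolP; exists P; split=> //.
    by rewrite -evab_eq0 -e (model_integral M) negb_or r0 (model_expf_neq0 M) ?(a_neq0 M).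
  by rewrite -e; apply: primeM.
case: (ex_minnP ex) => n /asboolP[R [R0 RQ sR]] minn.
have [q [p [q0 prim RE]]] := primitive_part R0.
have p0 : p != 0 by apply: contraNneq R0; rewrite RE => ->; rewrite mulr0.
have sp : size p = n by rewrite -sR RE mul_polyC size_scale.
have pQ : evab p \in Q.
  apply: (prime_cancel hQ (r := evab q%:P)); last by rewrite -rmorphM -RE.
  by apply/negP => qQ; apply: nos; exists q.
exists (evab p); split=> //; first by rewrite evab_eq0.
move=> g gQ; have [N [P e]] := localize M g.
have := Pdiv.Idomain.divp_eq P p; set D := (P %/ p); set rem := (P %% p) => eD.
have rem0 : rem = 0.
  apply/eqP; apply: contraT => rem0.
  have remQ : evab rem \in Q.
    have -> : evab rem = evab (lead_coef p ^+ scalp P p)%:P * (a ^+ N * g) - evab D * evab p.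
      rewrite e -!rmorphM -rmorphB mul_polyC eD; congr (ev2 _ _ _ _).
      by rewrite addrAC subrr add0r.
    by apply: primeB => //; apply: primeM => //; apply: primeM.
  have := minn (size rem); have lt : (size rem < size p)%N by rewrite ltn_modp.
  by rewrite leqNgt -sp lt; apply; apply/asboolP; exists rem.
have e2 : (lead_coef p ^+ scalp P p)%:P * P = D * p by rewrite mul_polyC eD rem0 addr0.
have [|q' PE] := gauss_cancel kcl _ prim e2; first by rewrite expf_neq0 ?lead_coef_eq0.
by exists N, (evab q'); rewrite e PE rmorphM mulrC.
Qed.

Section Horizontal.
Variable p : S.
Hypotheses (irr : irreducible_poly p) (prim : primitive p).

Definition horizontal_ideal : {pred C} := fun r => `[< exists N h, a ^+ N * r = evab p * h >].

Let p0 : p != 0.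
Proof. by rewrite -size_poly_gt0; case: irr => s1 _; apply: leq_trans s1. Qed.

Lemma primitive_dvdp P : p %| P -> exists P', P = P' * p.
Proof.
case/Pdiv.Idomain.dvdpP=> -[c P'] /= c0 e.
by apply: (gauss_cancel kcl c0 prim (q := P')); rewrite mul_polyC e.
Qed.

Lemma horizontalP r N P : a ^+ N * r = evab P -> reflect (exists P', P = P' * p) (r \in horizontal_ideal).
Proof.
move=> e; apply: (iffP (asboolP _)) => [[N' [h e']]|[P' PE]]; last first.
  by exists N, (evab P'); rewrite e PE rmorphM mulrC.
have [N2 [H eH]] := localize M h.
have : ('X^(N2 + N'))%:P * P = ('X^N)%:P * H * p.
  apply: (evab_inj hk M); rewrite !rmorphM /= !evab_XnC -e -eH exprD.
  transitivity (a ^+ N2 * a ^+ N * (a ^+ N' * r)); first by ring.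
  rewrite e'; ring.
by apply: gauss_cancel => //; rewrite monic_neq0 ?monicXn.
Qed.

Lemma horizontal_in : evab p \in horizontal_ideal.
Proof. by apply/asboolP; exists 0%N, 1; rewrite mulr1 mul1r. Qed.

Lemma horizontal_notin q : q != 0 -> evab q%:P \notin horizontal_ideal.
Proof.
move=> q0; apply/(horizontalP (N := 0) (P := q%:P)); first by rewrite mul1r.
case=> P' e; have P'0 : P' != 0.
  by apply: contraNneq q0 => P'0; move/eqP: e; rewrite P'0 mul0r polyC_eq0.
have [s1 _] := irr; have e1 : size (P' * p) = 1%N by rewrite -e size_polyC q0.
rewrite size_mul // in e1; move: P'0; rewrite -size_poly_gt0 => sP.
by move: s1 sP e1; case: (size P') => //= l; lia.
Qed.

Lemma horizontal_prime : prime_ideal horizontal_ideal.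
Proof.
split.
  split.
  - by apply/asboolP; exists 0%N, 0; rewrite !mulr0.
  - by rewrite -(rmorph1 evab) -polyC1 horizontal_notin ?oner_eq0.
  - move=> u v w /asboolP[N [h e]] /asboolP[N' [h' e']]; apply/asboolP.
    exists (N + N')%N, (a ^+ N' * u * h + a ^+ N * h'); rewrite exprD.
    transitivity (a ^+ N' * u * (a ^+ N * v) + a ^+ N * (a ^+ N' * w)); first by ring.
    by rewrite e e'; ring.
move=> u v; have [N [P e]] := localize M u; have [N' [P' e']] := localize M v.
have e2 : a ^+ (N + N') * (u * v) = evab (P * P').
  by rewrite rmorphM /= -e -e' exprD; ring.
move/(horizontalP e2) => [H eH].
have := irreducible_euclid irr (P := P) (Q := P').
rewrite eH dvdp_mull // => /(_ isT)/orP[] /primitive_dvdp h; apply/orP; [left|right].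
  exact/(horizontalP e).
exact/(horizontalP e').
Qed.

Lemma horizontal_height : height_eq horizontal_ideal 1.
Proof.
have l0 : lead_coef p != 0 by rewrite lead_coef_eq0.
have [|a0 ra] := closed_root kcl (p := 'X * lead_coef p - 1).
  have s1 : (1 < size ('X * lead_coef p)%R)%N.
    by rewrite mulrC size_mulX // ltnS size_poly_gt0.
  by rewrite size_polyDl // size_polyN size_poly1.
have e1 : a0 * (lead_coef p).[a0] = 1.
  by apply/eqP; rewrite -subr_eq0; move: ra; rewrite /root !hornerE.
have a00 : a0 != 0 by apply: contra_eq_neq e1 => ->; rewrite mul0r eq_sym oner_eq0.
have l1 : (lead_coef p).[a0] != 0.
  by apply: contra_eq_neq e1 => ->; rewrite mulr0 eq_sym oner_eq0.
have [f [fa fP]] := vertical_exists M a00.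
have [|b0 rb] := closed_root kcl (p := evc a0 p).
  rewrite /evc size_poly_eq //; first by case: irr.
have [g gE] : exists g : {rmorphism C -> k}, forall r, g r = (f r).[b0].
  by exists (horner_eval b0 \o f).
apply: (height_one_of_dim hk kcl M horizontal_prime _ (ker_prime g)).
- by exists (evab p); [apply: horizontal_in | rewrite evab_eq0].
- move=> r /asboolP[N [h e]]; have := congr1 g e; rewrite unfold_in !gE !(rmorphM f) rmorphXn fa fP.
  by rewrite !hornerM (rootP rb) mul0r => /eqP; rewrite mulf_eq0 horner_exp hornerC expf_eq0 (negPf a00) andbF.
- exists (a - a0%:A).
    by rewrite unfold_in gE -evab_Xsub fP evcC hornerXsubC subrr horner0.
  by rewrite -evab_Xsub horizontal_notin ?polyXsubC_eq0.
Qed.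

End Horizontal.

Lemma irreducible_primitive (R : S) : (1 < size R)%N ->
  exists p, [/\ irreducible_poly p, primitive p & p %| R].
Proof.
move=> s1; have [p0 irr pR] := irreducible_divisor s1.
have n0 : p0 != 0 by apply: contraTneq pR => ->; rewrite dvd0p -size_poly_eq0; case: (size R) s1.
have [q [p [q0 prim e]]] := primitive_part n0.
have pp : p0 %= p by rewrite e mul_polyC eqp_scale.
exists p; split=> //; last by rewrite -(eqp_dvdl _ pp).
case: irr => s0 h; split; first by rewrite -(eqp_size pp).
move=> t t1; rewrite -(eqp_dvdr _ pp) => /(h _ t1) tp.
exact: eqp_trans tp pp.
Qed.

Lemma only_fibre r : r != 0 ->
  (forall Q, prime_ideal Q -> height_eq Q 1 -> r \in Q -> a \in Q) ->
  exists N n c, c != 0 /\ a ^+ N * r = c%:A * a ^+ n.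
Proof.
move=> r0 hr; have [N [R e]] := localize M r.
have R0 : R != 0.
  by rewrite -evab_eq0 -e (model_integral M) negb_or r0 (model_expf_neq0 M) ?(a_neq0 M).
have [s1|s1] := leqP (size R) 1; last first.
  have [p [irr prim pR]] := irreducible_primitive s1.
  have hp := horizontal_prime irr prim.
  have := hr _ hp (horizontal_height irr prim).
  have aP : a \notin horizontal_ideal p.
    by have := horizontal_notin irr prim (negbT (polyX_eq0 k)); rewrite ev2C ev1X.
  rewrite (negPf aP).
  have [P' RE] := primitive_dvdp prim pR.
  by case/(_ _)/notF; apply/(horizontalP prim e); exists P'.
have RE := size1_polyC s1.
have q0 : R`_0 != 0 by rewrite -polyC_eq0 -RE.
have [|n [c [c0 qE]]] := only_root0 kcl q0.
  move=> c rc; apply/eqP; apply: contraT => c0.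
  have [f [fa fP]] := vertical_exists M c0.
  have := hr _ (vertical_prime f) (vertical_height fP).
  rewrite !vertical_mem fa polyC_eq0 (negPf c0); case/(_ _)/notF.
  have := congr1 f e; rewrite RE fP evcC (rootP rc) rmorphM rmorphXn fa => /eqP.
  by rewrite mulf_eq0 expf_eq0 polyC_eq0 (negPf c0) andbF.
exists N, n, c; split=> //; rewrite e RE qE -mul_polyC ev2C rmorphM /= ev1C.
by rewrite rmorphXn /= ev1X.
Qed.

End PrimesAwayFromFibre.

(** * The divisor class group *)

Section OrderAtPrime.

Variables (k : fieldType) (C : comAlgType k).
Hypothesis integral : forall r s : C, (r * s == 0) = (r == 0) || (s == 0).

Let mulfI0 (r s t : C) : r != 0 -> r * s = r * t -> s = t.
Proof.
move=> /negPf r0 /eqP; rewrite -subr_eq0 -mulrBr integral r0 /=.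
by rewrite subr_eq0 => /eqP.
Qed.

Definition uniformizer (Q : {pred C}) (t : C) : Prop :=
  [/\ t != 0, t \in Q & forall r, r \in Q -> exists s h, s \notin Q /\ s * r = t * h].

Definition order (Q : {pred C}) (t r : C) (n : nat) : Prop :=
  exists s h, [/\ s \notin Q, h \notin Q & s * r = t ^+ n * h].

Section AtPrime.
Variables (Q : {pred C}) (t : C).
Hypotheses (hQ : prime_ideal Q) (ht : uniformizer Q t).

Let t0 n : t ^+ n != 0.
Proof.
have [t0 _ _] := ht; elim: n => [|n IHn]; first by rewrite expr0 oner_eq0.
by rewrite exprS integral negb_or t0.
Qed.

Lemma order_notin r : r \notin Q -> order Q t r 0.
Proof. by move=> rQ; exists 1, r; split; rewrite ?expr0 //; apply: prime1. Qed.

Lemma order_self : order Q t t 1.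
Proof. by exists 1, 1; split; rewrite ?expr1 ?mul1r ?mulr1 //; apply: prime1. Qed.

Lemma orderM r r' n n' : order Q t r n -> order Q t r' n' -> order Q t (r * r') (n + n').
Proof.
move=> [s [h [sQ hQ' e]]] [s' [h' [sQ' hQ'' e']]]; exists (s * s'), (h * h').
split; rewrite ?prime_notinM // exprD.
transitivity ((s * r) * (s' * r')); first by ring.
by rewrite e e'; ring.
Qed.

Lemma order_divl r r' n n' : order Q t (r * r') n -> order Q t r n' ->
  (n' <= n)%N /\ order Q t r' (n - n').
Proof.
move=> [s [h [sQ hQ' e]]] [s' [h' [sQ' hQ'' e']]].
have e2 : t ^+ n' * (s * h' * r') = t ^+ n * (s' * h).
  transitivity (s * r' * (t ^+ n' * h')); first by ring.
  rewrite -e'; transitivity (s' * (s * (r * r'))); first by ring.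
  by rewrite e; ring.
have [le|lt] := leqP n' n.
  split=> //; exists (s * h'), (s' * h); split; rewrite ?prime_notinM //.
  by apply: (mulfI0 (t0 n')); rewrite e2 [RHS]mulrA -exprD (subnKC le).
exfalso; have : s' * h \in Q.
  have -> : s' * h = t ^+ (n' - n) * (s * h' * r').
    by apply: (mulfI0 (t0 n)); rewrite -e2 [RHS]mulrA -exprD (subnKC (ltnW lt)).
  rewrite -subn_gt0 in lt; rewrite -(prednK lt) mulrC exprSr mulrA.
  by case: ht => _ tQ _; apply: primeM.
by apply/negP; rewrite prime_notinM.
Qed.

Lemma order_uniq r n n' : order Q t r n -> order Q t r n' -> n = n'.
Proof.
move=> h h'; have le m m' : order Q t r m -> order Q t r m' -> (m' <= m)%N.
  by rewrite -{1}[r]mulr1 => hm /(order_divl hm)[].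
by apply/eqP; rewrite eqn_leq !le.
Qed.

Lemma uniformizer_ideal_pow n r : ideal_pow Q n r ->
  exists s h, s \notin Q /\ s * r = t ^+ n * h.
Proof.
have prodE m (x : 'I_m -> C) : (forall j, x j \in Q) ->
    exists s h, s \notin Q /\ s * \prod_j x j = t ^+ m * h.
  elim: m x => [|m IHm] x hx.
    by exists 1, 1; rewrite big_ord0 !mulr1; split=> //; apply: prime1.
  have [s [h [sQ e]]] := IHm _ (fun j => hx (fintype.lift ord0 j)).
  have [_ _ /(_ _ (hx ord0))[s' [h' [sQ' e']]]] := ht.
  exists (s' * s), (h' * h); rewrite prime_notinM // big_ord_recl exprS; split=> //.
  transitivity ((s' * x ord0) * (s * \prod_j x (fintype.lift ord0 j))); first by ring.
  by rewrite e e'; ring.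
case=> m [c [x [hx ->]]]; elim: m c x hx => [|m IHm] c x hx.
  by exists 1, 0; rewrite big_ord0 !mulr0; split=> //; apply: prime1.
have [s [h [sQ e]]] := IHm (fun i => c (fintype.lift ord0 i)) _ (fun i => hx (fintype.lift ord0 i)).
have [s' [h' [sQ' e']]] := prodE _ _ (hx ord0).
exists (s' * s), (c ord0 * s * h' + s' * h); rewrite prime_notinM // big_ord_recl; split=> //.
transitivity (c ord0 * s * (s' * \prod_j x ord0 j)
   + s' * (s * \sum_i c (fintype.lift ord0 i) * \prod_j x (fintype.lift ord0 i) j)); first by ring.
by rewrite e e'; ring.
Qed.

Lemma local_ideal_powP n r : local_ideal_pow Q n r <->
  exists s h, s \notin Q /\ s * r = t ^+ n * h.
Proof.
split=> [[s sQ /uniformizer_ideal_pow[s' [h [sQ' e]]]]|[s [h [sQ e]]]].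
  by exists (s' * s), h; rewrite prime_notinM // -mulrA.
exists s => //; exists 1%N, (fun=> h), (fun _ _ => t); split; first by case: ht.
by rewrite big_ord1 prodr_const card_ord e mulrC.
Qed.

Lemma ord_atP r n : ord_at Q r n <-> order Q t r n.
Proof.
split=> [[/local_ideal_powP[s [h [sQ e]]] nh]|[s [h [sQ hQ' e]]]].
  exists s, h; split=> //; apply/negP => hQ'; apply: nh; apply/local_ideal_powP.
  have [_ _ /(_ _ hQ')[s' [h' [sQ' e']]]] := ht.
  exists (s' * s), h'; rewrite prime_notinM //; split=> //.
  by rewrite -mulrA e mulrCA e' exprSr mulrA.
split; first by apply/local_ideal_powP; exists s, h.
case/local_ideal_powP=> s' [h' [sQ' e']].
have : s' * h \in Q.
  have -> : s' * h = s * h' * t.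
    apply: (mulfI0 (t0 n)); transitivity (s * (t ^+ n.+1 * h')); last by rewrite exprS; ring.
    by rewrite -e' mulrCA -e; ring.
  by case: ht => _ tQ _; apply: primeM.
by apply/negP; rewrite prime_notinM.
Qed.

End AtPrime.

Section Divisors.
Hypothesis has_uniformizer : forall P : prime_divisor C, exists t, uniformizer (val P) t.

Lemma prime_divisorP (P : prime_divisor C) : prime_ideal (val P) /\ height_eq (val P) 1.
Proof. exact: (asboolW (valP P)). Qed.

Lemma div_eqM r r' (E E' : Div C) : div_eq r E -> div_eq r' E' -> div_eq (r * r') (E + E').
Proof.
move=> h h' P; have [hP _] := prime_divisorP P; have [t ht] := has_uniformizer P.
have [n /(ord_atP hP ht) o e] := h P; have [n' /(ord_atP hP ht) o' e'] := h' P.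
exists (n + n')%N; last by rewrite coeffD e e' PoszD.
by apply/(ord_atP hP ht); apply: orderM.
Qed.

Lemma div_eq_divl r r' (E E' : Div C) : div_eq (r * r') E -> div_eq r E' -> div_eq r' (E - E').
Proof.
move=> h h' P; have [hP _] := prime_divisorP P; have [t ht] := has_uniformizer P.
have [n /(ord_atP hP ht) o e] := h P; have [n' /(ord_atP hP ht) o' e'] := h' P.
have [le o2] := order_divl hP ht o o'.
exists (n - n')%N; first exact/(ord_atP hP ht).
by rewrite coeffB e e' subzn.
Qed.

Lemma div_eq_uniq r (E E' : Div C) : div_eq r E -> div_eq r E' -> E = E'.
Proof.
move=> h h'; apply/eqP/freeg_eqP => P.
have [hP _] := prime_divisorP P; have [t ht] := has_uniformizer P.
have [n /(ord_atP hP ht) o ->] := h P; have [n' /(ord_atP hP ht) o' ->] := h' P.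
by rewrite (order_uniq hP ht o o').
Qed.

Lemma div_eq_unit r : (forall P : prime_divisor C, r \notin val P) -> div_eq r (0 : Div C).
Proof.
move=> hr P; have [hP _] := prime_divisorP P; have [t ht] := has_uniformizer P.
by exists 0%N; [apply/(ord_atP hP ht); apply: order_notin | rewrite coeff0].
Qed.

Lemma div_eqX r (E : Div C) n : div_eq r E -> div_eq (r ^+ n) (E *+ n).
Proof.
move=> h; elim: n => [|n IHn]; last by rewrite exprS mulrS; apply: div_eqM.
rewrite expr0 mulr0n; apply: div_eq_unit => P.
by have [hP _] := prime_divisorP P; apply: prime1.
Qed.

End Divisors.
End OrderAtPrime.

Section ClassGroup.

Variables (k : fieldType) (C : comAlgType k) (a z al b be : C).
Hypothesis hk : [pchar k] =i pred0.
Hypothesis kcl : GRing.closed_field_axiom k.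
Hypothesis M : model 1 a z al b be.
Local Notation S := {poly {poly k}}.

Let mulfI0 (r s t : C) : r != 0 -> r * s = r * t -> s = t.
Proof. by move=> r0; apply: (model_mulfI M r0). Qed.

Let integral (r s : C) : (r * s == 0) = (r == 0) || (s == 0).
Proof. exact: (model_integral M). Qed.

Section WithChart.
Variables (i : k) (psi : {rmorphism C -> S}).
Hypotheses (ii : i ^+ 2 = -1) (ch : is_chart a z al b be i psi).

Local Notation F := (fibre_ideal psi).

Fact fibre_height_one : height_one F.
Proof.
by apply/asboolP; split; [apply: fibre_prime | apply: (fibre_height hk kcl M ii ch)].
Qed.

Definition P0 : prime_divisor C := exist _ F fibre_height_one.

Lemma neq_P0 (P : prime_divisor C) : P != P0 -> a \notin val P.
Proof.
apply: contraNN => aP; apply/eqP/val_inj/funext => r.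
have [hP h1] := prime_divisorP P; symmetry; exact: (height_one_a M ii ch hP h1 aP r).
Qed.

Lemma b_squared : b ^+ 2 = a * (a * al - 1).
Proof. by have := rel_bb (model_rels M); rewrite expr1. Qed.

Lemma unit_at_fibre : a * al - 1 \notin F.
Proof.
have hF := fibre_prime psi; apply/negP => h.
have : 1 \in F.
  rewrite -[1](subKr (a * al)); apply: primeB => //.
  by rewrite mulrC; apply: primeM; rewrite // (a_in_fibre ch).
by apply/negP/prime1.
Qed.

Lemma b_neq0 : b != 0.
Proof.
apply/eqP => b0; move: b_squared; rewrite b0 expr0n /= => /esym/eqP.
rewrite integral (negPf (a_neq0 M)) /= => /eqP e.
by have := unit_at_fibre; rewrite e prime0 //; apply: fibre_prime.
Qed.

Lemma b_uniformizer : uniformizer F b.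
Proof.
split; [exact: b_neq0 | by rewrite unfold_in (chart_at0_b ch) | move=> r rF].
have [v e] := fibre_dvd rF; have [_ [_ _ _ pb _]] := ch.
have [|r' e'] := chart_div M ii ch (r := r * b) (Q := v * yS i).
  by rewrite rmorphM e pb /xS; ring.
exists (a * al - 1), r'; split; first exact: unit_at_fibre.
apply: (mulfI0 (a_neq0 M)); rewrite mulrA -b_squared; transitivity (b * (r * b)); first by ring.
by rewrite e'; ring.
Qed.

Lemma order_fibre_exists r : r != 0 -> exists n, order F b r n.
Proof.
move=> r0; have p0 : psi r != 0 by rewrite -(rmorph0 psi) (inj_eq (chart_inj M ii ch)).
have [n [q [q0 e]]] : exists n q, q.[0] != 0 /\ psi r = 'X^n * q.
  have [n [q nr e]] := multiplicity_XsubC (psi r) 0.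
  by exists n, q; rewrite p0 /= in nr; rewrite e subr0 mulrC.
have [_ [pa _ _ pb _]] := ch.
have [r' e'] : exists r', r * b ^+ n = a ^+ n * r'.
  have : psi (r * b ^+ n) = ('X ^+ 2) ^+ n * (q * yS i ^+ n).
    by rewrite rmorphM rmorphXn e pb /xS -exprM mulnC exprM exprMn; ring.
  move: (q * _) (r * _); elim: (n) => [|m IHm] q' t e1; first by exists t; rewrite mul1r.
  have [|t' e2] := chart_div M ii ch (r := t) (Q := ('X ^+ 2) ^+ m * q').
    by rewrite e1 exprS mulrA.
  have [|r' e3] := IHm q' t'; last by exists r'; rewrite e2 e3 exprS mulrA.
  apply: (mulfI (x := 'X ^+ 2)); first by rewrite expf_neq0 ?polyX_eq0.
  by rewrite mulrA -exprS -e1 e2 rmorphM pa.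
have hF := fibre_prime psi; exists n, ((a * al - 1) ^+ n), r'; split.
- by apply: prime_notinX; first exact: hF; apply: unit_at_fibre.
- rewrite unfold_in chart_at0E.
  have -> : psi r' = q * yS i ^+ n.
    apply: (mulfI (x := ('X ^+ 2) ^+ n)); first by rewrite !expf_neq0 ?polyX_eq0.
    have := congr1 psi e'; rewrite !(rmorphM psi) !rmorphXn pa /= => <-.
    by rewrite e pb /xS exprMn -exprM mulnC exprM; ring.
  rewrite hornerM horner_exp mulf_neq0 ?expf_neq0 //.
  by rewrite (yS_at0 i) polyC_eq0 (sqrtN1_neq0 ii).
- have an : a ^+ n != 0 := model_expf_neq0 M _ (a_neq0 M).
  apply: (mulfI0 an); rewrite mulrA -exprMn -b_squared -exprM mulnC exprM.
  by rewrite -mulrA [b ^+ n * r]mulrC e'; ring.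
Qed.

Lemma away_uniformizer (P : prime_divisor C) p : P != P0 -> away_generator a (val P) p ->
  uniformizer (val P) p.
Proof.
move=> /neq_P0 aP [p0 pP gen]; split=> // r /gen[N [h e]]; exists (a ^+ N), h; split=> //.
by have [hP _] := prime_divisorP P; apply: prime_notinX.
Qed.

Lemma weights : exists (gen : prime_divisor C -> C) (v : prime_divisor C -> nat),
  forall P, P != P0 -> away_generator a (val P) (gen P) /\ order F b (gen P) (v P).
Proof.
have h P : exists pn : C * nat, P != P0 -> away_generator a (val P) pn.1 /\ order F b pn.1 pn.2.
  have [->|nP] := eqVneq P P0; first by exists (0, 0%N).
  have [hP h1] := prime_divisorP P.
  have [p gen] := away_generator_exists hk kcl M hP h1 (neq_P0 nP).
  have [p0 _ _] := gen; have [n o] := order_fibre_exists p0.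
  by exists (p, n).
have [f hf] := choice h.
by exists (fun P => (f P).1), (fun P => (f P).2).
Qed.

Section WithWeights.
Variables (gen : prime_divisor C -> C) (v : prime_divisor C -> nat).
Hypothesis weightP : forall P, P != P0 -> away_generator a (val P) (gen P) /\ order F b (gen P) (v P).

Lemma has_uniformizer (P : prime_divisor C) : exists t, uniformizer (val P) t.
Proof.
have [->|nP] := eqVneq P P0; first by exists b; apply: b_uniformizer.
by exists (gen P); apply: away_uniformizer => //; have [] := weightP nP.
Qed.

Lemma div_a : div_eq a (<< 2 *g P0 >> : Div C).
Proof.
move=> P; have [hP _] := prime_divisorP P; have [t ht] := has_uniformizer P.
have [e|nP] := eqVneq P P0; last first.
  exists 0%N; first by apply/(ord_atP integral hP ht); apply: order_notin => //; apply: neq_P0.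
  by rewrite coeffU eq_sym (negPf nP) mulr0.
exists 2; last by rewrite coeffU e eqxx mulr1.
rewrite e; apply/(ord_atP integral (fibre_prime psi) b_uniformizer).
exists (a * al - 1), 1; split; [exact: unit_at_fibre | exact: prime1 (fibre_prime psi) |].
by rewrite b_squared; ring.
Qed.

Lemma div_gen (P : prime_divisor C) : P != P0 ->
  div_eq (gen P) (<< P >> + << (v P)%:Z *g P0 >> : Div C).
Proof.
move=> nP Q; have [g o] := weightP nP; have [hP h1] := prime_divisorP P.
have [hQ h1Q] := prime_divisorP Q; have uP := away_uniformizer nP g.
have [e|nQ] := eqVneq Q P0.
  exists (v P); first by rewrite e; apply/(ord_atP integral (fibre_prime psi) b_uniformizer).
  by rewrite coeffD !coeffU e (negPf nP) eqxx mulr0 mulr1 add0r.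
have [e|nQP] := eqVneq Q P.
  exists 1%N; first by rewrite e; apply/(ord_atP integral hP uP); apply: order_self.
  by rewrite coeffD !coeffU e eqxx eq_sym (negPf nP) mulr0 mulr1 addr0.
have [t ht] := has_uniformizer Q; have [p0 pP gP] := g.
exists 0%N; last by rewrite coeffD !coeffU ![_ == Q]eq_sym (negPf nQ) (negPf nQP) !mulr0.
apply/(ord_atP integral hQ ht); apply: order_notin => //; apply: contra nQP => pQ.
have sub : {subset val P <= val Q}.
  move=> r /gP[N [h e]]; apply: (prime_cancel hQ (prime_notinX hQ N (neq_P0 nQ))).
  by rewrite e mulrC; apply: primeM.
have e : val P =i val Q by apply: (height_one_minimal M h1Q hQ hP _ sub); exists (gen P).
by apply/eqP/val_inj/funext => r; symmetry; apply: e.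
Qed.

Definition weight (P : prime_divisor C) : int^o := if P == P0 then 1 else - (v P)%:Z.

Definition theta : Div C -> int^o := fglift weight.

Lemma theta_is_additive : zmod_morphism theta.
Proof. exact: lift_is_additive. Qed.
HB.instance Definition _ := GRing.isZmodMorphism.Build (Div C) int^o theta theta_is_additive.

Lemma theta_U (c : int) (P : prime_divisor C) : theta << c *g P >> = c * weight P.
Proof. exact: liftU. Qed.

Lemma deg_ge0 (E : Div C) : (forall P, (0 <= coeff P E)%R) -> (0 <= deg E)%R.
Proof.
move=> h; rewrite -[E]freeg_sumE raddf_sum; apply: Num.Theory.sumr_ge0 => P _.
by rewrite /= degU.
Qed.

Lemma div_eq_deg r (E : Div C) : div_eq r E -> (coeff P0 E <= deg E)%R.
Proof.
move=> h; have : (0 <= deg (E - << coeff P0 E *g P0 >> : Div C))%R.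
  apply: deg_ge0 => P; rewrite coeffB coeffU; have [n _ e] := h P.
  by have [->|_] := eqVneq; rewrite ?mulr1 ?subrr // mulr0 subr0 e.
by rewrite degB degU; lia.
Qed.

Definition is_even (x : int) : Prop := exists y, x = y * 2.

Lemma div_eq_reduce r (E : Div C) P : r != 0 -> div_eq r E -> P != P0 -> coeff P E != 0 ->
  exists N h, h != 0 /\
    div_eq h (<< 2 *g P0 >> *+ N + E - (<< P >> + << (v P)%:Z *g P0 >>) : Div C).
Proof.
move=> r0 hE nP cP; have [[p0 pP gP] _] := weightP nP.
have [hP _] := prime_divisorP P; have [t ht] := has_uniformizer P.
have rP : r \in val P.
  apply: contraT => rP; move: cP; have [n /(ord_atP integral hP ht) o ->] := hE P.
  by rewrite (order_uniq integral hP ht o (order_notin _ hP rP)).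
have [N [h e]] := gP _ rP; exists N, h; split.
  have : a ^+ N * r != 0 by rewrite integral negb_or r0 (model_expf_neq0 M) ?(a_neq0 M).
  by rewrite e integral negb_or => /andP[].
apply: (div_eq_divl integral has_uniformizer (r := gen P)); last exact: div_gen.
rewrite -e; apply: (div_eqM integral has_uniformizer) => //.
exact: (div_eqX integral has_uniformizer _ div_a).
Qed.

Lemma theta_P0 c : theta << c *g P0 >> = c.
Proof. by rewrite theta_U /weight eqxx mulr1. Qed.

Lemma theta_div_base r (E : Div C) : r != 0 -> div_eq r E ->
  (forall P, P != P0 -> coeff P E = 0) -> is_even (theta E).
Proof.
move=> r0 hE cE.
have [Q hQ h1 rQ|N [n [c [c0 e]]]] := only_fibre hk kcl M r0.
  have hQ1 : height_one Q by apply/asboolP.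
  pose P : prime_divisor C := exist _ (Q : C -> bool) hQ1.
  have [t ht] := has_uniformizer P.
  apply: contraT => aQ; have nP : P != P0.
    by apply: contraNneq aQ => /(congr1 val) /= QF; move: (a_in_fibre ch); rewrite -QF.
  have [m /(ord_atP integral hQ ht) o em] := hE P.
  have m0 : m = 0%N by move: em; rewrite cE // => -[].
  move: o; rewrite m0 => -[s [h [sQ hQ' es]]]; move: hQ'.
  by rewrite -[h]mul1r -(expr0 t) -es primeM.
have hM := div_eqM integral has_uniformizer.
have hX n' := div_eqX integral has_uniformizer n' div_a.
have h1 := hM _ _ _ _ (hX N) hE.
have hc : div_eq c%:A (0 : Div C).
  apply: (div_eq_unit integral has_uniformizer) => P.
  by have [hP _] := prime_divisorP P; apply: prime_scalar.
have h2 := hM _ _ _ _ hc (hX n); rewrite -e in h2.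
have := congr1 theta (div_eq_uniq integral has_uniformizer h1 h2).
rewrite !raddfD raddf0 /= !raddfMn /= theta_P0 => e3.
by exists (n%:Z - N%:Z); move: e3; lia.
Qed.

Lemma theta_div_even r (E : Div C) : r != 0 -> div_eq r E -> is_even (theta E).
Proof.
suff h n : forall r (E : Div C), r != 0 -> div_eq r E ->
    (deg E < coeff P0 E + n%:Z)%R -> is_even (theta E).
  move=> r0 hE; apply: (h (`|deg E - coeff P0 E|.+1)%N r E) => //; lia.
elim: n => [|n IHn] {}r {}E r0 hE le; first by have := div_eq_deg hE; lia.
have [[P [nP cP]]|none] := pselect (exists P, P != P0 /\ coeff P E != 0); last first.
  apply: (theta_div_base r0 hE) => P nP; apply/eqP; apply: contraT => cP.
  by case: none; exists P.
have [N [h [h0 hd]]] := div_eq_reduce r0 hE nP cP; move: hd.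
set E1 : Div C := (X in div_eq h X) => hd.
have e1 : deg E1 = coeff P0 E1 + deg E - coeff P0 E - 1.
  rewrite /E1 degB !degD degMn !degU coeffB !coeffD coeffMn !coeffU eqxx (negPf nP); lia.
have [|y e2] := IHn h E1 h0 hd; first by lia.
exists (y - N%:Z).
have : theta E1 = 2 *+ N + theta E.
  rewrite /E1 raddfB !raddfD raddfMn /= !theta_P0 theta_U /weight (negPf nP); lia.
by rewrite e2; lia.
Qed.

Lemma principal_of_div r (E : Div C) : r != 0 -> div_eq r E -> E \in principal_div (B := C).
Proof. by move=> r0 h; apply/asboolP => T _ hT; apply: (hT r E). Qed.

Lemma theta_class (E : Div C) : E - << theta E *g P0 >> \in principal_div (B := C).
Proof.
rewrite -[E]freeg_sumE; elim/big_rec: _ => [|P E' _ IH].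
  by rewrite raddf0 freegU0 subr0; case: (principal_div_closed C).
have h : << coeff P E *g P >> - << theta << coeff P E *g P >> *g P0 >> \in principal_div (B := C).
  rewrite theta_U /weight; case: eqVneq => [->|nP].
    by rewrite mulr1 subrr; case: (principal_div_closed C).
  have [[p0 _ _] _] := weightP nP.
  have := rpredMz (coeff P E) (principal_of_div p0 (div_gen nP)).
  by rewrite mulrzDl !freeg_mulz mulrN -freegUN opprK -[(v P)%:Z *~ _]mulrzr !intz [(v P)%:Z * _]mulrC.
rewrite raddfD /= -freegUD opprD addrACA.
exact: rpredD h IH.
Qed.

Lemma int_Z2 (x : int) : x%:~R = 0 :> 'Z_2 <-> is_even x.
Proof.
have e2 : 2%:~R = 0 :> 'Z_2 by apply: val_inj.
split=> [|[y ->]]; last by rewrite intrM e2 mulr0.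
have [y [->|->]] : exists y, x = y * 2 \/ x = y * 2 + 1.
  exists (x %/ 2)%Z; lia.
  by exists y.
by rewrite intrD intrM e2 mulr0 add0r.
Qed.

Lemma principal_theta (E : Div C) :
  (E \in principal_div (B := C)) = ((theta E)%:~R == 0 :> 'Z_2).
Proof.
apply/idP/eqP => [/asboolP h|/int_Z2[y e]].
  pose T : {pred Div C} := fun E => (theta E)%:~R == 0 :> 'Z_2.
  apply/eqP; apply: (h T).
    by split=> [|E1 E2]; rewrite !unfold_in ?raddf0 // raddfB /= intrB => /eqP -> /eqP ->.
  by move=> r E' r0 /(theta_div_even r0)/int_Z2/eqP.
rewrite -[E](subrK << theta E *g P0 >>); apply: rpredD; first exact: theta_class.
rewrite e mulrC -[y in 2 * y]intz mulrzr -freeg_mulz; apply: rpredMz.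
exact: principal_of_div (a_neq0 M) div_a.
Qed.

Definition theta_Cl (x : Cl C) : 'Z_2 := (theta (repr x))%:~R.

Lemma theta_Cl_pi (E : Div C) : theta_Cl (\pi_(Cl C)%qT E) = (theta E)%:~R.
Proof.
apply/eqP; rewrite -subr_eq0 -intrB -raddfB -principal_theta.
by rewrite Quotient.idealrBE reprK.
Qed.

Lemma class_group_Z2 : group_isomorphic (Cl C) 'Z_2.
Proof.
exists theta_Cl.
  move=> x y; rewrite -[x]reprK -[y]reprK -raddfD !theta_Cl_pi raddfD /=.
  exact: intrD.
exists (fun n => \pi_(Cl C)%qT << (nat_of_ord n)%:Z *g P0 >>) => [x|n].
  rewrite -[x in RHS]reprK; apply/eqP; rewrite -Quotient.idealrBE principal_theta.
  rewrite raddfB /= theta_P0 intrB subr_eq0.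
  by rewrite -pmulrn natr_Zp.
by rewrite theta_Cl_pi theta_P0 -[RHS]natr_Zp pmulrn.
Qed.

End WithWeights.
End WithChart.
End ClassGroup.

Theorem theorem1p4 (k : fieldType) (hk : [pchar k] =i pred0) :
  [/\ kisomorphic (kprod (Spec (ringR k)) (A1 k)) (kprod (Spec (ringRt k)) (A1 k)),
      ~ kisomorphic (Spec (ringR k)) (Spec (ringRt k)),
      exists (phi : kaut_action (Gm k) (Ga k))
             (rho : kaction (sdprod phi) (Spec (ringRt k))),
        [/\ ~ aut_trivial phi, effective rho & fixed_point_free (act_normal rho)]
    & GRing.closed_field_axiom k ->
      classC (ringRt k) /\ group_isomorphic (Cl (ringRt k)) 'Z_2].
Proof.
have M0 := modelR hk; have [a [z [al [b [be M1]]]]] := modelRt hk.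
split; first exact: (stably_isomorphic hk M0 M1).
- exact: (not_isomorphic hk M0 M1).
- exists (weight_aut k), (surf_action M1); split.
  + exact: (weight_nontrivial hk).
  + exact: surf_effective.
  + exact: (surf_fixed_point_free hk).
move=> kcl; have [i [psi [ii ch]]] := model_chart hk kcl M1.
have [gen [v w]] := weights hk kcl M1 ii ch.
split; last exact: (class_group_Z2 w).
split.
- by split; [apply: (model_affine M1) | apply: (model_normal hk kcl M1)].
- exact: (krull_dim2 hk kcl M1 ii ch).
- exact: (model_units hk kcl M1).
- exact: (ML_proper M1).
- by move=> D; apply: (LND_kernel_line hk M1).
Qed.
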